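(* Let $G$ be a simply connected domain whose boundary does not reduce to a single point, let $D$ be the open unit disk, let $\varphi$ be the Riemann map of $G$ (a univalent analytic function mapping $G$ onto $D$), and let $\psi=\varphi^{-1}:D\to G$. Then $\psi$ extends continuously to $\overline D$ if and only if $\partial_{sn}G=\emptyset$.
   Context: A Jordan arc is the image of an injective continuous function on a closed interval $[a,b]$ (with values in the complex plane). For a domain $G$, a point $\lambda\in\partial G$ is called an accessible point of $G$ if there is a Jordan arc $J\subset\overline G$ such that $J\cap\partial G=\{\lambda\}$. Let $\partial_a G$ denote the set of accessible points of $G$, and let $\partial_n G=\partial G\setminus\partial_a G$. The same notation is used for any domain $U$ in place of $G$: $\partial_a U$ and $\partial_n U$ are defined relative to $U$. A point $\lambda\in\partial G$ is called semi-unreachable if there is a simply connected subdomain $U\subset G$ such that $\lambda\in\partial_n U$ and $\lambda\notin\overline{\partial U\cap G}$. The set of semi-unreachable points of $G$ is denoted $\partial_{sn}G$. *)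

(* Defs.v *)
From HB Require Import structures.
From mathcomp Require Import all_boot all_order all_algebra.
From mathcomp Require Import complex.
From mathcomp Require Import all_classical all_reals topology normedtype derive.

Set Implicit Arguments.
Unset Strict Implicit.
Unset Printing Implicit Defensive.

Import Order.TTheory GRing.Theory Num.Theory.
Import numFieldNormedType.Exports.

Local Open Scope classical_set_scope.
Local Open Scope ring_scope.

(* The topology of R[i]^o is that of the modulus, and derivability of a function
   from it to itself is complex differentiability. *)
Notation cplane R := (complex R)^o.

Notation sphere R := (one_point_compactification (cplane R)).

Definition boundary (T : topologicalType) (A : set T) : set T :=
  closure A `\` interior A.

Section PlaneDomains.
Context {R : realType}.
Local Notation C := (cplane R).

Definition unit_disk : set C := [set z | `|z| < 1].
Definition closed_unit_disk : set C := [set z | `|z| <= 1].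

Definition domain (G : set C) := [/\ G !=set0, open G & connected G].

Definition loop_in (G : set C) (g : R -> C) :=
  [/\ {within `[0, 1], continuous g}, g @` `[0, 1] `<=` G & g 0 = g 1].

(* In H (s, t), s is the homotopy parameter and t the loop parameter. *)
Definition null_homotopic_in (G : set C) (g : R -> C) :=
  exists H : R * R -> C,
    [/\ {within `[0, 1] `*` `[0, 1], continuous H},
        H @` (`[0, 1] `*` `[0, 1]) `<=` G,
        forall t, t \in `[0, 1] -> H (0, t) = g t,
        forall t, t \in `[0, 1] -> H (1, t) = g 0 &
        forall s, s \in `[0, 1] -> H (s, 0) = g 0 /\ H (s, 1) = g 0].

(* Path-connectedness is automatic for open connected subsets of the plane. *)
Definition simply_connected_domain (G : set C) :=
  domain G /\ forall g : R -> C, loop_in G g -> null_homotopic_in G g.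

(* The interval is nondegenerate: if a = b were allowed, every singleton would
   be an arc and every boundary point would be accessible. *)
Definition jordan_arc (J : set C) :=
  exists (a b : R) (g : R -> C),
    [/\ a < b, {within `[a, b], continuous g}, set_inj `[a, b] g &
        J = g @` `[a, b]].

Definition accessible_boundary (G : set C) : set C :=
  [set l | boundary G l /\
    exists J, [/\ jordan_arc J, J `<=` closure G & J `&` boundary G = [set l]]].

Definition nonaccessible_boundary (G : set C) : set C :=
  boundary G `\` accessible_boundary G.

Definition semi_unreachable (G : set C) : set C :=
  [set l | boundary G l /\
    exists U, [/\ simply_connected_domain U, U `<=` G,
      nonaccessible_boundary U l & ~ closure (boundary U `&` G) l]].

(* A univalent analytic function on G with image the unit disk; its values
   outside G are irrelevant. *)
Definition riemann_map (G : set C) (phi : C -> C) :=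
  (forall z, G z -> derivable phi z 1) /\ set_bij G unit_disk phi.

(* G may be unbounded, so the extension takes its values in the Riemann sphere:
   the half-plane has no semi-unreachable point, but its Riemann maps have a
   pole on the unit circle. When psi is bounded, the values stay in the plane. *)
Definition extends_continuously_to_closed_disk (psi : C -> C) :=
  exists Psi : C -> sphere R,
    {within closed_unit_disk, continuous Psi} /\
    forall w, unit_disk w -> Psi w = Some (psi w).

(* Taken on the sphere, so that G = C, with boundary {oo}, is excluded. *)
Definition sphere_boundary (G : set C) : set (sphere R) :=
  boundary (Some @` G : set (sphere R)).

End PlaneDomains.

(* Main.v *)
Require Import Defs.
From HB Require Import structures.
From mathcomp Require Import all_boot all_order all_algebra.
From mathcomp Require Import complex ring lra.
From mathcomp Require Import all_classical all_reals all_analysis.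

Import Order.TTheory GRing.Theory Num.Theory.
Import numFieldNormedType.Exports.

Local Open Scope classical_set_scope.
Local Open Scope ring_scope.

(** The extension of psi to the circle is a local matter. A Cayley map takes the disk to
    the upper half-plane H and a given point of the circle to the origin, so the question
    is whether the univalent map f = psi o cayley from H onto G has a limit at the origin,
    in the sphere.

    If psi extends, no point l is semi-unreachable. Indeed, if l were semi-unreachable
    through U, points of U tending to l would have images in the disk clustering at some
    w on the circle, where the extension takes the value l. Near l there is no boundary
    point of U inside G, so by connectedness psi maps all points of the disk near w into
    U, and the image of a radius ending at w makes l accessible from U
    (no_semi_unreachable).

    Conversely, suppose that no point is semi-unreachable.
    - The sphere has finite area, so the length-area method provides crosscuts around the
      origin, three sides of arbitrarily small rectangles standing on the real line, with
      images of small diameter (small_crosscut). These images accumulate at a point p of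
      the sphere, the only possible limit (crosscut_limit).
    - If f does not tend to p, the intermediate value theorem on vertical segments that
      end on crosscuts produces a continuum of cluster values of f at the origin
      (level_value, level_cluster).
    - Let lam be a finite cluster value other than p, and U the image of the rectangle
      behind a small crosscut. It is simply connected, and its boundary inside G lies in
      the image of the crosscut, away from lam. As lam is not semi-unreachable, it is
      accessible from U (accessible_cluster): f tends to lam along some path, which
      accumulates at a real point. This point is not the origin, because a path coming
      back to the origin would cross the crosscuts (landing).
    - So each such lam is a limit value of f along paths that land arbitrarily close to
      the origin, on the left or on the right. Two distinct values cannot land on the same
      side, since then landing points with alternating values would exist, contradicting
      the injectivity of f (no_interlacing). With three values this is absurd
      (boundary_limit).

    That landing points do not interlace is usually read off from the Jordan curve
    theorem. Here it follows from a sign computation: the difference quotient of f has no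
    zero on H x H, hence has continuous square roots, whose variation along the paths can
    be compared with that of explicit square roots (root_ratio).

    The complex analysis behind this is elementary: Goursat's argument on squares gives a
    maximum principle that tolerates exceptional points, which is applied to difference
    quotients. It yields the continuity of the difference quotient across the diagonal,
    the non-vanishing of the derivative of a univalent function, and the openness of its
    image. *)

Set Implicit Arguments.
Unset Strict Implicit.
Unset Printing Implicit Defensive.

(** * Modulus and coordinates in the plane *)

Section ComplexModulus.
Context {R : realType}.
Local Notation C := (cplane R).
Implicit Types (z w : C) (x y e : R).

(** The norm of the plane takes its values in R[i]; this is the same number in R,
    where real arithmetic applies to it. *)
Definition cabs z : R := complex.Re (`|z| : R[i]).
Definition cpx x y : C := Complex x y.
Definition cre (z : C) : R := complex.Re z.
Definition cim (z : C) : R := complex.Im z.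

Lemma normC_cabs z : `|z| = (cabs z)%:C%C.
Proof. by rewrite /cabs; case: z => a b /=. Qed.

Lemma cabs_def x y : cabs (cpx x y) = Num.sqrt (x ^+ 2 + y ^+ 2).
Proof. by []. Qed.

Lemma cabs_ge0 z : 0 <= cabs z.
Proof. by case: z => a b; rewrite cabs_def sqrtr_ge0. Qed.

Lemma cabs0 : cabs 0 = 0.
Proof. by rewrite /cabs normr0. Qed.

Lemma cabs_eq0 z : (cabs z == 0) = (z == 0).
Proof.
apply/idP/idP => [/eqP h|/eqP ->]; last by rewrite cabs0.
by rewrite -normr_eq0 normC_cabs h.
Qed.

Lemma cabs_gt0 z : (0 < cabs z) = (z != 0).
Proof. by rewrite lt_def cabs_eq0 cabs_ge0 andbT. Qed.

Lemma cabsM z w : cabs (z * w) = cabs z * cabs w.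
Proof.
by apply: (@complexI R); rewrite -normC_cabs normrM !normC_cabs rmorphM.
Qed.

Lemma cabsV z : cabs z^-1 = (cabs z)^-1.
Proof.
by apply: (@complexI R); rewrite -normC_cabs normfV !normC_cabs fmorphV.
Qed.

Lemma cabsN z : cabs (- z) = cabs z.
Proof. by rewrite /cabs normrN. Qed.

Lemma cabs1 : cabs 1 = 1.
Proof. by rewrite /cabs normr1. Qed.

Lemma cabsC z w : cabs (z - w) = cabs (w - z).
Proof. by rewrite -cabsN opprB. Qed.

Lemma cabsD z w : cabs (z + w) <= cabs z + cabs w.
Proof.
rewrite -(lecR (cabs (z + w)) _) rmorphD /= -!normC_cabs; exact: ler_normD.
Qed.

Lemma cabsX z n : cabs (z ^+ n) = cabs z ^+ n.
Proof. by elim: n => [|n IH]; rewrite ?expr0 ?cabs1 // !exprS cabsM IH. Qed.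

Lemma cabs_triangle u z w : cabs (z - w) <= cabs (z - u) + cabs (u - w).
Proof. by apply: le_trans (cabsD _ _); rewrite addrA subrK. Qed.

Lemma cabsB z w : cabs z - cabs w <= cabs (z - w).
Proof. by rewrite lerBlDr; have := cabsD (z - w) w; rewrite subrK. Qed.

Lemma cre_cabs z : `|cre z| <= cabs z.
Proof.
case: z => a b; rewrite cabs_def /= -sqrtr_sqr ler_wsqrtr // lerDl; exact: sqr_ge0.
Qed.

Lemma cim_cabs z : `|cim z| <= cabs z.
Proof.
case: z => a b; rewrite cabs_def /= -sqrtr_sqr ler_wsqrtr // lerDr; exact: sqr_ge0.
Qed.

Lemma cabs_le_re_im z : cabs z <= `|cre z| + `|cim z|.
Proof.
case: z => a b; rewrite cabs_def /=.
rewrite -[leRHS]ger0_norm ?addr_ge0 // -[leRHS]sqrtr_sqr ler_wsqrtr //.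
rewrite sqrrD !real_normK ?num_real // addrAC lerDl mulrn_wge0 //.
Qed.

Lemma cpxE z : z = cpx (cre z) (cim z).
Proof. by case: z. Qed.

Lemma cpx_real x : cabs (cpx x 0) = `|x|.
Proof. by rewrite cabs_def expr0n addr0 sqrtr_sqr. Qed.

Lemma cpx_imag y : cabs (cpx 0 y) = `|y|.
Proof. by rewrite cabs_def expr0n add0r sqrtr_sqr. Qed.

Lemma creD z w : cre (z + w) = cre z + cre w. Proof. by case: z; case: w. Qed.
Lemma cimD z w : cim (z + w) = cim z + cim w. Proof. by case: z; case: w. Qed.
Lemma creN z : cre (- z) = - cre z. Proof. by case: z. Qed.
Lemma cimN z : cim (- z) = - cim z. Proof. by case: z. Qed.
Lemma creM z w : cre (z * w) = cre z * cre w - cim z * cim w.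
Proof. by case: z; case: w. Qed.
Lemma cimM z w : cim (z * w) = cre z * cim w + cim z * cre w.
Proof. by case: z; case: w. Qed.
Lemma cre_cpx x y : cre (cpx x y) = x. Proof. by []. Qed.
Lemma cim_cpx x y : cim (cpx x y) = y. Proof. by []. Qed.
Lemma cre0 : cre 0 = 0. Proof. by []. Qed.
Lemma cim0 : cim 0 = 0. Proof. by []. Qed.
Lemma cre1 : cre 1 = 1. Proof. by []. Qed.
Lemma cim1 : cim 1 = 0. Proof. by []. Qed.
Definition cE := (creD, cimD, creN, cimN, creM, cimM, cre_cpx, cim_cpx,
  cre0, cim0, cre1, cim1).

Lemma cpx_inj z w : cre z = cre w -> cim z = cim w -> z = w.
Proof. by case: z => a b; case: w => c d /= -> ->. Qed.

Lemma sqr_cabs z : cabs z ^+ 2 = cre z ^+ 2 + cim z ^+ 2.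
Proof. by case: z => a b; rewrite cabs_def sqr_sqrtr ?addr_ge0 ?sqr_ge0. Qed.

Definition disk z e : set C := [set w | cabs (w - z) < e].

Lemma nbhs_disk z (A : set C) :
  nbhs z A <-> exists2 e, 0 < e & disk z e `<=` A.
Proof.
split.
  move=> /nbhs_ballP[e /= e0 eA]; have [ere eim] : e = (complex.Re e)%:C%C /\ 0 < complex.Re e.
    by move: e0; rewrite ltcE /= => /andP[/eqP h1 h2]; split => //;
      case: (e) h1 => ? ? /= ->.
  exists (complex.Re e) => // w; rewrite /disk /= => wz; apply: eA.
  by rewrite -ball_normE /= normC_cabs cabsC ere ltcR.
move=> [e e0 eA]; apply/nbhs_ballP; exists (e%:C%C) => /=; first by rewrite ltcR.
by move=> w; rewrite -ball_normE /= normC_cabs cabsC ltcR => h; apply: eA.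
Qed.

Lemma disk_nbhs z e : 0 < e -> nbhs z (disk z e).
Proof. by move=> e0; apply/nbhs_disk; exists e. Qed.

Lemma open_disk (G : set C) z : open G -> G z ->
  exists2 e, 0 < e & disk z e `<=` G.
Proof. by move=> oG Gz; apply/nbhs_disk; apply: open_nbhs_nbhs. Qed.

Lemma disk_open (G : set C) :
  (forall z, G z -> exists2 e, 0 < e & disk z e `<=` G) -> open G.
Proof.
by move=> h; rewrite openE => z Gz; apply/nbhs_disk; apply: h.
Qed.

End ComplexModulus.

(** * Primitives and bisection *)

Section Real.
Context {R : realType}.
Implicit Types (h P : R -> R) (a b x y s t m e : R).

Lemma continuous_primitive h a b : continuous h ->
  exists P, forall x, a < x -> x < b -> is_derive x 1 P (h x).
Proof.
move=> ch; exists (fun x => \int[lebesgue_measure]_(t in `[a, x]) h t)%R.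
move=> x ax xb.
have ih : (@lebesgue_measure R).-integrable `[a, b] (EFin \o h).
  apply: continuous_compact_integrable; first exact: segment_compact.
  exact: continuous_subspaceT.
have [df <-] := @continuous_FTC1_closed R h a x b xb ih ax (ch x).
by rewrite derive1E; apply/derivableP.
Qed.

Lemma increment_le P h a b m : a <= b ->
  (forall x, a <= x <= b -> is_derive x 1 P (h x)) ->
  (forall x, a <= x <= b -> h x <= m) -> P b - P a <= m * (b - a).
Proof.
move=> ab dP hm.
have [||c + ->] := @MVT_segment R P h a b ab.
- by move=> x; rewrite in_itv /= => /andP[ax xb]; apply: dP; rewrite !ltW.
- apply: derivable_within_continuous => x; rewrite in_itv /= => /dP ?.
  exact: ex_derive.
by rewrite in_itv /= => hc; rewrite ler_wpM2r ?subr_ge0 // hm.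
Qed.

Lemma increment_ge P h a b m : a <= b ->
  (forall x, a <= x <= b -> is_derive x 1 P (h x)) ->
  (forall x, a <= x <= b -> m <= h x) -> m * (b - a) <= P b - P a.
Proof.
move=> ab dP hm.
have : (- P) b - (- P) a <= - m * (b - a).
  apply: (@increment_le _ (fun x => - h x)) => // x hx; last by rewrite lerN2 hm.
  by have := dP x hx => ?; apply: is_deriveN.
by rewrite !fctE; lra.
Qed.

Lemma derive_quadratic A B x :
  is_derive x (1 : R) (A \*: id + (B / 2) \*: (id * id) : R -> R) (A + B * x).
Proof.
have d1 : is_derive x (1 : R) (id : R -> R) 1 by exact: is_derive_id.
have d2 := is_deriveD (is_deriveZ A d1) (is_deriveZ (B / 2) (is_deriveM d1 d1)).
by apply: is_derive_eq d2 _; rewrite /GRing.scale /=; field.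
Qed.

(** The form of the mean value inequality that a Goursat estimate needs: a
    derivative close to an affine function has increments close to those of the
    quadratic primitive of that function. *)
Lemma increment_affine P h a b A B m : a <= b ->
  (forall x, a <= x <= b -> is_derive x 1 P (h x)) ->
  (forall x, a <= x <= b -> `|h x - (A + B * x)| <= m) ->
  `|P b - P a - (A * (b - a) + B * (b ^+ 2 - a ^+ 2) / 2)| <= m * (b - a).
Proof.
move=> ab dP hm.
pose K : R -> R := P - (A \*: id + (B / 2) \*: (id * id)).
have dK x : a <= x <= b -> is_derive x 1 K (h x - (A + B * x)).
  by move=> /dP dPx; exact: is_deriveB dPx (derive_quadratic A B x).
have -> : P b - P a - (A * (b - a) + B * (b ^+ 2 - a ^+ 2) / 2) = K b - K a.
    rewrite /K; change (P b - P a - (A * (b - a) + B * (b ^+ 2 - a ^+ 2) / 2) =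
    P b - (A * b + B / 2 * (b * b)) - (P a - (A * a + B / 2 * (a * a)))).
  by field.
rewrite ler_norml -mulNr; apply/andP; split.
  by apply: (increment_ge ab dK) => x /hm; rewrite ler_norml => /andP[].
by apply: (increment_le ab dK) => x /hm; rewrite ler_norml => /andP[].
Qed.

(** Cousin's lemma for rectangles: if the property failed, one could halve forever
    and the rectangles would shrink to a point, near which it holds. All rectangles
    keep the proportions of the first one, so one scale s describes their size. *)
Lemma rectangle_bisection (w h X Y : R) (Pr : R -> R -> R -> Prop) :
  0 <= w -> 0 <= h ->
  (forall x y s, 0 < s -> Pr x y (s / 2) -> Pr (x + s / 2 * w) y (s / 2) ->
     Pr x (y + s / 2 * h) (s / 2) -> Pr (x + s / 2 * w) (y + s / 2 * h) (s / 2) ->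
     Pr x y s) ->
  (forall p q, X <= p <= X + w -> Y <= q <= Y + h ->
     exists2 d, 0 < d & forall x y s, 0 < s < d ->
       X <= x -> x + s * w <= X + w -> Y <= y -> y + s * h <= Y + h ->
       x <= p <= x + s * w -> y <= q <= y + s * h -> Pr x y s) ->
  Pr X Y 1.
Proof.
move=> w0 h0 sub loc; apply: contrapT => nP.
have nxt (u : R * R * nat) : exists v : R * R * nat,
    ~ Pr u.1.1 u.1.2 (2^-1 ^+ u.2) ->
    (~ Pr v.1.1 v.1.2 (2^-1 ^+ v.2) /\ v.2 = u.2.+1) /\
    [/\ u.1.1 <= v.1.1, v.1.1 + 2^-1 ^+ v.2 * w <= u.1.1 + 2^-1 ^+ u.2 * w,
     u.1.2 <= v.1.2 & v.1.2 + 2^-1 ^+ v.2 * h <= u.1.2 + 2^-1 ^+ u.2 * h].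
  case: u => [[x y] n] /=; set s := 2^-1 ^+ n.
  have s0 : 0 < s by rewrite exprn_gt0 // invr_gt0.
  have sE : 2^-1 ^+ n.+1 = s / 2 by rewrite exprSr.
  have hs0 : 0 < s / 2 by rewrite divr_gt0.
  have hw : 0 <= s / 2 * w by rewrite mulr_ge0 // ltW.
  have hh : 0 <= s / 2 * h by rewrite mulr_ge0 // ltW.
  have dw : s * w = s / 2 * w + s / 2 * w by field.
  have dh : s * h = s / 2 * h + s / 2 * h by field.
  have [nPr|/contrapT Pr0] := pselect (~ Pr x y s); last by exists (x, y, n).
  have [?|n1] := pselect (Pr x y (s / 2)); last first.
    by exists (x, y, n.+1) => _ /=; rewrite sE dw dh; split => //; split; lra.
  have [?|n1] := pselect (Pr (x + s / 2 * w) y (s / 2)); last first.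
    by exists (x + s / 2 * w, y, n.+1) => _ /=; rewrite sE dw dh; split => //; split; lra.
  have [?|n1] := pselect (Pr x (y + s / 2 * h) (s / 2)); last first.
    by exists (x, y + s / 2 * h, n.+1) => _ /=; rewrite sE dw dh; split => //; split; lra.
  have [?|n1] := pselect (Pr (x + s / 2 * w) (y + s / 2 * h) (s / 2)); last first.
    by exists (x + s / 2 * w, y + s / 2 * h, n.+1) => _ /=; rewrite sE dw dh;
      split => //; split; lra.
  by exfalso; apply: nPr; apply: sub.
have [F FP] := choice nxt.
pose u n := iter n F (X, Y, 0%N).
have uP n : [/\ ~ Pr (u n).1.1 (u n).1.2 (2^-1 ^+ (u n).2) & (u n).2 = n].
  elim: n => [|n [IH1 IH2]]; first by rewrite /= expr0.
  by rewrite /u iterS -/(u n); have [[h1 e1] _] := FP _ IH1; split=> //; rewrite e1 IH2.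
have step n : [/\ (u n).1.1 <= (u n.+1).1.1,
    (u n.+1).1.1 + 2^-1 ^+ n.+1 * w <= (u n).1.1 + 2^-1 ^+ n * w,
    (u n).1.2 <= (u n.+1).1.2 &
    (u n.+1).1.2 + 2^-1 ^+ n.+1 * h <= (u n).1.2 + 2^-1 ^+ n * h].
  have [nP1 e1] := uP n; have [_ e2] := uP n.+1.
  by have [_] := FP _ nP1; rewrite -[F _]/(u n.+1) e2 e1.
have nest k (pr : R * R -> R) (v : R) : 0 <= v ->
   (forall n, pr (u n).1 <= pr (u n.+1).1 /\
     pr (u n.+1).1 + 2^-1 ^+ n.+1 * v <= pr (u n).1 + 2^-1 ^+ n * v) ->
   pr (u k).1 <= sup (range (fun n => pr (u n).1)) <= pr (u k).1 + 2^-1 ^+ k * v.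
  move=> v0 hs.
  have mono n j : pr (u n).1 <= pr (u (n + j)%N).1.
    elim: j => [|j IH]; first by rewrite addn0.
    by rewrite addnS; exact: le_trans IH (hs (n + j)%N).1.
  have mono2 n j : pr (u (n + j)%N).1 + 2^-1 ^+ (n + j) * v <= pr (u n).1 + 2^-1 ^+ n * v.
    elim: j => [|j IH]; first by rewrite addn0.
    by rewrite addnS; exact: le_trans (hs (n + j)%N).2 IH.
  have ub n : pr (u n).1 <= pr (u k).1 + 2^-1 ^+ k * v.
    apply: (le_trans (mono n k)); rewrite addnC; apply: le_trans (mono2 k n).
    by rewrite lerDl mulr_ge0 // exprn_ge0 // invr_ge0.
  have hsup : has_sup (range (fun n => pr (u n).1)).
    split; first by exists (pr (u 0%N).1); exists 0%N.
    by exists (pr (u k).1 + 2^-1 ^+ k * v) => _ [n _ <-].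
  apply/andP; split; first by apply: sup_upper_bound => //; exists k.
  by apply: sup_le_ub; [exact: (proj1 hsup)|move=> _ [n _ <-]].
pose p := sup (range (fun n => (u n).1.1)).
pose q := sup (range (fun n => (u n).1.2)).
have pb k : (u k).1.1 <= p <= (u k).1.1 + 2^-1 ^+ k * w.
  by apply: (nest k fst) => // n; have [] := step n.
have qb k : (u k).1.2 <= q <= (u k).1.2 + 2^-1 ^+ k * h.
  by apply: (nest k snd) => // n; have [] := step n.
have inb k : [/\ X <= (u k).1.1, (u k).1.1 + 2^-1 ^+ k * w <= X + w,
    Y <= (u k).1.2 & (u k).1.2 + 2^-1 ^+ k * h <= Y + h].
  elim: k => [|k [i1 i2 i3 i4]]; first by rewrite /= expr0 !mul1r; split.
  have [s1 s2 s3 s4] := step k.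
  by split; [exact: le_trans s1|exact: le_trans s2 _|exact: le_trans s3|exact: le_trans s4 _].
have [||d d0 dP] := loc p q.
- by have := pb 0%N; rewrite /= expr0 mul1r.
- by have := qb 0%N; rewrite /= expr0 mul1r.
have [k kd] : exists k, 2^-1 ^+ k < d.
  have /cvgrPdist_lt /(_ d d0) [k _ /(_ k (leqnn k))] :=
    @cvg_geometric R 1 2^-1 ltac:(by rewrite ger0_norm ?invf_lt1 ?invr_ge0 // ltr1n).
  rewrite sub0r normrN /geometric /= mul1r ger0_norm ?exprn_ge0 ?invr_ge0 //.
  by exists k.
have [nPk e2] := uP k; rewrite e2 in nPk; apply: nPk.
have [i1 i2 i3 i4] := inb k.
by apply: dP => //; rewrite kd exprn_gt0 // invr_gt0.
Qed.


End Real.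

(** * Vanishing circulation *)

Section Real.
Context {R : realType}.
(** Goursat's argument for the differential form a dx + b dy. The partial primitives
    A and B replace integrals along the sides of a rectangle: an increment of A in x
    is the integral of a along a horizontal side. *)
Section Green.
Variables (a b A B : R -> R -> R) (x0 x1 y0 y1 : R).
Hypotheses (x01 : x0 <= x1) (y01 : y0 <= y1).
Hypothesis dA : forall x y, x0 <= x <= x1 -> y0 <= y <= y1 ->
  is_derive x 1 (fun t => A t y) (a x y).
Hypothesis dB : forall x y, x0 <= x <= x1 -> y0 <= y <= y1 ->
  is_derive y 1 (B x) (b x y).

Definition circulation (u v u' v' : R) :=
  (A v u' - A u u') - (A v v' - A u v') + (B v v' - B v u') - (B u v' - B u u').

(** The form is differentiable with symmetric differential (the coefficient a2 occurs
    twice), so on a small rectangle of size r it differs from an exact form by e * r,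
    and its circulation is at most a multiple of e * r ^ 2. Bisection adds these up
    to a multiple of e. *)
Lemma circulation_eq0 :
  (forall p q, x0 <= p <= x1 -> y0 <= q <= y1 ->
    exists a0 a1 a2 b0 b2 : R, forall e : R, 0 < e -> exists2 d : R, 0 < d &
      forall x y, x0 <= x <= x1 -> y0 <= y <= y1 -> `|x - p| < d -> `|y - q| < d ->
       `|a x y - (a0 + a1 * (x - p) + a2 * (y - q))| <= e * (`|x - p| + `|y - q|) /\
       `|b x y - (b0 + a2 * (x - p) + b2 * (y - q))| <= e * (`|x - p| + `|y - q|)) ->
  circulation x0 x1 y0 y1 = 0.
Proof.
move=> loc; set w := x1 - x0; set h := y1 - y0.
have w0 : 0 <= w by rewrite subr_ge0.
have h0 : 0 <= h by rewrite subr_ge0.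
have xw : x0 + w = x1 by rewrite addrC subrK.
have yh : y0 + h = y1 by rewrite addrC subrK.
suff H (e : R) : 0 < e -> `|circulation x0 x1 y0 y1| <= 2 * e * (w + h) ^+ 2.
  apply/eqP; rewrite -normr_le0; apply/ler_addgt0Pl => e e0; rewrite addr0.
  have k0 : 0 < 2 * ((w + h) ^+ 2 + 1) by rewrite mulr_gt0 // ltr_wpDl // sqr_ge0.
  have := H (e / (2 * ((w + h) ^+ 2 + 1))) ltac:(by rewrite divr_gt0).
  move=> /le_trans; apply; rewrite [2 * _]mulrC -mulrA.
  rewrite -mulrA ler_piMr ?(ltW e0) // mulrC ler_pdivrMr // mul1r.
  by rewrite ler_pM2l // lerDl.
move=> e0.
have := @rectangle_bisection R w h x0 y0 (fun x y s =>
  `|circulation x (x + s * w) y (y + s * h)| <= 2 * e * (s * w + s * h) ^+ 2) w0 h0.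
rewrite !mul1r xw yh; apply.
  move=> x y s s0 h1 h2 h3 h4.
  have -> : circulation x (x + s * w) y (y + s * h) =
    circulation x (x + s / 2 * w) y (y + s / 2 * h) +
    circulation (x + s / 2 * w) (x + s / 2 * w + s / 2 * w) y (y + s / 2 * h) +
    circulation x (x + s / 2 * w) (y + s / 2 * h) (y + s / 2 * h + s / 2 * h) +
    circulation (x + s / 2 * w) (x + s / 2 * w + s / 2 * w) (y + s / 2 * h) (y + s / 2 * h + s / 2 * h).
    have -> : x + s * w = x + s / 2 * w + s / 2 * w by field.
    have -> : y + s * h = y + s / 2 * h + s / 2 * h by field.
    by rewrite /circulation; ring.
  have -> : 2 * e * (s * w + s * h) ^+ 2 = 2 * e * (s / 2 * w + s / 2 * h) ^+ 2 +
    2 * e * (s / 2 * w + s / 2 * h) ^+ 2 + 2 * e * (s / 2 * w + s / 2 * h) ^+ 2 +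
    2 * e * (s / 2 * w + s / 2 * h) ^+ 2 by field.
  by do 3 (apply: le_trans (ler_normD _ _) _; apply: lerD => //).
move=> p q pin qin.
have wh1 : 0 < 1 + w + h by lra.
have [a0 [a1 [a2 [b0 [b2 /(_ e e0)[d d0 H]]]]]] := loc p q pin qin.
exists (d / (1 + w + h)); first by rewrite divr_gt0.
move=> x y s /andP[s0 sd] xx0 xx1 yy0 yy1 px qy.
set u := x + s * w in xx1 px *; set v := y + s * h in yy1 qy *.
have sw : 0 <= s * w by rewrite mulr_ge0 // ltW.
have sh : 0 <= s * h by rewrite mulr_ge0 // ltW.
have sdd : s * w + s * h < d.
  rewrite ltr_pdivlMr // in sd.
  by move: sd; rewrite !mulrDr mulr1; lra.
have inx t : x <= t <= u -> x0 <= t <= x1.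
  by move=> /andP[h1 h2]; rewrite (le_trans xx0 h1) (le_trans h2 xx1).
have iny t : y <= t <= v -> y0 <= t <= y1.
  by move=> /andP[h1 h2]; rewrite (le_trans yy0 h1) (le_trans h2 yy1).
have xu : x <= u by rewrite lerDl.
have yv : y <= v by rewrite lerDl.
have M t y' : x <= t <= u -> y <= y' <= v ->
  `|a t y' - (a0 + a1 * (t - p) + a2 * (y' - q))| <= e * (s * w + s * h) /\
  `|b t y' - (b0 + a2 * (t - p) + b2 * (y' - q))| <= e * (s * w + s * h).
  move=> ht hy.
  have n1 : `|t - p| <= s * w by rewrite ler_norml; rewrite /u in ht px; lra.
  have n2 : `|y' - q| <= s * h by rewrite ler_norml; rewrite /v in hy qy; lra.
  have n3 : `|t - p| < d by apply: le_lt_trans n1 (le_lt_trans _ sdd); rewrite lerDl.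
  have n4 : `|y' - q| < d by apply: le_lt_trans n2 (le_lt_trans _ sdd); rewrite lerDr.
  have [c1 c2] := H t y' (inx t ht) (iny y' hy) n3 n4.
  have k : e * (`|t - p| + `|y' - q|) <= e * (s * w + s * h).
    by rewrite ler_pM2l // lerD.
  by split; [exact: le_trans c1 k|exact: le_trans c2 k].
have EA y' : y <= y' <= v ->
  `|A u y' - A x y' - ((a0 - a1 * p + a2 * (y' - q)) * (u - x) + a1 * (u ^+ 2 - x ^+ 2) / 2)|
    <= e * (s * w + s * h) * (u - x).
  move=> hy; apply: (@increment_affine R (fun t => A t y') (fun t => a t y')) => // t ht.
    by apply: dA; [exact: inx|exact: iny].
  have [+ _] := M t y' ht hy; congr (`| _ | <= _); ring.
have EB t : x <= t <= u ->
  `|B t v - B t y - ((b0 + a2 * (t - p) - b2 * q) * (v - y) + b2 * (v ^+ 2 - y ^+ 2) / 2)|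
    <= e * (s * w + s * h) * (v - y).
  move=> ht; apply: (@increment_affine R (B t) (b t)) => // y' hy.
    by apply: dB; [exact: inx|exact: iny].
  have [_] := M t y' ht hy; congr (`| _ | <= _); ring.
have := EA y; have := EA v; have := EB x; have := EB u.
rewrite !lexx xu yv => /(_ isT) E1 /(_ isT) E2 /(_ isT) E3 /(_ isT) E4.
rewrite /circulation.
have -> : A u y - A x y - (A u v - A x v) + (B u v - B u y) - (B x v - B x y) =
  (A u y - A x y - ((a0 - a1 * p + a2 * (y - q)) * (u - x) + a1 * (u ^+ 2 - x ^+ 2) / 2)) -
  (A u v - A x v - ((a0 - a1 * p + a2 * (v - q)) * (u - x) + a1 * (u ^+ 2 - x ^+ 2) / 2)) +
  (B u v - B u y - ((b0 + a2 * (u - p) - b2 * q) * (v - y) + b2 * (v ^+ 2 - y ^+ 2) / 2)) -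
  (B x v - B x y - ((b0 + a2 * (x - p) - b2 * q) * (v - y) + b2 * (v ^+ 2 - y ^+ 2) / 2)).
  by field.
have -> : 2 * e * (s * w + s * h) ^+ 2 = e * (s * w + s * h) * (u - x) +
  e * (s * w + s * h) * (u - x) + e * (s * w + s * h) * (v - y) +
  e * (s * w + s * h) * (v - y) by rewrite /u /v; ring.
do 3 (apply: le_trans (ler_normD _ _) _; rewrite ?normrN; apply: lerD => //).
Qed.
End Green.

End Real.

(** * Continuity and complex differentiability with real bounds *)

Section EpsilonDelta.
Context {R : realType}.
Local Notation C := (cplane R).
Implicit Types (f g : C -> C) (z w l : C) (e d : R).

(** Multiplying by the distance avoids dividing by w - z, so that w = z is not a
    special case. *)
Definition has_deriv f z l := forall e : R, 0 < e -> exists2 d : R, 0 < d &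
  forall w, cabs (w - z) < d -> cabs (f w - f z - l * (w - z)) <= e * cabs (w - z).

Lemma nearC z (P : C -> Prop) : (\forall w \near z, P w) <->
  exists2 d : R, 0 < d & forall w, cabs (w - z) < d -> P w.
Proof. exact: nbhs_disk. Qed.

Lemma continuousC f z : {for z, continuous f} <->
  forall e : R, 0 < e -> exists2 d : R, 0 < d & forall w, cabs (w - z) < d -> cabs (f w - f z) < e.
Proof.
split.
  by move=> cf e e0; apply/nearC; exact: (cf _ (disk_nbhs (f z) e0)).
move=> h A /nbhs_disk[e e0 eA]; have [d d0 H] := h e e0.
by apply/nbhs_disk; exists d => // w wd; apply: eA; exact: H.
Qed.

Lemma derivable_has_deriv f z : derivable f z 1 -> has_deriv f z ('D_1 f z).
Proof.
move=> df e e0.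
have : (fun h : C => h^-1 *: ((f \o shift z) (h *: 1) - f z)) @ (0 : C)^' --> 'D_1 f z by exact: df.
move=> /(_ _ (disk_nbhs _ e0)) /=; rewrite /nbhs /= => /nearC[d d0 H].
exists d => // w wd; have [->|wz] := eqVneq w z.
  by rewrite !subrr mulr0 subr0 cabs0 mulr0.
have := H (w - z); rewrite subr0 => /(_ wd); rewrite subr_eq0 => /(_ wz).
rewrite /disk /= scaler1 /= subrK => H1.
have wz0 : w - z != 0 by rewrite subr_eq0.
have -> : f w - f z - 'D_1 f z * (w - z) =
   ((w - z)^-1 * (f w - f z) - 'D_1 f z) * (w - z).
  by rewrite mulrBl mulrAC mulVf // mul1r.
by rewrite cabsM ler_wpM2r ?cabs_ge0 // ltW.
Qed.

Lemma has_deriv_is_derive f z l : has_deriv f z l -> is_derive z (1 : C) f l.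
Proof.
move=> h.
have k : (fun h : C => h^-1 *: ((f \o shift z) (h *: 1) - f z)) @ (0 : C)^' --> l.
  move=> A /nbhs_disk[e e0 eA]; have [d d0 H] := h (e / 2) ltac:(by rewrite divr_gt0).
  rewrite /nbhs /=; apply/nearC; exists d => // t; rewrite subr0 => td t0.
  apply: eA; rewrite /disk /= scaler1 /=.
  have := H (t + z); rewrite addrK => /(_ td) H1.
  have t1 : 0 < cabs t by rewrite cabs_gt0.
  rewrite -(ltr_pM2r t1) -cabsM mulrBl [_^-1 *: _]/(_^-1 * _) mulrAC mulVf // mul1r.
  apply: le_lt_trans H1 _; rewrite ltr_pM2r //; lra.
by split; [apply/cvg_ex; exists l|exact: cvg_lim].
Qed.

Lemma has_deriv_derivable f z l : has_deriv f z l -> derivable f z 1.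
Proof. by move=> /has_deriv_is_derive /@ex_derive. Qed.

Lemma derivableC_continuous f z : derivable f z 1 -> {for z, continuous f}.
Proof. by move=> df; apply: differentiable_continuous; exact/derivable1_diffP. Qed.

Lemma cre_continuous : continuous (@cre R).
Proof.
move=> z A /nbhs_ballP[e /= e0 eA]; apply/nbhs_disk; exists e => // w wz; apply: eA.
rewrite -ball_normE /= distrC; apply: le_lt_trans wz; rewrite -creN -creD.
exact: cre_cabs.
Qed.

Lemma cim_continuous : continuous (@cim R).
Proof.
move=> z A /nbhs_ballP[e /= e0 eA]; apply/nbhs_disk; exists e => // w wz; apply: eA.
rewrite -ball_normE /= distrC; apply: le_lt_trans wz; rewrite -cimN -cimD.
exact: cim_cabs.
Qed.

Lemma cabs_continuous : continuous (@cabs R).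
Proof.
move=> z A /nbhs_ballP[e /= e0 eA]; apply/nbhs_disk; exists e => // w wz; apply: eA.
rewrite -ball_normE /= distrC; apply: le_lt_trans wz; rewrite ler_norml cabsB.
by rewrite andbT cabsC lerNl opprB; exact: cabsB.
Qed.

Lemma cpx_continuous (T : topologicalType) (a b : T -> R) t :
  {for t, continuous a} -> {for t, continuous b} ->
  {for t, continuous (fun t => cpx (a t) (b t))}.
Proof.
move=> ca cb A /nbhs_disk[e e0 eA].
have e2 : 0 < e / 2 by rewrite divr_gt0.
have h1 : \forall s \near t, `|a t - a s| < e / 2 by move/cvgrPdist_lt: ca; exact.
have h2 : \forall s \near t, `|b t - b s| < e / 2 by move/cvgrPdist_lt: cb; exact.
apply: filterS2 h1 h2 => s h1 h2; apply: eA; rewrite /disk /=.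
apply: le_lt_trans (cabs_le_re_im _) _; rewrite !cE distrC [X in _ + X]distrC; lra.
Qed.

Section Arithmetic.
Context {T : topologicalType}.
Implicit Types (u v : T -> C) (t : T).
Lemma cts_cst (k : C) t : {for t, continuous (fun _ : T => k)}.
Proof. exact: cst_continuous. Qed.
Lemma ctsM u v t : {for t, continuous u} -> {for t, continuous v} ->
  {for t, continuous (fun t => u t * v t)}.
Proof. by move=> cu cv; exact: (cvgM cu cv). Qed.
Lemma ctsD u v t : {for t, continuous u} -> {for t, continuous v} ->
  {for t, continuous (fun t => u t + v t)}.
Proof. by move=> cu cv; exact: (cvgD cu cv). Qed.
Lemma ctsB u v t : {for t, continuous u} -> {for t, continuous v} ->
  {for t, continuous (fun t => u t - v t)}.
Proof. by move=> cu cv; exact: (cvgB cu cv). Qed.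
Lemma ctsV v t : {for t, continuous v} -> v t != 0 -> {for t, continuous (fun t => (v t)^-1)}.
Proof. by move=> cv h; exact: (cvgV h cv). Qed.
Lemma cts_div u v t : {for t, continuous u} -> {for t, continuous v} -> v t != 0 ->
  {for t, continuous (fun t => u t / v t)}.
Proof. by move=> cu cv h; exact: (cvgM cu (cvgV h cv)). Qed.
End Arithmetic.

Lemma cts_id z : {for z, continuous (fun z : C => z)}.
Proof. exact: cvg_id. Qed.

End EpsilonDelta.

(** * Cauchy's theorem on a square with an exceptional point *)

Section Square.
Context {R : realType}.
Local Notation C := (cplane R).
Implicit Types (u g : C -> C) (z w l c : C) (e d r m : R).

Definition square c r : set C := [set z | `|cre (z - c)| <= r /\ `|cim (z - c)| <= r].
Definition square_edge c r : set C :=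
  [set z | square c r z /\ (`|cre (z - c)| = r \/ `|cim (z - c)| = r)].

(** Composing with this retraction extends a function from the square to the plane
    continuously, so that it has primitives along every line. *)
Definition clamp r x : R := Num.max (- r) (Num.min r x).

Lemma clamp_in r x : 0 <= r -> - r <= clamp r x <= r.
Proof. by move=> r0; rewrite /clamp le_max lexx ge_max ge_min lexx /=; lra. Qed.

Lemma clamp_id r x : - r <= x <= r -> clamp r x = x.
Proof. by move=> /andP[h1 h2]; rewrite /clamp min_r // max_r. Qed.

Lemma clamp_continuous r : continuous (clamp r).
Proof.
move=> x; apply: (@continuous_max _ _ (fun=> - r : R^o) (fun x => Num.min r x : R^o)).
  exact: cvg_cst.
by apply: (@continuous_min _ _ (fun=> r : R^o) (fun x => x : R^o)); [exact: cvg_cst|exact: cvg_id].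
Qed.

(** The square is cut into nine rectangles around a small central square. The outer
    eight contribute nothing, and the contribution of the central one tends to zero
    with its size because g is bounded near c. The form is the imaginary part of
    g dz, which detects the residue of 1 / (z - c). *)
Lemma square_punctured_circulation g c r :
  0 < r -> (forall z, square c r z -> {for z, continuous g}) ->
  (forall z, square c r z -> z != c -> derivable g z 1) ->
  exists A B : R -> R -> R,
   [/\ forall x y, - r <= x <= r -> - r <= y <= r ->
         is_derive x 1 (fun t => A t y) (cim (g (c + cpx x y))),
       forall x y, - r <= x <= r -> - r <= y <= r ->
         is_derive y 1 (B x) (cre (g (c + cpx x y))) &
       circulation A B (- r) r (- r) r = 0].
Proof.
move=> r0 cg dg.
pose a x y := cim (g (c + cpx (clamp r x) (clamp r y))).
pose b x y := cre (g (c + cpx (clamp r x) (clamp r y))).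
have insq x y : square c r (c + cpx (clamp r x) (clamp r y)).
  have := clamp_in x (ltW r0); have := clamp_in y (ltW r0).
  by rewrite /square /= addrAC subrr add0r !cE !ler_norml.
have cc (f1 f2 : R -> R) : continuous f1 -> continuous f2 ->
    continuous (fun t => g (c + cpx (clamp r (f1 t)) (clamp r (f2 t)))).
  move=> c1 c2 t.
  apply: (@continuous_comp _ _ _ (fun t => c + cpx (clamp r (f1 t)) (clamp r (f2 t))) g).
    apply: (@cvgD _ C); first exact: cvg_cst.
    apply: (@cpx_continuous R _ (fun t => clamp r (f1 t)) (fun t => clamp r (f2 t))).
      by apply: (@continuous_comp _ _ _ f1 (clamp r)); [exact: c1|exact: clamp_continuous].
    by apply: (@continuous_comp _ _ _ f2 (clamp r)); [exact: c2|exact: clamp_continuous].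
  exact: cg.
have ca y : continuous (a ^~ y).
  move=> t; apply: (@continuous_comp _ _ _ _ (@cim R)); last exact: cim_continuous.
  by apply: (cc id (fun=> y)) => s; [exact: cvg_id|exact: cvg_cst].
have cb x : continuous (b x).
  move=> t; apply: (@continuous_comp _ _ _ _ (@cre R)); last exact: cre_continuous.
  by apply: (cc (fun=> x) id) => s; [exact: cvg_cst|exact: cvg_id].
have [A HA] := choice (fun y => continuous_primitive (- r - 1) (r + 1) (ca y)).
have [B HB] := choice (fun x => continuous_primitive (- r - 1) (r + 1) (cb x)).
have dA x y : - r <= x <= r -> - r <= y <= r ->
   is_derive x 1 (fun t => A y t) (cim (g (c + cpx x y))).
  move=> hx hy; have := HA y x; rewrite /a !clamp_id //; apply; lra.
have dB x y : - r <= x <= r -> - r <= y <= r ->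
   is_derive y 1 (B x) (cre (g (c + cpx x y))).
  move=> hx hy; have := HB x y; rewrite /b !clamp_id //; apply; lra.
exists (fun x y => A y x), B; split => //.
set J := circulation _ _.
have J0 x0 x1 y0 y1 : - r <= x0 <= x1 -> x1 <= r -> - r <= y0 <= y1 -> y1 <= r ->
   (forall x y, x0 <= x <= x1 -> y0 <= y <= y1 -> c + cpx x y != c) ->
   J x0 x1 y0 y1 = 0.
  move=> hx0 hx1 hy0 hy1 off.
  apply: (@circulation_eq0 _ (fun x y => cim (g (c + cpx x y))) (fun x y => cre (g (c + cpx x y)))).
  - lra.
  - lra.
  - by move=> x y hx hy; apply: dA; lra.
  - by move=> x y hx hy; apply: dB; lra.
  move=> p q hp hq; set z := c + cpx p q.
  have zs : square c r z.
    by rewrite /square /= /z addrAC subrr add0r !cE !ler_norml; split; lra.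
  have /derivable_has_deriv H := dg z zs (off p q hp hq).
  set l := 'D_1 g z in H.
  exists (cim (g z)), (cim l), (cre l), (cre (g z)), (- cim l) => e e0.
  have [d d0 {}H] := H e e0.
  exists (d / 2); first by rewrite divr_gt0.
  move=> x y hx hy xp yq.
  have wz : c + cpx x y - z = cpx (x - p) (y - q).
    by rewrite /z; apply: cpx_inj; rewrite !cE; ring.
  have nw : cabs (cpx (x - p) (y - q)) <= `|x - p| + `|y - q|.
    exact: cabs_le_re_im.
  have := H (c + cpx x y); rewrite wz => /(_ ltac:(lra)) {}H.
  have {}H : cabs (g (c + cpx x y) - g z - l * cpx (x - p) (y - q)) <= e * (`|x - p| + `|y - q|).
    by apply: le_trans H _; rewrite ler_pM2l.
  split; apply: le_trans H.
    apply: le_trans (cim_cabs _); rewrite !cE le_eqVlt; apply/orP; left; apply/eqP.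
    by congr (`| _ |); ring.
  apply: le_trans (cre_cabs _); rewrite !cE le_eqVlt; apply/orP; left; apply/eqP.
  by congr (`| _ |); ring.
have off x y : x != 0 \/ y != 0 -> c + cpx x y != c.
  move=> h; apply/eqP => /eqP; rewrite -subr_eq0 addrAC subrr add0r => /eqP k.
  by case: h => /eqP; apply; [rewrite -[x]/(cre (cpx x y)) k|rewrite -[y]/(cim (cpx x y)) k].
have split9 t : 0 < t < r -> J (- r) r (- r) r = J (- t) t (- t) t.
  move=> /andP[t0 tr].
  have e1 : J (- r) (- t) (- r) r = 0.
    apply: J0; [lra|lra|lra|lra|move=> x y hx hy; apply: off; left; apply/eqP; lra].
  have e2 : J t r (- r) r = 0.
    apply: J0; [lra|lra|lra|lra|move=> x y hx hy; apply: off; left; apply/eqP; lra].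
  have e3 : J (- t) t (- r) (- t) = 0.
    apply: J0; [lra|lra|lra|lra|move=> x y hx hy; apply: off; right; apply/eqP; lra].
  have e4 : J (- t) t t r = 0.
    apply: J0; [lra|lra|lra|lra|move=> x y hx hy; apply: off; right; apply/eqP; lra].
  have : J (- r) r (- r) r = J (- t) t (- t) t + J (- r) (- t) (- r) r + J t r (- r) r
     + J (- t) t (- r) (- t) + J (- t) t t r by rewrite /J /circulation; ring.
  by rewrite e1 e2 e3 e4 !addr0.
have csq : square c r c by rewrite /square /= subrr !cE normr0 ltW.
have /continuousC/(_ 1 ltr01)[d d0 H] := cg c csq.
pose M := cabs (g c) + 1.
have M0 : 0 < M by rewrite /M; have := cabs_ge0 (g c); lra.
have small : forall t, 0 < t -> t < r -> t < d / 2 -> `|J (- t) t (- t) t| <= 8 * M * t.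
  move=> t t0 tr td.
  have gM x y : - t <= x <= t -> - t <= y <= t -> cabs (g (c + cpx x y)) <= M.
    move=> hx hy.
    have h : cabs (c + cpx x y - c) < d.
      rewrite addrAC subrr add0r; apply: le_lt_trans (cabs_le_re_im _) _; rewrite !cE.
      have : `|x| <= t by rewrite ler_norml.
      have : `|y| <= t by rewrite ler_norml.
      lra.
    have := H _ h; have := cabsB (g (c + cpx x y)) (g c); rewrite /M; lra.
  have IA y : - t <= y <= t -> `|A y t - A y (- t)| <= M * (t - - t).
    move=> hy; have := @increment_affine R (A y) (fun x => cim (g (c + cpx x y))) (- t) t 0 0 M.
    rewrite !mul0r addr0 subr0; apply; first lra.
      by move=> x hx; apply: dA; lra.
    move=> x hx; rewrite !mul0r !addr0 subr0; apply: le_trans (cim_cabs _) _; exact: gM.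
  have IB x : - t <= x <= t -> `|B x t - B x (- t)| <= M * (t - - t).
    move=> hx; have := @increment_affine R (B x) (fun y => cre (g (c + cpx x y))) (- t) t 0 0 M.
    rewrite !mul0r addr0 subr0; apply; first lra.
      by move=> y hy; apply: dB; lra.
    move=> y hy; rewrite !mul0r !addr0 subr0; apply: le_trans (cre_cabs _) _; exact: gM.
  have tt : - t <= - t <= t by lra.
  have tt' : - t <= t <= t by lra.
  have := IA _ tt; have := IA _ tt'; have := IB _ tt; have := IB _ tt'.
  rewrite /J /circulation !ler_norml => h1 h2 h3 h4.
  have E : 8 * M * t = 4 * (M * (t - - t)) by ring.
  rewrite E; lra.
apply/eqP; rewrite -normr_le0; apply/ler_addgt0Pl => e e0; rewrite addr0.
pose s := Num.min (Num.min (r / 2) (d / 4)) (e / (8 * M)).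
have t0 : 0 < s by rewrite !lt_min !divr_gt0 // mulr_gt0.
have t1 : s <= r / 2 by rewrite !ge_min lexx.
have t2 : s <= d / 4 by rewrite !ge_min lexx ?orbT.
have t3 : s <= e / (8 * M) by rewrite !ge_min lexx ?orbT.
have -> : J (- r) r (- r) r = J (- s) s (- s) s by apply: split9; lra.
apply: le_trans (small s t0 _ _) _; [lra|lra|].
by rewrite mulrC -ler_pdivlMr // mulr_gt0.
Qed.

End Square.

(** * The maximum principle *)

Section MaximumPrinciple.
Context {R : realType}.
Local Notation C := (cplane R).
Implicit Types (u g : C -> C) (z w l c : C) (e d r m : R).

(** On each side of the square (1 - th) / z keeps the sign that 1 / z has there, with
    a definite size, so the four sides add up instead of cancelling. *)
Lemma half_plane_edge (th : C) x r : 0 < r -> `|x| <= r -> cabs th <= 1 / 4 ->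
  [/\ 1 / (4 * r) <= cim ((1 - th) / cpx x (- r)),
      cim ((1 - th) / cpx x r) <= - (1 / (4 * r)),
      1 / (4 * r) <= cre ((1 - th) / cpx r x) &
      cre ((1 - th) / cpx (- r) x) <= - (1 / (4 * r))].
Proof.
move=> r0 xr th4; set a := cre th; set b := cim th.
have ha : `|a| <= 1 / 4 by apply: le_trans (cre_cabs _) th4.
have hb : `|b| <= 1 / 4 by apply: le_trans (cim_cabs _) th4.
have D0 : 0 < x ^+ 2 + r ^+ 2 by rewrite ltr_wpDl ?sqr_ge0 ?exprn_gt0.
have xx : x ^+ 2 <= r ^+ 2 by rewrite -real_normK ?num_real // ler_pXn2r ?nnegrE // ltW.
have inv (s t : R) : (cpx s t)^-1 = cpx (s / (s ^+ 2 + t ^+ 2)) (- (t / (s ^+ 2 + t ^+ 2))).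
  by [].
rewrite !inv !cE -/a -/b !sqrrN [r ^+ 2 + _]addrC.
set D := x ^+ 2 + r ^+ 2 in D0 *.
have K (n : R) : r / 2 <= n -> 1 / (4 * r) <= n / D.
  move=> h; rewrite ler_pdivrMr ?mulr_gt0 // mulrAC ler_pdivlMr // mul1r.
  have -> : n * (4 * r) = 2 * r * (2 * n) by ring.
  have : 2 * r * r <= 2 * r * (2 * n) by rewrite ler_pM2l ?mulr_gt0 //; lra.
  rewrite /D; nra.
have K' (n : R) : n <= - (r / 2) -> n / D <= - (1 / (4 * r)).
  by move=> h; rewrite lerNr -mulNr; apply: K; lra.
have bx : `|b * x| <= r / 4.
  by rewrite normrM; apply: le_trans (ler_pM _ _ hb xr) _ => //; lra.
have br : `|b * r| <= r / 4.
  by rewrite normrM (gtr0_norm r0) mulrC ler_pM2l //; lra.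
have ax : `|a * x| <= r / 4.
  by rewrite normrM; apply: le_trans (ler_pM _ _ ha xr) _ => //; lra.
have ar : `|a * r| <= r / 4.
  by rewrite normrM (gtr0_norm r0) mulrC ler_pM2l //; lra.
move: bx br ax ar; rewrite !ler_norml => bx br ax ar.
split.
- have -> : (1 + - a) * - (- r / D) + (0 + - b) * (x / D) = (r - a * r - b * x) / D by field; exact: lt0r_neq0.
  by apply: K; lra.
- have -> : (1 + - a) * - (r / D) + (0 + - b) * (x / D) = (- r + a * r - b * x) / D by field; exact: lt0r_neq0.
  by apply: K'; lra.
- have -> : (1 + - a) * (r / D) - (0 + - b) * - (x / D) = (r - a * r - b * x) / D by field; exact: lt0r_neq0.
  by apply: K; lra.
- have -> : (1 + - a) * (- r / D) - (0 + - b) * - (x / D) = (- r + a * r - b * x) / D by field; exact: lt0r_neq0.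
  by apply: K'; lra.
Qed.


(** Were the bound false, u / u c would be at most 1 / 4 on the edge, and the function
    (1 - u z / u c) / (z - c), which is regular at c, would have non-zero circulation
    along the square. *)
Lemma square_center_le4 u c r m : 0 < r ->
  (forall z, square c r z -> derivable u z 1) ->
  (forall z, square_edge c r z -> cabs (u z) <= m) -> cabs (u c) <= 4 * m.
Proof.
move=> r0 du um; rewrite leNgt; apply/negP => uc.
have csq : square c r c by rewrite /square /= subrr !cE normr0 ltW.
have esq x y : `|x| <= r -> `|y| <= r -> square c r (c + cpx x y).
  by move=> hx hy; rewrite /square /= addrAC subrr add0r !cE.
have m0 : 0 <= m.
  apply: le_trans (cabs_ge0 (u (c + cpx r 0))) (um _ _); split.
    by apply: esq; rewrite ?normr0 ?gtr0_norm // ltW.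
  by left; rewrite addrAC subrr add0r !cE gtr0_norm.
have uc0 : u c != 0 by rewrite -cabs_gt0; apply: le_lt_trans uc; rewrite mulr_ge0.
have H := derivable_has_deriv (du c csq).
set l := 'D_1 u c in H.
pose g z : C := if z == c then - (l / u c) else (1 - u z / u c) / (z - c).
have gE z : z != c -> g z = (1 - u z / u c) / (z - c) by rewrite /g => /negPf ->.
have near_off z : z != c -> \forall w \near z, w != c.
  move=> zc; apply/nearC; exists (cabs (z - c)); first by rewrite cabs_gt0 subr_eq0.
  by move=> w; apply: contraTneq => ->; rewrite cabsC ltxx.
have dg z : square c r z -> z != c -> derivable g z 1.
  move=> zs zc.
  pose G : C -> C := fun w => (1 - u w / u c) / (w - c).
  have dG : derivable G z 1.
    apply: derivableM; last first.
      apply: derivableV; first by rewrite subr_eq0.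
      by apply: derivableB; [exact: derivable_id|exact: derivable_cst].
    apply: derivableB; first exact: derivable_cst.
    by apply: derivableM; [exact: du|exact: derivable_cst].
  have := derivable_has_deriv dG => hG.
  apply: (@has_deriv_derivable _ _ _ ('D_1 G z)) => e e0.
  have [d d0 hd] := hG e e0; have /nearC[d' d'0 hd'] := near_off z zc.
  exists (Num.min d d'); first by rewrite lt_min d0.
  by move=> w; rewrite lt_min => /andP[h1 h2]; rewrite (gE w (hd' w h2)) (gE z zc); exact: hd h1.
have cg z : square c r z -> {for z, continuous g}.
  move=> zs; have [->|zc] := eqVneq z c; last by apply: derivableC_continuous; exact: dg.
  apply/continuousC => e e0.
  have [d d0 hd] := H (e / 2 * cabs (u c)) ltac:(by rewrite mulr_gt0 ?divr_gt0 ?cabs_gt0).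
  exists d => // w wd; have [->|wc] := eqVneq w c; first by rewrite subrr cabs0.
  rewrite gE // /g eqxx.
  have wc0 : w - c != 0 by rewrite subr_eq0.
  have -> : (1 - u w / u c) / (w - c) - - (l / u c) =
      - ((u w - u c - l * (w - c)) / u c / (w - c)).
    by field; rewrite uc0 wc0.
  rewrite cabsN !cabsM !cabsV; have := hd w wd.
  have a0 : 0 < cabs (u c) by rewrite cabs_gt0.
  have b0 : 0 < cabs (w - c) by rewrite cabs_gt0.
  rewrite ltr_pdivrMr // ltr_pdivrMr // => /le_lt_trans; apply.
  rewrite mulrAC ltr_pM2r // ltr_pM2r //; lra.
have [A [B [dA dB J0]]] := square_punctured_circulation r0 cg dg.
have rr : `|r| = r by rewrite gtr0_norm.
have rr' : `|- r| = r by rewrite normrN.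
have thb x y : `|x| <= r -> `|y| <= r -> `|x| = r \/ `|y| = r ->
    cabs (u (c + cpx x y) / u c) <= 1 / 4.
  move=> hx hy hxy; rewrite cabsM cabsV ler_pdivrMr ?cabs_gt0 //.
  apply: le_trans (um _ _) _; last by lra.
  by split; [exact: esq|rewrite addrAC subrr add0r !cE].
have gexp x y : x != 0 \/ y != 0 ->
    g (c + cpx x y) = (1 - u (c + cpx x y) / u c) / cpx x y.
  move=> h; rewrite gE; first by rewrite [c + _]addrC addrK.
  apply/eqP => /eqP; rewrite -subr_eq0 addrAC subrr add0r => /eqP k.
  by case: h => /eqP; apply; [rewrite -[x]/(cre (cpx x y)) k|rewrite -[y]/(cim (cpx x y)) k].
have ab x : - r <= x <= r -> `|x| <= r by rewrite ler_norml.
have r1 : - r <= - r <= r by lra.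
have r2 : - r <= r <= r by lra.
have r12 : - r <= r by lra.
have rn0 : r != 0 by rewrite lt0r_neq0.
have rn0' : - r != 0 by rewrite oppr_eq0.
have i1 : 1 / (4 * r) * (r - - r) <= A r (- r) - A (- r) (- r).
  apply: (@increment_ge R (fun t => A t (- r)) _ _ _ _ r12 (fun x hx => dA x _ hx r1)) => x hx.
  have [h _ _ _] := half_plane_edge r0 (ab x hx) (thb x (- r) (ab x hx) ltac:(by rewrite rr') (or_intror rr')).
  by rewrite gexp //; right.
have i2 : A r r - A (- r) r <= - (1 / (4 * r)) * (r - - r).
  apply: (@increment_le R (fun t => A t r) _ _ _ _ r12 (fun x hx => dA x _ hx r2)) => x hx.
  have [_ h _ _] := half_plane_edge r0 (ab x hx) (thb x r (ab x hx) ltac:(by rewrite rr) (or_intror rr)).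
  by rewrite gexp //; right.
have i3 : 1 / (4 * r) * (r - - r) <= B r r - B r (- r).
  apply: (@increment_ge R (B r) _ _ _ _ r12 (fun x hx => dB _ x r2 hx)) => x hx.
  have [_ _ h _] := half_plane_edge r0 (ab x hx) (thb r x ltac:(by rewrite rr) (ab x hx) (or_introl rr)).
  by rewrite gexp //; left.
have i4 : B (- r) r - B (- r) (- r) <= - (1 / (4 * r)) * (r - - r).
  apply: (@increment_le R (B (- r)) _ _ _ _ r12 (fun x hx => dB _ x r1 hx)) => x hx.
  have [_ _ _ h] := half_plane_edge r0 (ab x hx) (thb (- r) x ltac:(by rewrite rr') (ab x hx) (or_introl rr')).
  by rewrite gexp //; left.
have E : 1 / (4 * r) * (r - - r) = 1 / 2 by field.
have E' : - (1 / (4 * r)) * (r - - r) = - (1 / 2) by field.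
move: J0 i1 i2 i3 i4; rewrite /circulation E E'; lra.
Qed.

(** A constant factor in a bound that holds for all powers can be dropped. *)
Lemma power_bound (a k m M : R) : 0 <= a -> 0 <= m -> 0 < k ->
  (forall n, k * a ^+ n <= M * m ^+ n) -> a <= m.
Proof.
move=> a0 m0 k0 h; rewrite leNgt; apply/negP => ma.
have a1 : 0 < a by apply: le_lt_trans ma.
have := @cvg_geometric R M (m / a) ltac:(by rewrite ger0_norm ?divr_ge0 // ltr_pdivrMr // mul1r).
move/cvgrPdist_lt => /(_ k k0) [n _ /(_ n (leqnn n))].
rewrite sub0r normrN /geometric /= => hk.
have : k <= M * (m / a) ^+ n.
  by rewrite exprMn exprVn mulrA ler_pdivlMr ?exprn_gt0.
by move: hk; rewrite ltNge; move=> /negP hk h2; apply: hk; apply: le_trans h2 (ler_norm _).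
Qed.

(** The crude bound is applied to u ^ n times (z - p) (z - q): the powers remove the
    constant, and the two factors remove the exceptional points, where a continuous
    function becomes differentiable after multiplication by z - p. Difference
    quotients have such exceptional points on the diagonal. *)
Lemma max_principle u c r m (p q : C) : 0 < r -> c != p -> c != q ->
  (forall z, square c r z -> {for z, continuous u}) ->
  (forall z, square c r z -> z != p -> z != q -> derivable u z 1) ->
  (forall z, square_edge c r z -> cabs (u z) <= m) -> cabs (u c) <= m.
Proof.
move=> r0 cp cq cu du um.
have m0 : 0 <= m.
  apply: le_trans (cabs_ge0 (u (c + cpx r 0))) (um _ _); split.
    by rewrite /square /= addrAC subrr add0r !cE normr0 gtr0_norm // lexx ltW.
  by left; rewrite addrAC subrr add0r !cE gtr0_norm.
pose K := (2 * r + cabs (c - p)) * (2 * r + cabs (c - q)).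
apply: (@power_bound _ (cabs (c - p) * cabs (c - q)) _ (4 * K)) => //.
- exact: cabs_ge0.
- by rewrite mulr_gt0 // cabs_gt0 subr_eq0.
move=> n.
pose v : C -> C := fun z => u z ^+ n * ((z - p) * (z - q)).
have -> : cabs (c - p) * cabs (c - q) * cabs (u c) ^+ n = cabs (v c).
  by rewrite /v !cabsM cabsX mulrC.
rewrite -mulrA; apply: (square_center_le4 r0).
  move=> z zs.
  have du1 (f : C -> C) (s : C) : {for s, continuous f} -> derivable (fun z => f z * (z - s)) s 1.
    move=> cf; apply: (@has_deriv_derivable _ _ _ (f s)) => e e0.
    have /continuousC/(_ e e0)[d d0 hd] := cf.
    exists d => // w wd; rewrite subrr mulr0 subr0 -mulrBl cabsM ler_wpM2r ?cabs_ge0 //.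
    exact/ltW/hd.
  have cun : {for z, continuous (fun z => u z ^+ n)}.
    elim: n {v} => [|k IH].
      have -> : (fun z => u z ^+ 0) = (fun=> 1) by apply: funext => s; rewrite expr0.
      exact: cts_cst.
    have -> : (fun z => u z ^+ k.+1) = (fun z => u z * u z ^+ k).
      by apply: funext => s; rewrite exprS.
    exact: ctsM (cu z zs) IH.
  have cl (s : C) : {for z, continuous (fun z : C => z - s)}.
    exact: (@ctsB R _ (fun z : C => z) (fun=> s) z (@cts_id R z) (@cts_cst R _ s z)).
  have [zp|zp] := eqVneq z p.
    have -> : v = (fun z => (u z ^+ n * (z - q)) * (z - p)) by apply: funext => w; rewrite /v; ring.
    by rewrite zp; apply: du1; rewrite -zp; exact: ctsM cun (cl q).
  have [zq|zq] := eqVneq z q.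
    have -> : v = (fun z => (u z ^+ n * (z - p)) * (z - q)) by apply: funext => w; rewrite /v; ring.
    by rewrite zq; apply: du1; rewrite -zq; exact: ctsM cun (cl p).
  apply: derivableM.
    by have := @derivableX _ _ u n z 1 (du z zs zp zq); rewrite exprfctE.
  by apply: derivableM; apply: derivableB; [exact: derivable_id|exact: derivable_cst|
    exact: derivable_id|exact: derivable_cst].
move=> z ze; rewrite /v !cabsM cabsX mulrC.
have zc : cabs (z - c) <= 2 * r.
  have [[h1 h2] _] := ze; apply: le_trans (cabs_le_re_im _) _; lra.
have hs (s : C) : cabs (z - s) <= 2 * r + cabs (c - s).
  by apply: le_trans (cabs_triangle c z s) _; rewrite lerD2r.
apply: ler_pM; rewrite ?mulr_ge0 ?cabs_ge0 ?exprn_ge0 ?cabs_ge0 //.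
  by apply: ler_pM; rewrite ?cabs_ge0.
by apply: lerXn2r; rewrite ?nnegrE ?cabs_ge0 //; exact: um.
Qed.

End MaximumPrinciple.

(** * Compact sets and difference quotients *)

Section Compact.
Context {R : realType}.
Local Notation C := (cplane R).
Implicit Types (z w l c : C) (e d r m : R).

Lemma compact_rectangle (a b a' b' : R) :
  compact [set z : C | a <= cre z <= b /\ a' <= cim z <= b'].
Proof.
have -> : [set z : C | a <= cre z <= b /\ a' <= cim z <= b'] =
   (fun p : R * R => cpx p.1 p.2) @` (`[a, b]%classic `*` `[a', b']%classic).
  apply/seteqP; split => [z [h1 h2]|_ [[x y] [/= h1 h2] <-]].
    by exists (cre z, cim z); rewrite /= ?in_itv //= -cpxE.
  by move: h1 h2; rewrite !in_itv.
apply: continuous_compact; last by apply: compact_setX; exact: segment_compact.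
apply: continuous_subspaceT => p.
by apply: (@cpx_continuous R _ fst snd); [exact: cvg_fst|exact: cvg_snd].
Qed.

Lemma cabs_sub_continuous c z : {for z, continuous (fun z : C => cabs (z - c))}.
Proof.
apply: (@continuous_comp _ _ _ (fun z : C => z - c) (@cabs R)); last exact: cabs_continuous.
exact: (@ctsB R _ (fun z : C => z) (fun=> c) z (@cts_id R z) (@cts_cst R _ c z)).
Qed.

Lemma closed_cdisk c r : closed [set z : C | cabs (z - c) <= r].
Proof.
have -> : [set z : C | cabs (z - c) <= r] = (fun z : C => cabs (z - c)) @^-1` [set x | x <= r] by [].
apply: closed_comp; last exact: closed_le.
by move=> z _; exact: cabs_sub_continuous.
Qed.

Lemma compact_cdisk c r : compact [set z : C | cabs (z - c) <= r].
Proof.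
apply: (subclosed_compact (closed_cdisk (c := c) (r := r)) (@compact_rectangle (cre c - r) (cre c + r) (cim c - r) (cim c + r))).
move=> z /= h; have := le_trans (cre_cabs _) h; have := le_trans (cim_cabs _) h.
by rewrite !ler_norml !cE => h1 h2; split; lra.
Qed.

Lemma compact_bounded_below (T : topologicalType) (K : set T) (f : T -> R) :
  compact K -> (forall t, K t -> {for t, continuous f}) -> (forall t, K t -> 0 < f t) ->
  exists2 m : R, 0 < m & forall t, K t -> m <= f t.
Proof.
move=> cK cf f0; have [K0|K0] := pselect (K !=set0); last first.
  by exists 1 => // z Kz; exfalso; apply: K0; exists z.
have [|c] := @compact_EVT_min _ R f K K0 cK.
  by apply: continuous_in_subspaceT => z; rewrite inE; exact: cf.
by rewrite inE => Kc h; exists (f c); [exact: f0|move=> z Kz; apply: h; rewrite inE].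
Qed.

Lemma compact_square_edge c r : compact (square_edge c r).
Proof.
apply: (subclosed_compact _ (@compact_rectangle (cre c - r) (cre c + r) (cim c - r) (cim c + r))); last first.
  move=> z [[]] /=; rewrite !ler_norml !cE => h1 h2 _; split; lra.
have cc z : {for z, continuous (fun z : C => z - c)}.
  exact: (@ctsB R _ (fun z : C => z) (fun=> c) z (@cts_id R z) (@cts_cst R _ c z)).
have cr : continuous (fun z : C => `|cre (z - c)|).
  move=> z; apply: (@continuous_comp _ _ _ (fun z : C => cre (z - c)) Num.norm); last exact: norm_continuous.
  by apply: (@continuous_comp _ _ _ (fun z : C => z - c)); [exact: cc|exact: cre_continuous].
have ci : continuous (fun z : C => `|cim (z - c)|).
  move=> z; apply: (@continuous_comp _ _ _ (fun z : C => cim (z - c)) Num.norm); last exact: norm_continuous.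
  by apply: (@continuous_comp _ _ _ (fun z : C => z - c)); [exact: cc|exact: cim_continuous].
have cl (f : C -> R) (D : set R) : continuous f -> closed D -> closed (f @^-1` D).
  by move=> cf cD; apply: closed_comp => // z _; exact: cf.
have -> : square_edge c r =
  (((fun z : C => `|cre (z - c)|) @^-1` [set x | x <= r]) `&`
   ((fun z : C => `|cim (z - c)|) @^-1` [set x | x <= r])) `&`
  (((fun z : C => `|cre (z - c)|) @^-1` [set x | x = r]) `|`
   ((fun z : C => `|cim (z - c)|) @^-1` [set x | x = r])) by [].
apply: closedI; first by apply: closedI; apply: cl => //; exact: closed_le.
by apply: closedU; apply: cl => //; exact: closed_eq.
Qed.

End Compact.

Section Quotient.
Context {R : realType}.
Local Notation C := (cplane R).
Implicit Types (f g : C -> C) (z w l c a b : C) (e d r m : R).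

Definition quotient f z w : C := if z == w then 'D_1 f z else (f z - f w) / (z - w).

Lemma quotient_sym f z w : quotient f z w = quotient f w z.
Proof.
rewrite /quotient eq_sym; case: eqVneq => [->//|wz].
by rewrite -[f z - f w]opprB -[z - w]opprB invrN mulrNN.
Qed.

Lemma quotientE f z w : z != w -> quotient f z w = (f z - f w) / (z - w).
Proof. by rewrite /quotient => /negPf ->. Qed.

Lemma quotientM f z w : f z - f w = quotient f z w * (z - w).
Proof.
have [->|zw] := eqVneq z w; first by rewrite !subrr mulr0.
by rewrite quotientE // divfK // subr_eq0.
Qed.

Lemma near_eq_off a z : z != a -> \forall w \near z, w != a.
Proof.
move=> za; apply/nearC; exists (cabs (z - a)); first by rewrite cabs_gt0 subr_eq0.
by move=> w; apply: contraTneq => ->; rewrite cabsC ltxx.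
Qed.

Lemma quotient_derivable f a z : z != a -> derivable f z 1 ->
  derivable (quotient f ^~ a) z 1.
Proof.
move=> za df.
pose H : C -> C := fun w => (f w - f a) / (w - a).
have dH : derivable H z 1.
  apply: derivableM; last first.
    apply: derivableV; first by rewrite subr_eq0.
    by apply: derivableB; [exact: derivable_id|exact: derivable_cst].
  by apply: derivableB; [exact: df|exact: derivable_cst].
have hG := derivable_has_deriv dH.
apply: (@has_deriv_derivable _ _ _ ('D_1 H z)) => e e0.
have [d d0 hd] := hG e e0; have /nearC[d' d'0 hd'] := near_eq_off za.
exists (Num.min d d'); first by rewrite lt_min d0.
by move=> w; rewrite lt_min => /andP[h1 h2]; rewrite (quotientE _ (hd' w h2)) (quotientE _ za); exact: hd h1.
Qed.

Lemma quotient_continuous1 f a z : derivable f z 1 -> {for z, continuous (quotient f ^~ a)}.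
Proof.
move=> df; have [->|za] := eqVneq a z; last first.
  by apply: derivableC_continuous; apply: quotient_derivable => //; rewrite eq_sym.
have H := derivable_has_deriv df.
apply/continuousC => e e0.
have [d d0 hd] := H (e / 2) ltac:(by rewrite divr_gt0).
exists d => // w wd; have [->|wz] := eqVneq w z; first by rewrite subrr cabs0.
rewrite (quotientE _ wz) /quotient eqxx.
have b0 : 0 < cabs (w - z) by rewrite cabs_gt0 subr_eq0.
rewrite -(ltr_pM2r b0) -cabsM mulrBl divfK ?subr_eq0 //.
apply: le_lt_trans (hd w wd) _; rewrite ltr_pM2r //; lra.
Qed.

Lemma cabs_le_cluster (h : C -> C) z m : {for z, continuous h} ->
  (\forall w \near z, w != z -> cabs (h w) <= m) -> cabs (h z) <= m.
Proof.
move=> ch /nearC[d d0 hd]; apply/ler_addgt0Pl => e e0.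
have /continuousC/(_ e e0)[d' d'0 hd'] := ch.
pose t := Num.min d d' / 2.
have t0 : 0 < t by rewrite divr_gt0 // lt_min d0.
have tm : t < Num.min d d' by rewrite /t; move: t0; rewrite /t; lra.
have tE : cabs (z + cpx t 0 - z) = t by rewrite addrAC subrr add0r cpx_real gtr0_norm.
have h1 : cabs (h (z + cpx t 0)) <= m.
  apply: hd; first by rewrite tE; move: tm; rewrite lt_min => /andP[].
  by rewrite -subr_eq0 -cabs_gt0 tE.
have h2 : cabs (h (z + cpx t 0) - h z) < e.
  by apply: hd'; rewrite tE; move: tm; rewrite lt_min => /andP[].
have := cabsB (h z) (h (z + cpx t 0)); rewrite cabsC; lra.
Qed.

Lemma square_edge_far c r z : square_edge c r z -> r <= cabs (z - c).
Proof. by move=> [_ [<-|<-]]; [exact: cre_cabs|exact: cim_cabs]. Qed.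

Lemma square_near c r z : square c r z -> cabs (z - c) <= 2 * r.
Proof. by move=> [h1 h2]; apply: le_trans (cabs_le_re_im _) _; lra. Qed.

Lemma square_edge_square c r z : square_edge c r z -> square c r z.
Proof. by case. Qed.

(** Away from the diagonal the estimate is elementary. A square around z that contains
    a and b in its interior, with its edge far from both, transports it to the
    diagonal by the maximum principle in z. This takes the place of Cauchy's integral
    formula: it gives the continuity of the derivative. *)
Lemma quotient_lipschitz f z0 (G : set C) : open G -> G z0 ->
  (forall z, G z -> derivable f z 1) ->
  exists r K, [/\ 0 < r, 0 < K & forall z a b, cabs (z - z0) < r -> cabs (a - z0) < r ->
    cabs (b - z0) < r -> cabs (quotient f z a - quotient f z b) <= K * cabs (a - b)].
Proof.
move=> oG Gz0 df.
have [e0 e00 eG] := open_disk oG Gz0.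
have /continuousC/(_ 1 ltr01)[e1 e10 fb] := derivableC_continuous (df _ Gz0).
pose r := Num.min e0 e1 / 4.
have m0 : 0 < Num.min e0 e1 by rewrite lt_min e00.
have r0 : 0 < r by rewrite divr_gt0.
have rE : 4 * r = Num.min e0 e1 by rewrite /r; field.
have inG z : cabs (z - z0) < 4 * r -> G z.
  by rewrite rE lt_min => /andP[h _]; apply: eG.
have f2 z w : cabs (z - z0) < 4 * r -> cabs (w - z0) < 4 * r -> cabs (f z - f w) <= 2.
  rewrite rE !lt_min => /andP[_ /fb h1] /andP[_ /fb h2].
  have := cabs_triangle (f z0) (f z) (f w); rewrite [cabs (f z0 - _)]cabsC; lra.
have tri c z s : cabs (c - z0) < s -> cabs (z - z0) <= cabs (z - c) + s.
  by move=> h; have := cabs_triangle c z z0; lra.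
have sqr c z : cabs (c - z0) < r / 4 -> square c r z -> cabs (z - z0) < 4 * r.
  by move=> /tri h1 /square_near h2; have := h1 z; lra.
have far c a z : cabs (c - z0) < r / 4 -> cabs (a - z0) < r / 4 -> square_edge c r z ->
    r / 2 <= cabs (z - a).
  move=> h1 h2 /square_edge_far h3.
  have := cabs_triangle a z c; have := cabs_triangle z0 a c; rewrite [cabs (z0 - c)]cabsC; lra.
have lip z a : cabs (z - z0) < r / 4 -> cabs (a - z0) < r / 4 -> z != a ->
    cabs (quotient f z a) <= 4 / r.
  move=> hz ha za; apply: (@max_principle R (quotient f ^~ a) z r (4 / r) a a r0 za za).
  - by move=> w /(sqr _ _ hz) hw; apply: quotient_continuous1; apply: df; exact: inG.
  - by move=> w /(sqr _ _ hz) hw wa _; apply: quotient_derivable => //; apply: df; exact: inG.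
  move=> w hw; have fw := far _ _ _ hz ha hw.
  have wa : w != a.
    by apply/eqP => E; move: fw; rewrite E subrr cabs0; lra.
  rewrite quotientE // cabsM cabsV ler_pdivrMr; last by lra.
  have h2 : cabs (f w - f a) <= 2.
    apply: f2; last by lra.
    by apply: (sqr _ _ hz); exact: square_edge_square.
  apply: le_trans h2 _; rewrite mulrAC ler_pdivlMr //; lra.
have lip' a b : cabs (a - z0) < r / 4 -> cabs (b - z0) < r / 4 ->
    cabs (f a - f b) <= 4 / r * cabs (a - b).
  move=> ha hb; have [->|ab] := eqVneq a b; first by rewrite !subrr cabs0 mulr0.
  by rewrite quotientM cabsM ler_wpM2r ?cabs_ge0 // lip.
exists (r / 4), (16 / r ^+ 2); split; [by rewrite divr_gt0|by rewrite divr_gt0 // exprn_gt0|].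
have main z a b : cabs (z - z0) < r / 4 -> cabs (a - z0) < r / 4 -> cabs (b - z0) < r / 4 ->
    z != a -> z != b -> cabs (quotient f z a - quotient f z b) <= 16 / r ^+ 2 * cabs (a - b).
  move=> hz ha hb za zb.
  apply: (@max_principle R (fun z => quotient f z a - quotient f z b) z r _ a b r0 za zb).
  - move=> w /(sqr _ _ hz) hw.
    by apply: ctsB; apply: quotient_continuous1; apply: df; exact: inG.
  - move=> w /(sqr _ _ hz) hw wa wb.
    by apply: derivableB; apply: quotient_derivable => //; apply: df; exact: inG.
  move=> w hw; have fa := far _ _ _ hz ha hw; have fb' := far _ _ _ hz hb hw.
  have wa : w - a != 0 by rewrite -cabs_gt0; lra.
  have wb : w - b != 0 by rewrite -cabs_gt0; lra.
  have wa' : w != a by rewrite -subr_eq0.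
  have wb' : w != b by rewrite -subr_eq0.
  rewrite (quotientE _ wa') (quotientE _ wb').
  have -> : (f w - f a) / (w - a) - (f w - f b) / (w - b) =
     (f w - f a) * (a - b) / ((w - a) * (w - b)) + (f b - f a) / (w - b).
    by field; rewrite wa wb.
  have n1 : cabs ((f w - f a) * (a - b) / ((w - a) * (w - b))) <= 8 / r ^+ 2 * cabs (a - b).
    rewrite !cabsM cabsV cabsM mulrAC ler_wpM2r ?cabs_ge0 //.
    have h2 : cabs (f w - f a) <= 2.
      apply: f2; last by lra.
      by apply: (sqr _ _ hz); exact: square_edge_square.
    have r2 : 0 <= r / 2 by rewrite divr_ge0 // ltW.
    have p1 : r / 2 * (r / 2) <= cabs (w - a) * cabs (w - b) by exact: ler_pM.
    have p2 : 0 < cabs (w - a) * cabs (w - b) by rewrite mulr_gt0 // cabs_gt0.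
    rewrite ler_pdivrMr // mulrAC ler_pdivlMr ?exprn_gt0 //.
    have : cabs (f w - f a) * r ^+ 2 <= 2 * r ^+ 2 by rewrite ler_wpM2r // exprn_ge0 // ltW.
    have -> : r ^+ 2 = 4 * (r / 2 * (r / 2)) by field.
    lra.
  have n2 : cabs ((f b - f a) / (w - b)) <= 8 / r ^+ 2 * cabs (a - b).
    rewrite cabsM cabsV ler_pdivrMr; last by lra.
    have := lip' b a hb ha; rewrite [cabs (b - a)]cabsC => /le_trans; apply.
    rewrite [leRHS]mulrAC ler_wpM2r ?cabs_ge0 //.
    have -> : 8 / r ^+ 2 * cabs (w - b) = 4 / r * (2 / r * cabs (w - b)).
      by field; rewrite lt0r_neq0.
    rewrite ler_pMr ?divr_gt0 //.
    by rewrite mulrAC ler_pdivlMr // mul1r; lra.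
  apply: le_trans (cabsD _ _) _.
  have -> : 16 / r ^+ 2 = 8 / r ^+ 2 + 8 / r ^+ 2 by field; rewrite lt0r_neq0.
  by rewrite [leRHS]mulrDl lerD.
move=> z a b hz ha hb.
have [->|ab] := eqVneq a b; first by rewrite !subrr cabs0 mulr0.
apply: (@cabs_le_cluster (fun z => quotient f z a - quotient f z b)).
  by apply: ctsB; apply: quotient_continuous1; apply: df; apply: inG; lra.
have nz : \forall w \near z, cabs (w - z0) < r / 4.
  apply/nearC; exists (r / 4 - cabs (z - z0)); first by lra.
  by move=> w hw; have := cabs_triangle z w z0; lra.
have nab (c : C) : \forall w \near z, w != z -> w != c.
  have [->|zc] := eqVneq z c; first by apply/nearC; exists 1.
  by apply: filterS (near_eq_off zc).
apply: filterS3 nz (nab a) (nab b) => w h1 h2 h3 wz.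
by apply: main => //; [exact: h2|exact: h3].
Qed.

End Quotient.

(** * Non-vanishing of the derivative of a univalent function *)

Section Univalent.
Context {R : realType}.
Local Notation C := (cplane R).
Variables (f : C -> C) (G : set C).
Hypotheses (oG : open G) (df : forall z, G z -> derivable f z 1).
Implicit Types (z w l c a b : C) (e d r m : R).

Lemma quotient_near_diagonal z0 : G z0 -> forall e, 0 < e -> exists2 d : R, 0 < d &
  forall z w, cabs (z - z0) < d -> cabs (w - z0) < d ->
    cabs (quotient f z w - 'D_1 f z0) < e.
Proof.
move=> Gz0 e e0; have [r [K [r0 K0 H]]] := quotient_lipschitz oG Gz0 df.
exists (Num.min r (e / (2 * K))); first by rewrite lt_min r0 divr_gt0 // mulr_gt0.
move=> z w; rewrite !lt_min => /andP[z1 z2] /andP[w1 w2].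
have z00 : cabs (z0 - z0) < r by rewrite subrr cabs0.
have E : quotient f z0 z0 = 'D_1 f z0 by rewrite /quotient eqxx.
have h1 := H z w z0 z1 w1 z00; have h2 := H z0 z z0 z00 z1 z00.
rewrite (quotient_sym f z z0) in h1.
have := cabs_triangle (quotient f z0 z) (quotient f z w) ('D_1 f z0); rewrite -E => h3.
apply: le_lt_trans h3 _.
have z3 : K * cabs (z - z0) < e / 2 by move: z2; rewrite ltr_pdivlMr ?mulr_gt0 //; lra.
have w3 : K * cabs (w - z0) < e / 2 by move: w2; rewrite ltr_pdivlMr ?mulr_gt0 //; lra.
lra.
Qed.

Lemma strict_derivative z0 : G z0 -> forall e, 0 < e -> exists2 d : R, 0 < d &
  forall z w, cabs (z - z0) < d -> cabs (w - z0) < d ->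
    cabs (f z - f w - 'D_1 f z0 * (z - w)) <= e * cabs (z - w).
Proof.
move=> Gz0 e e0; have [d d0 hd] := quotient_near_diagonal Gz0 e0.
exists d => // z w hz hw; rewrite quotientM -mulrBl cabsM ler_wpM2r ?cabs_ge0 //.
exact/ltW/hd.
Qed.

Lemma quotient_continuous z0 w0 : G z0 -> G w0 -> forall e, 0 < e ->
  exists2 d : R, 0 < d & forall z w, cabs (z - z0) < d -> cabs (w - w0) < d ->
    cabs (quotient f z w - quotient f z0 w0) < e.
Proof.
move=> Gz0 Gw0 e e0; have [->|zw] := eqVneq z0 w0.
  have [d d0 hd] := quotient_near_diagonal Gw0 e0; exists d => //.
  by rewrite {2}/quotient eqxx.
have cH : {for (z0, w0), continuous (fun p : C * C => (f p.1 - f p.2) / (p.1 - p.2))}.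
  have c1 : {for (z0, w0), continuous (fun p : C * C => f p.1)}.
    by apply: (@continuous_comp _ _ _ fst f); [exact: cvg_fst|exact: derivableC_continuous (df _)].
  have c2 : {for (z0, w0), continuous (fun p : C * C => f p.2)}.
    by apply: (@continuous_comp _ _ _ snd f); [exact: cvg_snd|exact: derivableC_continuous (df _)].
  have c3 : {for (z0, w0), continuous (fun p : C * C => p.1)} by exact: cvg_fst.
  have c4 : {for (z0, w0), continuous (fun p : C * C => p.2)} by exact: cvg_snd.
  have h12 := ctsB c1 c2; have h34 := ctsB c3 c4.
  by apply: (cts_div h12 h34); rewrite subr_eq0.
have := cH _ (disk_nbhs _ e0); rewrite /nbhs /=.
move=> [[A B] /= [/nbhs_disk[d1 d10 h1] /nbhs_disk[d2 d20 h2]] h].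
pose d3 := cabs (z0 - w0) / 2.
have d30 : 0 < d3 by rewrite divr_gt0 // cabs_gt0 subr_eq0.
exists (Num.min d3 (Num.min d1 d2)); first by rewrite !lt_min d30 d10.
move=> z w; rewrite !lt_min => /and3P[z3 z1 _] /and3P[w3 _ w2].
have zw' : z != w.
  apply/eqP => E; move: z3 w3; rewrite E [cabs (w - z0)]cabsC => z3 w3.
  by have := cabs_triangle w z0 w0; rewrite /d3 in z3 w3; lra.
rewrite !quotientE //.
by have := h (z, w) (conj (h1 z z1) (h2 w w2)).
Qed.

(** A derivative that vanishes on a disk makes f vary quadratically; subdividing a
    segment into n pieces gives a variation of order 1 / n. *)
Lemma derivative_zero_quadratic z0 r K : 0 <= K ->
  (forall z a b, cabs (z - z0) < r -> cabs (a - z0) < r ->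
    cabs (b - z0) < r -> cabs (quotient f z a - quotient f z b) <= K * cabs (a - b)) ->
  (forall z, cabs (z - z0) < r -> quotient f z z = 0) ->
  forall z, cabs (z - z0) < r -> f z = f z0.
Proof.
move=> K0 lip f'0 z hz; have r0 : 0 < r by apply: le_lt_trans hz; exact: cabs_ge0.
have quad a b : cabs (a - z0) < r -> cabs (b - z0) < r ->
    cabs (f a - f b) <= K * cabs (a - b) ^+ 2.
  move=> ha hb; rewrite quotientM cabsM expr2 mulrA ler_wpM2r ?cabs_ge0 //.
  by have := lip a b a ha hb ha; rewrite f'0 // subr0 [cabs (b - a)]cabsC.
pose x (n k : nat) : C := z0 + (k%:R / n.+1%:R) * (z - z0).
have cnat (n : nat) : cabs (n%:R : C) = n%:R.
  have -> : (n%:R : C) = cpx n%:R 0.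
    by elim: n => [//|n IH]; rewrite -!natr1 IH; apply: cpx_inj; rewrite !cE /= ?addr0.
  by rewrite cpx_real ger0_norm.
have n0 (n : nat) : (n.+1%:R : C) != 0 by rewrite pnatr_eq0.
have inr n k : (k <= n.+1)%N -> cabs (x n k - z0) < r.
  move=> kn; rewrite /x addrAC subrr add0r !cabsM cabsV !cnat.
  apply: le_lt_trans hz; rewrite ler_piMl ?cabs_ge0 // ler_pdivrMr ?ltr0n //.
  by rewrite mul1r ler_nat.
have step n k : (k <= n.+1)%N ->
    cabs (f (x n k) - f z0) <= k%:R * (K * (cabs (z - z0) / n.+1%:R) ^+ 2).
  elim: k => [|k IH] kn.
    by rewrite /x mul0r mul0r addr0 subrr cabs0 mul0r.
  have := IH (ltnW kn); have := quad _ _ (inr n k.+1 kn) (inr n k (ltnW kn)).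
  have -> : x n k.+1 - x n k = (z - z0) / n.+1%:R.
    by rewrite /x -natr1; field.
  rewrite cabsM cabsV cnat => h1 h2.
  apply: le_trans (cabs_triangle (f (x n k)) _ _) _.
  by rewrite -[in leRHS]natr1 mulrDl mul1r [leRHS]addrC lerD.
apply/eqP; rewrite -subr_eq0 -cabs_eq0 eq_le cabs_ge0 andbT.
apply/ler_addgt0Pl => e e0; rewrite addr0.
pose D := K * cabs (z - z0) ^+ 2.
have [n hn] : exists n : nat, D / e < n.+1%:R.
  by exists (Num.trunc (D / e)); have := truncnS_gt (D / e).
have := step n n.+1 (leqnn _).
have -> : x n n.+1 = z by rewrite /x divff // mul1r addrC subrK.
move/le_trans; apply.
have E3 (N : R) : N != 0 -> N * (K * (cabs (z - z0) / N) ^+ 2) = D / N.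
  by move=> N0; rewrite /D; field.
have -> : n.+1%:R * (K * (cabs (z - z0) / n.+1%:R) ^+ 2) = D / n.+1%:R.
  by apply: E3; rewrite pnatr_eq0.
by rewrite ler_pdivrMr ?ltr0n // mulrC -ler_pdivrMr // ltW.
Qed.

Hypothesis inj : forall z w, G z -> G w -> f z = f w -> z = w.

(** Suppose that the derivative vanishes at z0. For a near z0 with non-zero derivative
    the quotient of f at z and a has no zero in z, so the maximum principle applies to
    its inverse, and bounds the quotient below by its values on a fixed square, hence
    by a constant. At z0 the quotient is nevertheless small. So the derivative
    vanishes near z0, f is constant there, and f is not injective. *)
Lemma univalent_derivative_neq0 z0 : G z0 -> 'D_1 f z0 != 0.
Proof.
move=> Gz0; apply/eqP => f'0.
have [e0 e00 eG] := open_disk oG Gz0.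
pose r := e0 / 4.
have r0 : 0 < r by rewrite divr_gt0.
have inG z : square z0 r z -> G z.
  by move=> /square_near h; apply: eG; rewrite /disk /=; rewrite /r in h; lra.
have [m m0 hm] : exists2 m, 0 < m & forall z, square_edge z0 r z -> m <= cabs (f z - f z0).
  apply: (compact_bounded_below (compact_square_edge (c := z0) (r := r))).
    move=> z /square_edge_square/inG Gz.
    apply: (@continuous_comp _ _ _ f (fun w => cabs (w - f z0))).
      exact: derivableC_continuous (df Gz).
    exact: cabs_sub_continuous.
  move=> z ze; rewrite cabs_gt0 subr_eq0; apply/eqP => /(inj (inG _ (square_edge_square ze)) Gz0) E.
  by have := square_edge_far ze; rewrite E subrr cabs0; lra.
have /continuousC/(_ (m / 2) ltac:(by rewrite divr_gt0))[d d0 hd] := derivableC_continuous (df Gz0).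
pose k := m / (6 * r).
have k0 : 0 < k by rewrite divr_gt0 // mulr_gt0.
have [d' d'0 hd'] := quotient_near_diagonal Gz0 k0.
(* the lower bound k contradicts the smallness at z0 unless f' a = 0 *)
have zero a : cabs (a - z0) < Num.min (Num.min d d') (r / 2) -> quotient f a a = 0.
  rewrite !lt_min => /andP[/andP[ad ad'] ar]; have [->|az] := eqVneq a z0.
    by rewrite /quotient eqxx.
  apply: contrapT => /eqP qa.
  have qn w : square z0 r w -> quotient f w a != 0.
    move=> ws; have [->//|wa] := eqVneq w a.
    rewrite quotientE // mulf_neq0 ?invr_eq0 ?subr_eq0 //.
    apply: contra_neq wa; apply: inj; first exact: inG.
    by apply: eG; rewrite /disk /=; rewrite /r in ar; lra.
  have : cabs ((quotient f z0 a)^-1) <= k^-1.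
    have za : z0 != a by rewrite eq_sym.
    apply: (@max_principle R (fun z => (quotient f z a)^-1) z0 r _ a a r0 za za).
    - move=> w ws; apply: ctsV; last exact: qn.
      by apply: quotient_continuous1; apply: df; exact: inG.
    - move=> w ws wa _; apply: derivableV; first exact: qn.
      by apply: quotient_derivable => //; apply: df; exact: inG.
    move=> w we; have ws := square_edge_square we.
    have wa : w != a.
      by apply/eqP => E; have := square_edge_far we; rewrite E; lra.
    rewrite cabsV lef_pV2 ?posrE //; last by rewrite cabs_gt0 qn.
    rewrite quotientE // cabsM cabsV.
    have h1 : m / 2 <= cabs (f w - f a).
      have := hm w we; have := hd a ad; have := cabs_triangle (f a) (f w) (f z0); lra.
    have h2 : cabs (w - a) <= 3 * r.
      have := square_near ws; have := cabs_triangle z0 w a; rewrite [cabs (z0 - a)]cabsC; lra.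
    have h3 : 0 < cabs (w - a) by rewrite cabs_gt0 subr_eq0.
    rewrite ler_pdivlMr // /k mulrAC ler_pdivrMr ?mulr_gt0 //.
    have : m * cabs (w - a) <= m * (3 * r) by rewrite ler_pM2l.
    have : m / 2 * (6 * r) <= cabs (f w - f a) * (6 * r) by rewrite ler_pM2r // mulr_gt0.
    lra.
  have az0 : square z0 r z0 by rewrite /square /= subrr !cE normr0 ltW.
  rewrite cabsV lef_pV2 ?posrE ?cabs_gt0 ?qn //.
  have z00 : cabs (z0 - z0) < d' by rewrite subrr cabs0.
  by have := hd' z0 a z00 ad'; rewrite f'0 subr0; lra.
have [r' [K [r'0 K0 lip]]] := quotient_lipschitz oG Gz0 df.
pose s := Num.min (Num.min (Num.min d d') (r / 2)) r'.
have s0 : 0 < s by rewrite !lt_min d0 d'0 r'0 divr_gt0.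
have cst := @derivative_zero_quadratic z0 s K (ltW K0) _ _ (z0 + cpx (s / 2) 0).
have h : cabs (z0 + cpx (s / 2) 0 - z0) = s / 2.
  by rewrite addrAC subrr add0r cpx_real gtr0_norm // divr_gt0.
have E : z0 + cpx (s / 2) 0 = z0.
  apply: inj => //.
    apply: eG; rewrite /disk /= h.
    have : s <= r / 2 by rewrite !ge_min lexx ?orbT.
    by rewrite /r; lra.
  apply: cst; last by rewrite h; lra.
    move=> z a b; rewrite ![_ < s]lt_min => /andP[_ hz] /andP[_ ha] /andP[_ hb]; exact: lip.
  by move=> z; rewrite [_ < s]lt_min => /andP[hz _]; exact: zero.
by move: h; rewrite E subrr cabs0; lra.
Qed.

End Univalent.

(** * Openness and the inverse function *)

Section Inverse.
Context {R : realType}.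
Local Notation C := (cplane R).
Variables (f : C -> C) (G : set C).
Hypotheses (oG : open G) (df : forall z, G z -> derivable f z 1).
Hypothesis inj : forall z w, G z -> G w -> f z = f w -> z = w.
Implicit Types (z w l c a b v : C) (e d r m : R).

(** Newton's direction: moving along (v - f z) / f' z decreases the distance of f to v,
    so a minimum of that distance on an open set is zero. *)
Lemma descent z v : G z -> f z != v -> forall d, 0 < d ->
  exists2 w, cabs (w - z) < d & cabs (f w - v) < cabs (f z - v).
Proof.
move=> Gz zv d d0; have l0 := univalent_derivative_neq0 oG df inj Gz.
have H := derivable_has_deriv (df Gz); set l := 'D_1 f z in l0 H.
have al0 : 0 < cabs l by rewrite cabs_gt0.
have [d' d'0 hd] := H (cabs l / 2) ltac:(by rewrite divr_gt0).
set k := cabs (f z - v).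
have k0 : 0 < k by rewrite cabs_gt0 subr_eq0.
pose d1 := Num.min d d'; have d10 : 0 < d1 by rewrite lt_min d0.
pose t := Num.min 1 (d1 * cabs l / (2 * k)).
have t0 : 0 < t by rewrite lt_min ltr01 divr_gt0 ?mulr_gt0.
have t1 : t <= 1 by rewrite ge_min lexx.
have td : t * k / cabs l < d1.
  have : t <= d1 * cabs l / (2 * k) by rewrite ge_min lexx orbT.
  rewrite ler_pdivlMr ?mulr_gt0 // ltr_pdivrMr // => h.
  have : 0 < d1 * cabs l by rewrite mulr_gt0.
  lra.
pose h : C := cpx t 0 * (v - f z) / l.
have ct s : 0 <= s -> cabs (cpx s 0) = s by move=> s0; rewrite cpx_real ger0_norm.
have ah : cabs h = t * k / cabs l.
  by rewrite /h !cabsM cabsV ct ?ltW // [cabs (v - _)]cabsC.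
exists (z + h).
  by rewrite addrAC subrr add0r ah; move: td; rewrite lt_min => /andP[].
have := hd (z + h); rewrite addrAC subrr add0r ah.
move: td; rewrite lt_min => /andP[_ hd'] /(_ hd') {}hd.
have -> : f (z + h) - v = cpx (1 - t) 0 * (f z - v) + (f (z + h) - f z - l * h).
  have -> : l * h = cpx t 0 * (v - f z) by rewrite /h mulrC divfK.
  have -> : cpx (1 - t) 0 = 1 - cpx t 0 by apply: cpx_inj; rewrite !cE; ring.
  by ring.
apply: le_lt_trans (cabsD _ _) _; rewrite cabsM ct ?subr_ge0 //.
apply: (@le_lt_trans _ _ ((1 - t) * k + t * k / 2)).
  rewrite lerD2l; apply: le_trans hd _; rewrite le_eqVlt; apply/orP; left.
  by apply/eqP; field; rewrite lt0r_neq0.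
have : 0 < t * k by rewrite mulr_gt0.
by lra.
Qed.

(** The distance of f to v has a minimum on the closed disk. On the circle it exceeds
    its value at the centre, so the minimum is inside, where descent makes it zero. *)
Lemma image_contains_disk c r m : 0 < r -> (forall z, cabs (z - c) <= r -> G z) ->
  (forall z, cabs (z - c) = r -> m <= cabs (f z - f c)) ->
  forall v, cabs (v - f c) < m / 2 -> exists2 z, cabs (z - c) < r & f z = v.
Proof.
move=> r0 inG hm v hv.
pose K : set C := [set z | cabs (z - c) <= r].
have Kc : K c by rewrite /K /= subrr cabs0 ltW.
have [|z] := @compact_EVT_min _ R (fun z => cabs (f z - v)) K (ex_intro _ c Kc) (compact_cdisk (c := c) (r := r)).
  apply: continuous_in_subspaceT => z; rewrite inE => Kz.
  apply: (@continuous_comp _ _ _ f (fun w => cabs (w - v))).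
    exact: derivableC_continuous (df (inG _ Kz)).
  exact: cabs_sub_continuous.
rewrite inE => Kz hmin.
have hc : cabs (f z - v) < m / 2.
  by apply: le_lt_trans hv; rewrite [leRHS]cabsC; apply: hmin; rewrite inE.
have zr : cabs (z - c) < r.
  rewrite lt_neqAle Kz andbT; apply/eqP => /hm h.
  by have := cabs_triangle v (f z) (f c); lra.
exists z => //; apply: contrapT => /eqP fz.
have rz : 0 < r - cabs (z - c) by lra.
have [w hw] := descent (inG _ Kz) fz rz.
apply/negP; rewrite -leNgt; apply: hmin; rewrite inE /K /=.
by have := cabs_triangle z w c; lra.
Qed.

Lemma circle_image_far c r : 0 < r -> (forall z, cabs (z - c) <= r -> G z) ->
  exists2 m, 0 < m & forall z, cabs (z - c) = r -> m <= cabs (f z - f c).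
Proof.
move=> r0 inG; have Gc : G c by apply: inG; rewrite subrr cabs0 ltW.
have cK : compact [set z : C | cabs (z - c) = r].
  apply: (subclosed_compact _ (compact_cdisk (c := c) (r := r))); last by move=> z /= ->.
  have -> : [set z : C | cabs (z - c) = r] = (fun z : C => cabs (z - c)) @^-1` [set x | x = r] by [].
  apply: closed_comp; last exact: closed_eq.
  by move=> z _; exact: cabs_sub_continuous.
apply: (compact_bounded_below cK) => z /= zr.
  apply: (@continuous_comp _ _ _ f (fun w => cabs (w - f c))).
    by apply: derivableC_continuous; apply: df; apply: inG; rewrite zr.
  exact: cabs_sub_continuous.
have Gz : G z by apply: inG; rewrite zr.
rewrite cabs_gt0 subr_eq0; apply/eqP => /(inj Gz Gc) E.
by move: r0; rewrite -zr E subrr cabs0 ltxx.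
Qed.

Lemma image_disk z : G z -> forall e, 0 < e -> exists2 d : R, 0 < d &
  forall v, cabs (v - f z) < d -> exists w, [/\ cabs (w - z) < e, G w & f w = v].
Proof.
move=> Gz e e0; have [r0 r00 rG] := open_disk oG Gz.
pose r := Num.min e (r0 / 2).
have rr : 0 < r by rewrite lt_min e0 divr_gt0.
have inG w : cabs (w - z) <= r -> G w.
  by rewrite le_min => /andP[_ h]; apply: rG; rewrite /disk /=; lra.
have [m m0 hm] := circle_image_far rr inG.
exists (m / 2); first by rewrite divr_gt0.
move=> v hv; have [w wr <-] := image_contains_disk rr inG hm hv.
exists w; split=> //; last exact: inG (ltW wr).
by apply: (lt_le_trans wr); rewrite ge_min lexx.
Qed.

Lemma open_image : open (f @` G).
Proof.
apply: disk_open => _ [z Gz <-]; have [d d0 hd] := image_disk Gz ltr01.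
by exists d => // v /hd[w [_ Gw <-]]; exists w.
Qed.

Variable g : C -> C.
Hypothesis gK : forall z, G z -> g (f z) = z.

Lemma inverse_continuous z : G z -> {for f z, continuous g}.
Proof.
move=> Gz; apply/continuousC => e e0; have [d d0 hd] := image_disk Gz e0.
by exists d => // v /hd[w [wz Gw <-]]; rewrite !gK.
Qed.

Lemma inverse_derivable z : G z -> derivable g (f z) 1.
Proof.
move=> Gz; have l0 := univalent_derivative_neq0 oG df inj Gz.
have H := derivable_has_deriv (df Gz); set l := 'D_1 f z in l0 H.
have al0 : 0 < cabs l by rewrite cabs_gt0.
apply: (@has_deriv_derivable _ _ _ (l^-1)) => e e0.
pose k := Num.min (cabs l / 2) (e * cabs l * (cabs l / 2)).
have k0 : 0 < k by rewrite lt_min !mulr_gt0 ?invr_gt0.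
have [d d0 hd] := H k k0; have [d' d'0 hd'] := image_disk Gz d0.
exists d' => // v /hd'[w [wz Gw <-]]; rewrite !gK //.
have h := hd w wz; set D := cabs (w - z) in h.
have D0 : 0 <= D by exact: cabs_ge0.
have low : cabs l / 2 * D <= cabs (f w - f z).
  have h1 : k * D <= cabs l / 2 * D by rewrite ler_wpM2r // ge_min lexx.
  have := cabsB (l * (w - z)) (f w - f z); rewrite [cabs (_ - (f w - f z))]cabsC cabsM -/D; lra.
have -> : w - z - l^-1 * (f w - f z) = - (l^-1 * (f w - f z - l * (w - z))).
  by field.
rewrite cabsN cabsM cabsV ler_pdivrMl //; apply: le_trans h _.
apply: (@le_trans _ _ (e * cabs l * (cabs l / 2) * D)).
  by rewrite ler_wpM2r // ge_min lexx orbT.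
have : e * cabs l * (cabs l / 2 * D) <= e * cabs l * cabs (f w - f z).
  by rewrite ler_pM2l // mulr_gt0.
by lra.
Qed.

End Inverse.

(** * Continuous square roots *)

Section PrincipalRoot.
Context {R : realType}.
Local Notation C := (cplane R).
Implicit Types (z w l c a b v : C) (e d r m x t : R).

(** The bisector z + |z| of the angle between z and the positive axis, rescaled. *)
Definition principal_root z : C :=
  (z + cpx (cabs z) 0) / cpx (Num.sqrt (2 * (cabs z + cre z))) 0.
Local Notation rt := principal_root.

Lemma cpx_neq0 x : x != 0 -> cpx x 0 != 0.
Proof. by move=> x0; rewrite -cabs_eq0 cpx_real normr_eq0. Qed.

Lemma principal_root_sqr z : 0 < cabs z + cre z -> rt z ^+ 2 = z.
Proof.
move=> z0; rewrite /rt expr_div_n.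
have k0 : 0 < 2 * (cabs z + cre z) by rewrite mulr_gt0.
have -> : cpx (Num.sqrt (2 * (cabs z + cre z))) 0 ^+ 2 = cpx (2 * (cabs z + cre z)) 0.
  by apply: cpx_inj; rewrite !expr2 !cE ?mulr0 ?mul0r ?subr0 ?addr0 // -expr2 sqr_sqrtr // ltW.
have E : (z + cpx (cabs z) 0) ^+ 2 = z * cpx (2 * (cabs z + cre z)) 0.
  have := sqr_cabs z; rewrite !expr2 => h.
  by apply: cpx_inj; rewrite !cE; lra.
by rewrite E mulfK // cpx_neq0 // lt0r_neq0.
Qed.

Lemma principal_root_neq0 z : 0 < cabs z + cre z -> rt z != 0.
Proof.
move=> z0; have E := principal_root_sqr z0; apply/eqP => h.
have : z = 0 by rewrite -E; apply/eqP; rewrite expf_eq0 h eqxx.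
by move=> zz; move: z0; rewrite zz cabs0 !cE addr0 ltxx.
Qed.

Lemma principal_root_continuous z : 0 < cabs z + cre z -> {for z, continuous rt}.
Proof.
move=> z0; have k0 : 0 < 2 * (cabs z + cre z) by rewrite mulr_gt0.
have c0 : {for z, continuous (fun _ : C => 0 : R)} by exact: cst_continuous.
have c1 : {for z, continuous (fun z : C => z + cpx (cabs z) 0)}.
  apply: (@ctsD R _ (fun z : C => z) (fun z => cpx (cabs z) 0)); first exact: cts_id.
  exact: (@cpx_continuous R _ (@cabs R) (fun=> 0) z (@cabs_continuous R z) c0).
have c2 : {for z, continuous (fun z : C => Num.sqrt (2 * (cabs z + cre z)))}.
  apply: (@continuous_comp _ _ _ (fun z : C => 2 * (cabs z + cre z)) Num.sqrt); last exact: sqrt_continuous.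
  have c3 : {for z, continuous (fun _ : C => 2 : R)} by exact: cst_continuous.
  exact: (cvgM c3 (cvgD (@cabs_continuous R z) (@cre_continuous R z))).
apply: (cts_div c1 (@cpx_continuous R _ _ (fun=> 0) z c2 c0)).
by rewrite cpx_neq0 // lt0r_neq0 // sqrtr_gt0.
Qed.

Lemma right_half_plane z : 0 < cre z -> 0 < cabs z + cre z.
Proof. by move=> h; rewrite ltr_wpDl ?cabs_ge0. Qed.

Lemma near1_right z : cabs (z - 1) < 1 -> 0 < cre z.
Proof.
move=> h; have := le_lt_trans (cre_cabs _) h; rewrite !cE ltr_norml; lra.
Qed.

(** A root of - i z rather than of z: it is continuous on the closed upper half-plane
    without the origin. Only quotients of its values occur below, and the constant
    factor cancels there. *)
Definition half_plane_root z : C := rt (cpx 0 (- 1) * z).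
Local Notation hrt := half_plane_root.

Lemma half_plane_pos z : 0 <= cim z -> z != 0 ->
  0 < cabs (cpx 0 (- 1) * z) + cre (cpx 0 (- 1) * z).
Proof.
move=> h z0; rewrite cabsM cpx_imag normrN normr1 mul1r !cE mul0r sub0r mulN1r opprK.
by rewrite ltr_pwDl // cabs_gt0.
Qed.

Lemma half_plane_root_sqr z : 0 <= cim z -> z != 0 -> hrt z ^+ 2 = cpx 0 (- 1) * z.
Proof. by move=> h z0; rewrite principal_root_sqr // half_plane_pos. Qed.

Lemma half_plane_root_neq0 z : 0 <= cim z -> z != 0 -> hrt z != 0.
Proof. by move=> h z0; rewrite principal_root_neq0 // half_plane_pos. Qed.

Lemma half_plane_root_continuous z : 0 <= cim z -> z != 0 -> {for z, continuous hrt}.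
Proof.
move=> h z0; apply: (@continuous_comp _ _ _ (fun z : C => cpx 0 (- 1) * z) rt).
  exact: (@ctsM R _ (fun=> cpx 0 (- 1)) (fun z : C => z) z (@cts_cst R _ _ z) (@cts_id R z)).
by apply: principal_root_continuous; exact: half_plane_pos.
Qed.

(** The quarter turn between the two sides of the origin is what finally
    distinguishes interlacing quadruples of real points. *)
Lemma half_plane_root_opp x : 0 < x -> hrt (cpx (- x) 0) = cpx 0 1 * hrt (cpx x 0).
Proof.
move=> x0; rewrite /hrt /rt.
have -> : cpx 0 (- 1) * cpx (- x) 0 = cpx 0 x by apply: cpx_inj; rewrite !cE; ring.
have -> : cpx 0 (- 1) * cpx x 0 = cpx 0 (- x) by apply: cpx_inj; rewrite !cE; ring.
rewrite !cpx_imag normrN (gtr0_norm x0) !cE mulrA; congr (_ / _).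
by apply: cpx_inj; rewrite !cE; ring.
Qed.

End PrincipalRoot.

Section ContinuousRoot.
Context {R : realType}.
Local Notation C := (cplane R).
Variables (b B : R) (F : C -> C -> C).
Hypotheses (b0 : b <= B) (B0 : 0 <= B).
Implicit Types (z w : C).

(** The same bound B for both coordinates puts i B in the box, where it serves as the
    base point of rays. *)
Definition box : set C := [set z | - B <= cre z <= B /\ b <= cim z <= B].

Hypothesis cF : forall z w, box z -> box w ->
  {for (z, w), continuous (fun p : C * C => F p.1 p.2)}.
Hypothesis F0 : forall z w, box z -> box w -> F z w != 0.

Let base : C := cpx 0 B.
Let proj z : C := cpx (Num.max (- B) (Num.min B (cre z))) (Num.max b (Num.min B (cim z))).

Let proj_in z : box (proj z).
Proof.
split; rewrite /proj ?cre_cpx ?cim_cpx; rewrite le_max lexx ge_max ge_min lexx /= ?andbT //; have := B0; lra.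
Qed.

Let proj_id z : box z -> proj z = z.
Proof.
move=> [/andP[h1 h2] /andP[h3 h4]]; apply: cpx_inj; rewrite /proj ?cre_cpx ?cim_cpx;
  by rewrite min_r // max_r.
Qed.

Let proj_continuous : continuous proj.
Proof.
move=> z; apply: (@cpx_continuous R _ (fun z => Num.max (- B) (Num.min B (cre z)))
   (fun z => Num.max b (Num.min B (cim z)))).
  apply: (@continuous_max _ _ (fun=> - B : R^o) (fun z => Num.min B (cre z) : R^o)); first exact: cst_continuous.
  by apply: (@continuous_min _ _ (fun=> B : R^o) (fun z => cre z : R^o)); [exact: cst_continuous|exact: cre_continuous].
apply: (@continuous_max _ _ (fun=> b : R^o) (fun z => Num.min B (cim z) : R^o)); first exact: cst_continuous.
by apply: (@continuous_min _ _ (fun=> B : R^o) (fun z => cim z : R^o)); [exact: cst_continuous|exact: cim_continuous].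
Qed.

Let ray (t : R) z : C := base + cpx t 0 * (proj z - base).

Let ray_in t z : 0 <= t <= 1 -> box (ray t z).
Proof.
move=> /andP[t0 t1]; have [p1 p2] := proj_in z.
have -> : ray t z = cpx (t * cre (proj z)) (B + t * (cim (proj z) - B)).
  by apply: cpx_inj; rewrite /ray /base !cE; ring.
move: p1 p2; set x := cre (proj z); set y := cim (proj z) => p1 p2.
split; rewrite ?cre_cpx ?cim_cpx; apply/andP; split.
- have : t * - B <= t * x by rewrite ler_wpM2l //; lra.
  have : t * B <= 1 * B by rewrite ler_wpM2r //; lra.
  lra.
- have : t * x <= t * B by rewrite ler_wpM2l //; lra.
  have : t * B <= 1 * B by rewrite ler_wpM2r //; lra.
  lra.
- have : t * (b - B) <= t * (y - B) by rewrite ler_wpM2l //; lra.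
  have : t * (B - b) <= 1 * (B - b) by rewrite ler_wpM2r //; lra.
  lra.
- have : t * (y - B) <= t * 0 by rewrite ler_wpM2l //; lra.
  lra.
Qed.

Let ray_continuous t : continuous (ray t).
Proof.
move=> z; have c1 : {for z, continuous (fun z => proj z - base)}.
  exact: (@ctsB R _ proj (fun=> base) z (@proj_continuous z) (@cts_cst R _ base z)).
exact: (ctsD (@cts_cst R _ base z) (ctsM (@cts_cst R _ (cpx t 0) z) c1)).
Qed.

Let ray_step t t' z : cabs (ray t z - ray t' z) <= `|t - t'| * (4 * B + `|b|).
Proof.
have -> : ray t z - ray t' z = cpx (t - t') 0 * (proj z - base).
  have -> : cpx (t - t') 0 = cpx t 0 - cpx t' 0 by apply: cpx_inj; rewrite !cE; ring.
  by rewrite /ray; ring.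
rewrite cabsM cpx_real ler_wpM2l //; apply: le_trans (cabs_le_re_im _) _.
have [p1 p2] := proj_in z; rewrite /base !cE.
have : `|cre (proj z) - 0| <= B by rewrite subr0 ler_norml.
have h := ler_norm b; have h' := ler_norm (- b); rewrite normrN in h'.
have : `|cim (proj z) - B| <= 2 * B + `|b| by rewrite ler_norml; lra.
have := normr_ge0 b; lra.
Qed.

Let uniform : exists2 d : R, 0 < d & forall z w z' w', box z -> box w -> box z' -> box w' ->
  cabs (z' - z) < d -> cabs (w' - w) < d -> cabs (F z' w' - F z w) < cabs (F z w).
Proof.
have cb : compact box by exact: compact_rectangle.
have /compact_near_coveringP cov := compact_setX cb cb.
pose P (d : R) (p : C * C) := forall z' w', box z' -> box w' ->
   cabs (z' - p.1) < d -> cabs (w' - p.2) < d -> box p.1 -> box p.2 ->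
   cabs (F z' w' - F p.1 p.2) < cabs (F p.1 p.2).
have : \forall d \near (0 : R)^'+, (box `*` box) `<=` P d.
  apply: cov.
  move=> [z w] [bz bw]; set m := cabs (F z w).
  have m0 : 0 < m by rewrite cabs_gt0; exact: F0.
  have m4 : 0 < m / 4 by rewrite divr_gt0.
  have := cF bz bw (disk_nbhs _ m4).
  rewrite /nbhs /= => -[[A1 A2] /= [/nbhs_disk[d1 d10 h1] /nbhs_disk[d2 d20 h2]] h].
  pose d := Num.min d1 d2 / 2.
  have d0 : 0 < d by rewrite divr_gt0 // lt_min d10.
  have near z' w' : cabs (z' - z) < 2 * d -> cabs (w' - w) < 2 * d -> cabs (F z' w' - F z w) < m / 4.
    have -> : 2 * d = Num.min d1 d2 by rewrite /d; field.
    by rewrite !lt_min => /andP[/h1 a1 _] /andP[_ /h2 a2]; exact: (h (z', w') (conj a1 a2)).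
  exists (disk z d `*` disk w d, [set e | e < d]) => /=.
    split; first by exists (disk z d, disk w d) => //=; split; exact: disk_nbhs.
    exact: nbhs_right_lt.
  move=> [[z1 w1] e] [[/= hz hw] he] z' w' bz' bw' hz' hw' b1 b2.
  rewrite /disk /= in hz hw he hz' hw'.
  have n1 := near z1 w1 ltac:(lra) ltac:(lra).
  have n2 : cabs (F z' w' - F z w) < m / 4.
    by apply: near; [have := cabs_triangle z1 z' z; lra|have := cabs_triangle w1 w' w; lra].
  have := cabs_triangle (F z w) (F z' w') (F z1 w1); rewrite [cabs (F z w - _)]cabsC.
  have := cabsB (F z w) (F z1 w1); rewrite [cabs (F z w - _)]cabsC -/m; lra.
move=> H; near (0 : R)^'+ => d; exists d; first by near: d; exact: nbhs_right_gt.
move=> z w z' w' bz bw bz' bw' hz hw.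
have Pd : (box `*` box) `<=` P d by near: d.
exact: (Pd (z, w) (conj bz bw) z' w' bz' bw' hz hw bz bw).
Unshelve. all: by end_near. Qed.

(** Along the rays to the base point, F is subdivided so finely, uniformly in (z, w), that
    consecutive values have a ratio in the right half-plane. The product of the principal
    roots of the ratios is a square root of the quotient of F by its value at the base
    point, and a continuous one. *)
Lemma continuous_root : exists s : C -> C -> C,
  [/\ forall z w, box z -> box w -> s z w ^+ 2 = F z w,
      forall z w, {for z, continuous (s ^~ w)} & forall z w, {for w, continuous (s z)}].
Proof.
have [d d0 hd] := uniform.
pose L := 4 * B + `|b| + 1.
have L0 : 0 < L by rewrite /L; have := B0; have := normr_ge0 b; lra.
have [n hn] : exists n : nat, L / d < n.+1%:R.
  by exists (Num.trunc (L / d)); have := truncnS_gt (L / d).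
pose tt (k : nat) : R := k%:R / n.+1%:R.
have tt1 k : (k <= n.+1)%N -> 0 <= tt k <= 1.
  by move=> kn; rewrite /tt divr_ge0 //= ler_pdivrMr ?ltr0n // mul1r ler_nat.
pose V k z w := F (ray (tt k) z) (ray (tt k) w).
have Vn k z w : (k <= n.+1)%N -> V k z w != 0.
  by move=> /tt1 h; apply: F0; exact: ray_in.
have stp k z : cabs (ray (tt k.+1) z - ray (tt k) z) < d.
  apply: le_lt_trans (ray_step _ _ _) _.
  have -> : tt k.+1 - tt k = n.+1%:R^-1 by rewrite /tt -mulrBl -natr1 addrC addKr mul1r.
  rewrite ger0_norm ?invr_ge0 // mulrC ltr_pdivrMr ?ltr0n //.
  by move: hn; rewrite ltr_pdivrMr // /L [d * _]mulrC; lra.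
have ratio k z w : (k < n.+1)%N -> 0 < cabs (V k.+1 z w / V k z w) + cre (V k.+1 z w / V k z w).
  move=> kn; apply: right_half_plane; apply: near1_right.
  have v0 := Vn k z w (ltnW kn).
  have -> : V k.+1 z w / V k z w - 1 = (V k.+1 z w - V k z w) / V k z w by field.
  rewrite cabsM cabsV ltr_pdivrMr ?cabs_gt0 // mul1r.
  by apply: hd => //; apply: ray_in; apply: tt1 => //; exact: ltnW.
have [s0 s0E] : exists s0, s0 ^+ 2 = V 0%N 0 0.
  by exists (sqrtC (V 0%N 0 0)); exact: sqrtCK.
have V00 z w : V 0%N z w = V 0%N 0 0.
  rewrite /V /tt /ray mul0r.
  have -> : cpx 0 0 = 0 by [].
  by rewrite !mul0r.
pose s z w : C := s0 * \prod_(k < n.+1) principal_root (V k.+1 z w / V k z w).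
have sE z w : s z w ^+ 2 = V n.+1 z w.
  rewrite /s exprMn s0E -prodrXl -(V00 z w).
  have : forall m, (m <= n.+1)%N -> V 0%N z w *
     \prod_(k < m) principal_root (V k.+1 z w / V k z w) ^+ 2 = V m z w.
    elim=> [|m IH] mn; first by rewrite big_ord0 mulr1.
    rewrite big_ord_recr /= mulrA IH ?(ltnW mn) // principal_root_sqr; last exact: ratio.
    by rewrite mulrC divfK // Vn // ltnW.
  exact.
exists s; split.
- move=> z w bz bw; rewrite sE /V /ray /tt divff ?pnatr_eq0 //.
  have -> : cpx 1 0 = 1 by [].
  by rewrite !mul1r ![base + _]addrC !subrK !proj_id.
- move=> z w; apply: (@ctsM R _ (fun=> s0)); first exact: cts_cst.
  have : forall m, (m <= n.+1)%N ->
      {for z, continuous (fun z => \prod_(k < m) principal_root (V k.+1 z w / V k z w))}.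
    elim=> [|m IH] mn.
      have -> : (fun z => \prod_(k < 0) principal_root (V k.+1 z w / V k z w)) = (fun=> 1).
        by apply: funext => y; rewrite big_ord0.
      exact: cts_cst.
    have -> : (fun z => \prod_(k < m.+1) principal_root (V k.+1 z w / V k z w)) =
       (fun z => \prod_(k < m) principal_root (V k.+1 z w / V k z w) *
          principal_root (V m.+1 z w / V m z w)).
      by apply: funext => y; rewrite big_ord_recr.
    apply: ctsM; first by apply: IH; exact: ltnW.
    apply: (@continuous_comp _ _ _ (fun z => V m.+1 z w / V m z w) principal_root); last first.
      by apply: principal_root_continuous; exact: ratio.
    have cV k : (k <= n.+1)%N -> {for z, continuous (fun z => V k z w)}.
      move=> kn; apply: (@continuous_comp _ _ _ (fun z => (ray (tt k) z, ray (tt k) w)) (fun p => F p.1 p.2)).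
        have c1 := @ray_continuous (tt k) z.
        have c2 : {for z, continuous (fun _ : C => ray (tt k) w)} by exact: cts_cst.
        exact: (cvg_pair c1 c2).
      by apply: cF; apply: ray_in; exact: tt1.
    by apply: cts_div; [exact: cV|apply: cV; exact: ltnW|apply: Vn; exact: ltnW].
  exact.
- move=> z w; apply: (@ctsM R _ (fun=> s0)); first exact: cts_cst.
  have : forall m, (m <= n.+1)%N ->
      {for w, continuous (fun w => \prod_(k < m) principal_root (V k.+1 z w / V k z w))}.
    elim=> [|m IH] mn.
      have -> : (fun w => \prod_(k < 0) principal_root (V k.+1 z w / V k z w)) = (fun=> 1).
        by apply: funext => y; rewrite big_ord0.
      exact: cts_cst.
    have -> : (fun w => \prod_(k < m.+1) principal_root (V k.+1 z w / V k z w)) =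
       (fun w => \prod_(k < m) principal_root (V k.+1 z w / V k z w) *
          principal_root (V m.+1 z w / V m z w)).
      by apply: funext => y; rewrite big_ord_recr.
    apply: ctsM; first by apply: IH; exact: ltnW.
    apply: (@continuous_comp _ _ _ (fun w => V m.+1 z w / V m z w) principal_root); last first.
      by apply: principal_root_continuous; exact: ratio.
    have cV k : (k <= n.+1)%N -> {for w, continuous (V k z)}.
      move=> kn; apply: (@continuous_comp _ _ _ (fun w => (ray (tt k) z, ray (tt k) w)) (fun p => F p.1 p.2)).
        have c1 := @ray_continuous (tt k) w.
        have c2 : {for w, continuous (fun _ : C => ray (tt k) z)} by exact: cts_cst.
        exact: (cvg_pair c2 c1).
      by apply: cF; apply: ray_in; exact: tt1.
    by apply: cts_div; [exact: cV|apply: cV; exact: ltnW|apply: Vn; exact: ltnW].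
  exact.
Qed.

End ContinuousRoot.

(** * Square roots of the difference quotient along connected sets *)

Section Connected.
Context {R : realType}.
Local Notation C := (cplane R).
Implicit Types (z w p q : C) (e d r m x t : R).

Definition half_plane : set C := [set z | 0 < cim z].

Lemma connected_sign (T : topologicalType) (A : set T) (h : T -> R) (p q : T) : connected A ->
  (forall t : T, A t -> {for t, continuous h}) -> (forall t : T, A t -> h t != 0) ->
  A p -> A q -> 0 < h q -> 0 < h p.
Proof.
move=> cA ch h0 Ap Aq hq; rewrite ltNge; apply/negP => hp.
have : connected (h @` A).
  apply: connected_continuous_connected => //.
  by apply: continuous_in_subspaceT => z; rewrite inE; exact: ch.
move/connected_intervalP => /(_ (h p) (h q)) H.
have [|||z Az hz] := H _ _ 0; [by exists p|by exists q|by rewrite hp ltW|].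
by have := h0 z Az; rewrite hz eqxx.
Qed.

Definition segment p q : R -> C := fun t => p + cpx t 0 * (q - p).

Lemma segment0 p q : segment p q 0 = p.
Proof. by rewrite /segment (_ : cpx 0 0 = 0) // mul0r addr0. Qed.

Lemma segment1 p q : segment p q 1 = q.
Proof. by rewrite /segment (_ : cpx 1 0 = 1) // mul1r addrC subrK. Qed.

Lemma segment_continuous p q : continuous (segment p q).
Proof.
move=> t; have c1 : {for t, continuous (fun t : R => cpx t 0)}.
  by apply: (@cpx_continuous R _ (fun t => t) (fun=> 0)); [exact: cvg_id|exact: cst_continuous].
exact: (ctsD (@cts_cst R _ p t) (ctsM c1 (@cts_cst R _ (q - p) t))).
Qed.

Lemma segment_im p q t : cim (segment p q t) = cim p + t * (cim q - cim p).
Proof. by rewrite /segment !cE; ring. Qed.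

Lemma segment_re p q t : cre (segment p q t) = cre p + t * (cre q - cre p).
Proof. by rewrite /segment !cE; ring. Qed.

Lemma between x y t : 0 <= t <= 1 -> forall a b, a <= x <= b -> a <= y <= b ->
  a <= x + t * (y - x) <= b.
Proof.
move=> /andP[t0 t1] a b /andP[ax xb] /andP[ay yb].
have -> : x + t * (y - x) = (1 - t) * x + t * y by ring.
have := ler_wpM2l t0 ay; have := ler_wpM2l t0 yb.
have s0 : 0 <= 1 - t by lra.
have := ler_wpM2l s0 ax; have := ler_wpM2l s0 xb; lra.
Qed.

Lemma near1M z w (a b : R) : cabs (z - 1) <= a -> cabs (w - 1) <= b ->
  cabs (z * w - 1) <= a + b + a * b.
Proof.
move=> ha hb; have -> : z * w - 1 = (z - 1) + (w - 1) + (z - 1) * (w - 1) by ring.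
apply: le_trans (cabsD _ _) _; apply: lerD.
  by apply: le_trans (cabsD _ _) _; apply: lerD.
by rewrite cabsM; apply: ler_pM; rewrite ?cabs_ge0.
Qed.

End Connected.

Section Interlacing.
Context {R : realType}.
Local Notation C := (cplane R).
Local Notation H := (@half_plane R).
Variable f : C -> C.
Hypotheses (df : forall z, H z -> derivable f z 1)
  (inj : forall z w, H z -> H w -> f z = f w -> z = w).
Implicit Types (z w p q lam mu : C) (e d r x t T : R) (g h : R -> C).

Lemma open_half_plane : open H.
Proof.
have -> : H = (@cim R) @^-1` [set x | 0 < x] by [].
apply: open_comp; last exact: open_gt.
by move=> z _; exact: cim_continuous.
Qed.

Lemma half_plane_sub_real z (x : R) : H z -> z - cpx x 0 != 0 /\ 0 <= cim (z - cpx x 0).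
Proof.
move=> Hz; rewrite !cE subr0; split; last exact: ltW.
apply/eqP => E; move: Hz; rewrite /half_plane /= -[cim z]subr0 -[X in _ - X](@cim_cpx R x 0).
by rewrite -cimN -cimD E ltxx.
Qed.

Definition root_quotient (x y : R) z :=
  half_plane_root (z - cpx y 0) / half_plane_root (z - cpx x 0).

Lemma root_quotient_continuous x y z : z - cpx x 0 != 0 -> z - cpx y 0 != 0 -> 0 <= cim z ->
  {for z, continuous (root_quotient x y)}.
Proof.
move=> zx zy z0.
have k a : z - cpx a 0 != 0 -> {for z, continuous (fun z => half_plane_root (z - cpx a 0))}.
  move=> za; apply: (@continuous_comp _ _ _ (fun z => z - cpx a 0) (@half_plane_root R)).
    exact: (ctsB (@cts_id R z) (@cts_cst R _ (cpx a 0) z)).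
  by apply: half_plane_root_continuous => //; rewrite !cE subr0.
apply: (cts_div (k y zy) (k x zx)); apply: half_plane_root_neq0 => //.
by rewrite !cE subr0.
Qed.

Lemma root_quotient_neq0 x y z : z - cpx x 0 != 0 -> z - cpx y 0 != 0 -> 0 <= cim z ->
  root_quotient x y z != 0.
Proof.
move=> zx zy z0; rewrite /root_quotient mulf_neq0 // ?invr_eq0 half_plane_root_neq0 //;
  by rewrite !cE subr0.
Qed.

Lemma root_quotient_sqr x y z : z - cpx x 0 != 0 -> z - cpx y 0 != 0 -> 0 <= cim z ->
  root_quotient x y z ^+ 2 = (z - cpx y 0) / (z - cpx x 0).
Proof.
move=> zx zy z0; rewrite /root_quotient expr_div_n !half_plane_root_sqr // ?cE ?subr0 //.
rewrite -mulf_div divff ?mul1r //.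
by rewrite -cabs_eq0 cpx_imag normrN normr1 oner_eq0.
Qed.

(** Let u and v be roots of the difference quotient of f against e2 and e4, where f e2
    and f e4 are both close to mu. As z runs through a connected set on which f stays
    away from mu, the quotient (u / v) ^ 2 is
      (f z - f e2) / (f z - f e4) * (z - e4) / (z - e2),
    which is close to (z - x4) / (z - x2). Hence u / v agrees with the explicit root of
    the latter up to a factor close to 1 or to -1, and the sign is the same at p and q. *)
Lemma root_ratio (A : set C) p q (u v : C -> C) (e2 e4 : C) (x2 x4 : R) mu (eta dl : R) :
  connected A -> A `<=` H -> A p -> A q -> H e2 -> H e4 ->
  (forall z, A z -> {for z, continuous u}) -> (forall z, A z -> {for z, continuous v}) ->
  (forall z, A z -> u z ^+ 2 = quotient f z e2) ->
  (forall z, A z -> v z ^+ 2 = quotient f z e4) ->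
  (forall z, A z -> eta <= cabs (z - cpx x2 0)) ->
  (forall z, A z -> eta <= cabs (z - cpx x4 0)) ->
  (forall z, A z -> eta <= cabs (f z - mu)) ->
  0 < dl -> 1000 * dl <= eta ->
  cabs (e2 - cpx x2 0) < dl -> cabs (e4 - cpx x4 0) < dl ->
  cabs (f e2 - mu) < dl -> cabs (f e4 - mu) < dl ->
  exists2 rho : C, cabs (rho - 1) <= 1 / 8 &
    (u p / v p) / (u q / v q) = rho * (root_quotient x2 x4 p / root_quotient x2 x4 q).
Proof.
move=> cA AH Ap Aq H2 H4 cu cv u2 v2 d2 d4 dm dl0 dle h2 h4 f2 f4.
set m := root_quotient x2 x4.
have off z : A z -> [/\ z != e2, z != e4, z - cpx x2 0 != 0 & z - cpx x4 0 != 0].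
  move=> Az; split; [apply/eqP => E|apply/eqP => E| |].
  - by have := d2 z Az; rewrite E; lra.
  - by have := d4 z Az; rewrite E; lra.
  - by have [] := half_plane_sub_real x2 (AH _ Az).
  - by have [] := half_plane_sub_real x4 (AH _ Az).
have q0 z w : H z -> H w -> quotient f z w != 0.
  move=> Hz Hw; have [->|zw] := eqVneq z w.
    by rewrite /quotient eqxx; exact: (univalent_derivative_neq0 open_half_plane df inj).
  rewrite quotientE // mulf_neq0 ?invr_eq0 ?subr_eq0 //.
  by apply: contra_neq zw; exact: inj.
have u0 z : A z -> u z != 0.
  move=> Az; have : u z ^+ 2 != 0 by rewrite u2 //; apply: q0 => //; exact: AH.
  by rewrite expf_eq0.
have v0 z : A z -> v z != 0.
  move=> Az; have : v z ^+ 2 != 0 by rewrite v2 //; apply: q0 => //; exact: AH.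
  by rewrite expf_eq0.
have m0 z : A z -> m z != 0.
  by move=> Az; have [_ _ z2 z4] := off z Az; apply: root_quotient_neq0 => //; exact: ltW (AH _ Az).
pose k z := u z / v z / m z.
have k0 z : A z -> k z != 0.
  by move=> Az; rewrite /k !mulf_neq0 ?invr_eq0 ?u0 ?v0 ?m0.
have kE z : A z -> cabs (k z ^+ 2 - 1) <= 1 / 20.
  move=> Az; have [z2 z4 zx2 zx4] := off z Az.
  have ze2 : z - e2 != 0 by rewrite subr_eq0.
  have ze4 : z - e4 != 0 by rewrite subr_eq0.
  have D2 := d2 z Az; have D4 := d4 z Az; have Dm := dm z Az.
  have F2 : dl * 200 <= cabs (z - e2).
    by have := cabs_triangle e2 z (cpx x2 0); lra.
  have F4 : dl * 200 <= cabs (f z - f e4).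
    by have := cabs_triangle (f e4) (f z) mu; lra.
  have fz4 : f z - f e4 != 0 by rewrite -cabs_gt0; lra.
  have -> : k z ^+ 2 = (f z - f e2) / (f z - f e4) * ((z - e4) / (z - cpx x4 0)) *
       ((z - cpx x2 0) / (z - e2)).
    rewrite /k 2!expr_div_n u2 // v2 // root_quotient_sqr //; last exact: ltW (AH _ Az).
    by rewrite !quotientE //; field; rewrite ze2 ze4 zx2 zx4 fz4.
  have frac (a b : C) : cabs a <= 2 * dl -> dl * 200 <= cabs b -> cabs (a / b) <= 1 / 100.
    move=> ha hb; rewrite cabsM cabsV ler_pdivrMr; first by clear -ha hb; lra.
    by apply: lt_le_trans hb; rewrite mulr_gt0.
  have dl2 : dl <= 2 * dl by clear -dl0; lra.
  have E1 : cabs ((f z - f e2) / (f z - f e4) - 1) <= 1 / 100.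
    have -> : (f z - f e2) / (f z - f e4) - 1 = (f e4 - f e2) / (f z - f e4) by field.
    apply: frac F4; apply: le_trans (cabs_triangle mu _ _) _.
    by rewrite [cabs (mu - _)]cabsC; clear -f2 f4; lra.
  have dle' : dl * 200 <= eta by clear -dle dl0; lra.
  have E2 : cabs ((z - e4) / (z - cpx x4 0) - 1) <= 1 / 100.
    have -> : (z - e4) / (z - cpx x4 0) - 1 = - (e4 - cpx x4 0) / (z - cpx x4 0) by field.
    by apply: frac (le_trans dle' D4); rewrite cabsN (le_trans (ltW h4)).
  have E3 : cabs ((z - cpx x2 0) / (z - e2) - 1) <= 1 / 100.
    have -> : (z - cpx x2 0) / (z - e2) - 1 = (e2 - cpx x2 0) / (z - e2) by field.
    by apply: frac F2; rewrite (le_trans (ltW h2)).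
  apply: le_trans (near1M (near1M E1 E2) E3) _; lra.
pose rho z := k z / k q.
have rE z : A z -> cabs (rho z ^+ 2 - 1) <= 1 / 8.
  move=> Az; have kq0 := k0 q Aq.
  have -> : rho z ^+ 2 - 1 = ((k z ^+ 2 - 1) - (k q ^+ 2 - 1)) / k q ^+ 2 by rewrite /rho; field.
  have Kz := kE z Az; have Kq := kE q Aq.
  have low : 19 / 20 <= cabs (k q ^+ 2).
    by have := cabsB 1 (k q ^+ 2); rewrite cabs1 cabsC; lra.
  rewrite cabsM cabsV ler_pdivrMr; last by lra.
  by apply: le_trans (cabsD _ _) _; rewrite cabsN; lra.
have crho z : A z -> {for z, continuous rho}.
  move=> Az; have [_ _ z2 z4] := off z Az.
  have cm : {for z, continuous m} by apply: root_quotient_continuous => //; exact: ltW (AH _ Az).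
  have ck := cts_div (cts_div (cu z Az) (cv z Az) (v0 z Az)) cm (m0 z Az).
  exact: (ctsM ck (@cts_cst R _ (k q)^-1 z)).
have rq : rho q = 1 by rewrite /rho divff // k0.
have imag (w : C) : cre w = 0 -> 1 <= cabs (w ^+ 2 - 1).
  move=> E; apply: le_trans (cre_cabs _); rewrite expr2 !cE E mul0r sub0r -expr2 -opprD normrN.
  by rewrite ger0_norm ?addr_ge0 ?sqr_ge0 // lerDr sqr_ge0.
have pos : 0 < cre (rho p).
  apply: (@connected_sign R _ A (fun z => cre (rho z)) p q cA _ _ Ap Aq).
  - move=> z Az; apply: (@continuous_comp _ _ _ rho (@cre R)); first exact: crho.
    exact: cre_continuous.
  - by move=> z Az; apply/eqP => /imag; have := rE z Az; lra.
  - by rewrite rq cre1 ltr01.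
exists (rho p).
  have h : 1 <= cabs (rho p + 1).
    have := le_trans (ler_norm _) (cre_cabs (rho p + 1)); rewrite creD cre1; lra.
  have : cabs (rho p - 1) * cabs (rho p + 1) <= 1 / 8.
    by rewrite -cabsM -subr_sqr expr1n; exact: rE.
  by move=> hh; apply: le_trans hh; rewrite ler_peMr ?cabs_ge0.
have mq := m0 q Aq; have mp := m0 p Ap; have uq := u0 q Aq; have vq := v0 q Aq.
have vp := v0 p Ap.
rewrite /rho /k; move: mq mp uq vq vp.
move: (m q) (m p) (u q) (v q) (v p) (u p) => a1 a2 a3 a4 a5 a6 mq mp uq vq vp.
by field; rewrite ?mq ?mp ?uq ?vq ?vp.
Qed.

End Interlacing.

(** * Landing paths of an injective function do not interlace *)

Section LandingPaths.
Context {R : realType}.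
Local Notation C := (cplane R).
Local Notation H := (@half_plane R).
Variable f : C -> C.
Hypotheses (df : forall z, H z -> derivable f z 1)
  (inj : forall z w, H z -> H w -> f z = f w -> z = w).
Implicit Types (z w p q lam mu : C) (e d r x t T : R) (g h : R -> C).

(** The values of f converge along the path, whereas the path itself need only
    accumulate at x: this much follows from compactness, and comparing values of f
    at suitable times is enough. *)
Definition landing_path g lam x :=
  [/\ forall t, t < 1 -> {for t, continuous g}, forall t, t < 1 -> H (g t),
      forall e, 0 < e -> exists2 T, T < 1 & forall t, T < t < 1 -> cabs (f (g t) - lam) < e &
      forall e T, 0 < e -> T < 1 -> exists2 t, T < t < 1 & cabs (g t - cpx x 0) < e].

Lemma landing_path_late g lam x e : landing_path g lam x -> 0 < e ->
  exists2 t, 0 <= t < 1 & cabs (g t - cpx x 0) < e /\ cabs (f (g t) - lam) < e.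
Proof.
move=> [_ _ h3 h4] e0; have [T T1 hT] := h3 e e0.
have [t /andP[Tt t1] ht] := h4 e (Num.max 0 T) e0 ltac:(by rewrite gt_max ltr01).
move: Tt; rewrite gt_max => /andP[t0 Tt].
exists t; first by rewrite ltW.
by split=> //; apply: hT; rewrite Tt.
Qed.

Lemma box_exists (g : R -> C) T : (forall t, 0 <= t <= T -> {for t, continuous g}) ->
  (forall t, 0 <= t <= T -> H (g t)) ->
  exists b B, [/\ 0 < b, b <= B & forall t, 0 <= t <= T -> box b B (g t)].
Proof.
move=> cg Hg; have cK := @segment_compact R 0 T.
have inK t : `[0, T]%classic t -> 0 <= t <= T by rewrite /= in_itv.
have [b b0 hb] := compact_bounded_below cK
  (fun t Kt => @continuous_comp _ _ _ g (@cim R) t (cg t (inK t Kt)) (@cim_continuous R _))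
  (fun t Kt => Hg t (inK t Kt)).
have [m m0 hm] : exists2 m : R, 0 < m & forall t, `[0, T]%classic t -> m <= (1 + cabs (g t))^-1.
  apply: (compact_bounded_below cK) => t Kt; last by rewrite invr_gt0 ltr_wpDr ?cabs_ge0.
  have c1 : {for t, continuous (fun _ : R => 1 : R)} by exact: cst_continuous.
  have c2 : {for t, continuous (fun t => cabs (g t))}.
    exact: (@continuous_comp _ _ _ g (@cabs R) t (cg t (inK t Kt)) (@cabs_continuous R _)).
  have c3 : {for t, continuous (fun t => 1 + cabs (g t))} by exact: (cvgD c1 c2).
  apply: (cvgV _ c3); apply: lt0r_neq0; rewrite ltr_wpDr ?cabs_ge0 //.
exists b, (m^-1 + b); split=> //.
  by rewrite lerDr invr_ge0 ltW.
move=> t ht; have Kt : `[0, T]%classic t by rewrite /= in_itv.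
have hB : cabs (g t) <= m^-1.
  have := hm t Kt; rewrite -[leLHS]invrK lef_pV2 ?posrE ?invr_gt0 //; last first.
    by rewrite ltr_wpDr ?cabs_ge0.
  lra.
have := le_trans (cre_cabs _) hB; have := le_trans (cim_cabs _) hB.
rewrite !ler_norml => h1 h2; have := hb t Kt; split; lra.
Qed.

Lemma box_sub b B b' B' : b' <= b -> B <= B' -> box b B `<=` @box R b' B'.
Proof. by move=> h1 h2 z [/andP[c1 c2] /andP[c3 c4]]; split; apply/andP; split; lra. Qed.

Lemma path_stays_away g lam x mu : landing_path g lam x -> mu != lam ->
  (forall z, H z -> f z != mu) ->
  exists2 eta : R, 0 < eta & forall t, 0 <= t < 1 -> eta <= cabs (f (g t) - mu).
Proof.
move=> [cg Hg h3 _] ml fmu.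
pose k := cabs (mu - lam) / 2.
have k0 : 0 < k by rewrite divr_gt0 // cabs_gt0 subr_eq0.
have [T T1 hT] := h3 k k0.
have [m m0 hm] : exists2 m : R, 0 < m & forall t, `[0, T]%classic t -> m <= cabs (f (g t) - mu).
  apply: (compact_bounded_below (@segment_compact R 0 T)) => t; rewrite /= in_itv => /andP[t0 tT].
    have t1 : t < 1 by apply: le_lt_trans T1.
    have cfg : {for t, continuous (fun t => f (g t))}.
      by apply: (@continuous_comp _ _ _ g f); [exact: cg|exact: derivableC_continuous (df (Hg t t1))].
    apply: (@continuous_comp _ _ _ (fun t => f (g t)) (fun w => cabs (w - mu))); first exact: cfg.
    exact: cabs_sub_continuous.
  by rewrite cabs_gt0 subr_eq0; apply: fmu; apply: Hg; exact: le_lt_trans T1.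
exists (Num.min k m); first by rewrite lt_min k0.
move=> t /andP[t0 t1]; rewrite ge_min; have [tT|Tt] := leP t T.
  by apply/orP; right; apply: hm; rewrite /= in_itv /= t0.
apply/orP; left; have := hT t; rewrite Tt t1 => /(_ isT) hk.
have := cabs_triangle (f (g t)) mu lam; rewrite [cabs (mu - f _)]cabsC /k in hk *; lra.
Qed.

(** Two paths with the same limit value lam, joined by a segment, form a connected set
    on which f stays away from mu. The part of the set away from the real line is kept
    apart from the part on the paths, as they meet different lower bounds for the
    distance to real points. *)
Lemma bridge g g' lam x x' mu : landing_path g lam x -> landing_path g' lam x' -> mu != lam ->
  (forall z, H z -> f z != mu) ->
  exists2 eta : R, 0 < eta & forall t t', 0 <= t < 1 -> 0 <= t' < 1 ->
  exists A : set C, [/\ connected A, A `<=` H, A (g t) /\ A (g' t'),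
    exists b B, [/\ 0 < b, b <= B & A `<=` box b B] &
    forall z, A z -> eta <= cabs (f z - mu) /\
      (eta <= cim z \/ exists2 s, 0 <= s < 1 & z = g s \/ z = g' s)].
Proof.
move=> pg pg' ml fmu.
have [e1 e10 h1] := path_stays_away pg ml fmu.
have [e2 e20 h2] := path_stays_away pg' ml fmu.
have [cg Hg _ _] := pg; have [cg' Hg' _ _] := pg'.
have g0 := Hg 0 ltr01; have g'0 := Hg' 0 ltr01.
pose sg := segment (g 0) (g' 0).
pose y := Num.min (cim (g 0)) (cim (g' 0)).
have y0 : 0 < y by rewrite lt_min; apply/andP.
have sgy s : 0 <= s <= 1 -> y <= cim (sg s).
  move=> hs; rewrite segment_im; have b1 := ge_min y (cim (g 0)) (cim (g' 0)).
  have l1 : y <= cim (g 0) by rewrite ge_min lexx.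
  have l2 : y <= cim (g' 0) by rewrite ge_min lexx orbT.
  have := @between _ (cim (g 0)) (cim (g' 0)) s hs y (Num.max (cim (g 0)) (cim (g' 0))).
  by rewrite l1 l2 !le_max !lexx /= ?orbT => /(_ isT isT) /andP[].
clearbody y.
have sgH s : 0 <= s <= 1 -> H (sg s) by move=> /sgy; exact: lt_le_trans.
have csg s : {for s, continuous sg} by exact: segment_continuous.
have [m m0 hm] : exists2 m : R, 0 < m & forall t, `[0, 1]%classic t -> m <= cabs (f (sg t) - mu).
  apply: (compact_bounded_below (@segment_compact R 0 1)) => t; rewrite /= in_itv => ht.
    have cfg : {for t, continuous (fun t => f (sg t))}.
      by apply: (@continuous_comp _ _ _ sg f); [exact: csg|exact: derivableC_continuous (df (sgH t ht))].
    apply: (@continuous_comp _ _ _ (fun t => f (sg t)) (fun w => cabs (w - mu))); first exact: cfg.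
    exact: cabs_sub_continuous.
  by rewrite cabs_gt0 subr_eq0; apply: fmu; apply: sgH.
pose eta := Num.min (Num.min e1 e2) (Num.min m y).
exists eta; first by rewrite 3!lt_min e10 e20 m0 y0.
have [l1 l2 l3 l4] : [/\ eta <= e1, eta <= e2, eta <= m & eta <= y].
  by split; rewrite /eta !ge_min lexx /= ?orbT /= ?orbT.
move=> t t' /andP[t0 t1] /andP[t'0 t'1].
have ct T : T < 1 -> forall s, 0 <= s <= T -> {for s, continuous g}.
  by move=> T1 s /andP[_ sT]; apply: cg; exact: le_lt_trans T1.
have ct' T : T < 1 -> forall s, 0 <= s <= T -> {for s, continuous g'}.
  by move=> T1 s /andP[_ sT]; apply: cg'; exact: le_lt_trans T1.
have Ht T : T < 1 -> forall s, 0 <= s <= T -> H (g s).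
  by move=> T1 s /andP[_ sT]; apply: Hg; exact: le_lt_trans T1.
have Ht' T : T < 1 -> forall s, 0 <= s <= T -> H (g' s).
  by move=> T1 s /andP[_ sT]; apply: Hg'; exact: le_lt_trans T1.
have conn (k : R -> C) T : (forall s, 0 <= s <= T -> {for s, continuous k}) -> connected (k @` `[0, T]%classic).
  move=> ck; apply: connected_continuous_connected; first exact: segment_connected.
  by apply: continuous_in_subspaceT => s; rewrite inE /= in_itv; exact: ck.
exists ((g @` `[0, t]%classic `|` sg @` `[0, 1]%classic) `|` g' @` `[0, t']%classic); split.
- apply: connectedU; last exact: conn _ _ (ct' _ t'1).
    exists (g' 0); split; last by exists 0; rewrite //= in_itv /= lexx.
    by right; exists 1; rewrite /= ?in_itv /= ?lexx ?ler01 //; exact: segment1.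
  apply: connectedU; last by apply: conn => s _; exact: csg.
    exists (g 0); split; first by exists 0; rewrite //= in_itv /= lexx.
    by exists 0; rewrite /= ?in_itv /= ?lexx ?ler01 //; exact: segment0.
  exact: conn _ _ (ct _ t1).
- move=> z [[|]|] [s]; rewrite /= in_itv /= => hs <-.
  + exact: Ht t1 _ hs.
  + exact: sgH.
  + exact: Ht' t'1 _ hs.
- split; first by left; left; exists t; rewrite //= in_itv /= t0 lexx.
  by right; exists t'; rewrite //= in_itv /= t'0 lexx.
- have [b1 [B1 [b10 bB1 k1]]] := box_exists (ct _ t1) (Ht _ t1).
  have [b2 [B2 [b20 bB2 k2]]] := box_exists (ct' _ t'1) (Ht' _ t'1).
  have [b3 [B3 [b30 bB3 k3]]] := box_exists (fun s _ => csg s) sgH.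
  pose b := Num.min b1 (Num.min b2 b3); pose B := Num.max B1 (Num.max B2 B3).
  have [lb1 lb2 lb3] : [/\ b <= b1, b <= b2 & b <= b3] by split; rewrite /b !ge_min lexx /= ?orbT /= ?orbT.
  have [lB1 lB2 lB3] : [/\ B1 <= B, B2 <= B & B3 <= B] by split; rewrite /B !le_max lexx /= ?orbT /= ?orbT.
  exists b, B; split.
  + by rewrite !lt_min b10 b20.
  + by apply: le_trans lb1 _; apply: le_trans bB1 _.
  + move=> z [[|]|] [s]; rewrite /= in_itv /= => hs <-.
    * exact: box_sub lb1 lB1 _ (k1 s hs).
    * exact: box_sub lb3 lB3 _ (k3 s hs).
    * exact: box_sub lb2 lB2 _ (k2 s hs).
- move=> z [[|]|] [s]; rewrite /= in_itv /= => hs <-.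
  + have s1 : 0 <= s < 1 by lra.
    by split; [apply: le_trans l1 _; exact: h1|right; exists s => //; left].
  + split; first by apply: le_trans l3 _; apply: hm; rewrite /= in_itv.
    by left; apply: le_trans l4 _; exact: sgy.
  + have s1 : 0 <= s < 1 by lra.
    by split; [apply: le_trans l2 _; exact: h2|right; exists s => //; right].
Qed.

Lemma near_ratio (m : C -> C) z0 : {for z0, continuous m} -> m z0 != 0 ->
  exists2 d : R, 0 < d & forall z, cabs (z - z0) < d -> cabs (m z / m z0 - 1) <= 1 / 100.
Proof.
move=> cm m0; have a0 : 0 < cabs (m z0) by rewrite cabs_gt0.
have /continuousC/(_ (cabs (m z0) / 100) ltac:(by rewrite divr_gt0))[d d0 hd] := cm.
exists d => // z /hd hz; have -> : m z / m z0 - 1 = (m z - m z0) / m z0 by field.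
by rewrite cabsM cabsV ler_pdivrMr //; lra.
Qed.

Lemma cpx_sub x y : cpx x 0 - cpx y 0 = cpx (x - y) 0 :> C.
Proof. by apply: cpx_inj; rewrite !cE ?subr0. Qed.

(** Paths 1 and 3 give a curve from x1 to x3, and paths 2 and 4 one from x2 to x4. These
    cross an odd number of times in H, but their images are closed curves, through lam
    and lam', which cross an even number of times. A square root replaces this parity
    argument. The difference quotient of f has no
    zero, so it has a continuous root s on a large box. The cross ratio of the four
    values s (g1 or g3) (g2 or g4) near the ends of the paths can be computed by moving
    along the first and third paths, or along the second and fourth; each gives, up to a
    factor close to 1, an explicit number, and for x1 < x2 < x3 < x4 the two numbers
    have opposite signs. *)
Lemma no_interlacing g1 g2 g3 g4 lam lam' x1 x2 x3 x4 : lam != lam' ->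
  (forall z, H z -> f z != lam) -> (forall z, H z -> f z != lam') ->
  landing_path g1 lam x1 -> landing_path g2 lam' x2 ->
  landing_path g3 lam x3 -> landing_path g4 lam' x4 ->
  x1 < x2 -> x2 < x3 -> x3 < x4 ->
  (exists2 eta : R, 0 < eta & forall t, 0 <= t < 1 ->
    [/\ eta <= cabs (g1 t - cpx x2 0) /\ eta <= cabs (g1 t - cpx x4 0),
        eta <= cabs (g3 t - cpx x2 0) /\ eta <= cabs (g3 t - cpx x4 0),
        eta <= cabs (g2 t - cpx x1 0) /\ eta <= cabs (g2 t - cpx x3 0) &
        eta <= cabs (g4 t - cpx x1 0) /\ eta <= cabs (g4 t - cpx x3 0)]) ->
  False.
Proof.
move=> ll fl fl' p1 p2 p3 p4 x12 x23 x34 [eta eta0 sep].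
have ll' : lam' != lam by rewrite eq_sym.
have [ea ea0 br13] := bridge p1 p3 ll' fl'.
have [eb eb0 br24] := bridge p2 p4 ll fl.
pose m := root_quotient x2 x4; pose m' := root_quotient x1 x3.
have r0 (x y : R) : x != y -> cpx x 0 - cpx y 0 != 0 :> C.
  by move=> xy; rewrite cpx_sub -cabs_eq0 cpx_real normr_eq0 subr_eq0.
have [n12 n23 n34] : [/\ x1 != x2, x2 != x3 & x3 != x4] by rewrite !lt_eqF.
have [n14 n21] : x1 != x4 /\ x2 != x1.
  by rewrite [x2 == x1]eq_sym n12 lt_eqF //; lra.
have [n32 n43 n41] : [/\ x3 != x2, x4 != x3 & x4 != x1].
  by rewrite eq_sym n23 eq_sym n34 eq_sym n14.
have ci x : 0 <= cim (cpx x 0) by [].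
have [d1 d10 q1] := near_ratio (root_quotient_continuous (r0 _ _ n12) (r0 _ _ n14) (ci x1))
   (root_quotient_neq0 (r0 _ _ n12) (r0 _ _ n14) (ci x1)).
have [d3 d30 q3] := near_ratio (root_quotient_continuous (r0 _ _ n32) (r0 _ _ n34) (ci x3))
   (root_quotient_neq0 (r0 _ _ n32) (r0 _ _ n34) (ci x3)).
have [d2 d20 q2] := near_ratio (root_quotient_continuous (r0 _ _ n21) (r0 _ _ n23) (ci x2))
   (root_quotient_neq0 (r0 _ _ n21) (r0 _ _ n23) (ci x2)).
have [d4 d40 q4] := near_ratio (root_quotient_continuous (r0 _ _ n41) (r0 _ _ n43) (ci x4))
   (root_quotient_neq0 (r0 _ _ n41) (r0 _ _ n43) (ci x4)).
pose th := Num.min eta (Num.min ea eb).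
have th0 : 0 < th by rewrite !lt_min eta0 ea0.
have [t1 t2 t3] : [/\ th <= eta, th <= ea & th <= eb] by split; rewrite /th !ge_min lexx /= ?orbT /= ?orbT.
clearbody th.
have th1000 : 0 < th / 1000 by lra.
pose dl := Num.min (th / 1000) (Num.min (Num.min d1 d2) (Num.min d3 d4)).
have dl0 : 0 < dl by rewrite !lt_min d10 d20 d30 d40 th1000.
have dlth : dl <= th / 1000 by rewrite ge_min lexx.
have [k1 k2 k3 k4] : [/\ dl <= d1, dl <= d2, dl <= d3 & dl <= d4].
  by split; rewrite /dl !ge_min lexx /= ?orbT /= ?orbT.
clearbody dl.
have dle : 1000 * dl <= th by move: dlth; clear; lra.
have [s1 hs1 [c1 f1]] := landing_path_late p1 dl0.
have [s2 hs2 [c2 f2]] := landing_path_late p2 dl0.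
have [s3 hs3 [c3 f3]] := landing_path_late p3 dl0.
have [s4 hs4 [c4 f4]] := landing_path_late p4 dl0.
have [A [cA AH [A1 A3] [b [B [b0 bB Abox]]] Afar]] := br13 s1 s3 hs1 hs3.
have [A' [cA' AH' [A2 A4] [b' [B' [b'0 bB' Abox']]] Afar']] := br24 s2 s4 hs2 hs4.
pose bb := Num.min b b'; pose BB := Num.max B B'.
have lb : bb <= b /\ bb <= b' by split; rewrite /bb !ge_min lexx /= ?orbT /= ?orbT.
have lB : B <= BB /\ B' <= BB by split; rewrite /BB !le_max lexx /= ?orbT /= ?orbT.
have bb0 : 0 < bb by rewrite lt_min b0.
have boxA z : A z -> box bb BB z by move=> /Abox; exact: box_sub lb.1 lB.1 _.
have boxA' z : A' z -> box bb BB z by move=> /Abox'; exact: box_sub lb.2 lB.2 _.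
have bbB : bb <= BB by exact: le_trans lb.1 (le_trans bB lB.1).
have BB0 : 0 <= BB by exact: le_trans (ltW bb0) bbB.
have boxH z : box bb BB z -> H z by move=> [_ /andP[h _]]; exact: lt_le_trans h.
have oH := @open_half_plane R.
have [||z w bz bw|z w bz bw|s [sE cs1 cs2]] := @continuous_root R bb BB (quotient f).
- exact: bbB.
- exact: BB0.
- move=> W /nbhs_disk[e e0 eW].
  have [d d0 hd] := quotient_continuous oH df (boxH z bz) (boxH w bw) e0.
  exists (disk z d, disk w d) => /=; first by split; exact: disk_nbhs.
  by move=> [z' w'] [/= hz hw]; apply: eW; exact: hd.
- have [->|zw] := eqVneq z w.
    by rewrite /quotient eqxx; apply: (univalent_derivative_neq0 oH df inj); exact: boxH.
  rewrite quotientE // mulf_neq0 ?invr_eq0 ?subr_eq0 //.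
  by apply: contra_neq zw; apply: inj; exact: boxH.
have fim z (x : R) : th <= cim z -> th <= cabs (z - cpx x 0).
  move=> h; apply: le_trans h _; have := cim_cabs (z - cpx x 0).
  by rewrite !cE subr0; exact: le_trans (ler_norm _).
have far13 z : A z -> [/\ th <= cabs (z - cpx x2 0), th <= cabs (z - cpx x4 0) & th <= cabs (f z - lam')].
  move=> /Afar[a1 [a2|[u hu a2]]].
    by split; [exact: fim (le_trans t2 a2)|exact: fim (le_trans t2 a2)|exact: le_trans t2 a1].
  have [[u1 u2] [u3 u4] _ _] := sep u hu.
  case: a2 => zE; rewrite zE in a1 *.
    by split; [exact: le_trans t1 u1|exact: le_trans t1 u2|exact: le_trans t2 a1].
  by split; [exact: le_trans t1 u3|exact: le_trans t1 u4|exact: le_trans t2 a1].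
have far24 z : A' z -> [/\ th <= cabs (z - cpx x1 0), th <= cabs (z - cpx x3 0) & th <= cabs (f z - lam)].
  move=> /Afar'[a1 [a2|[u hu a2]]].
    by split; [exact: fim (le_trans t3 a2)|exact: fim (le_trans t3 a2)|exact: le_trans t3 a1].
  have [_ _ [u1 u2] [u3 u4]] := sep u hu.
  case: a2 => zE; rewrite zE in a1 *.
    by split; [exact: le_trans t1 u1|exact: le_trans t1 u2|exact: le_trans t3 a1].
  by split; [exact: le_trans t1 u3|exact: le_trans t1 u4|exact: le_trans t3 a1].
have [rho hrho E13] := @root_ratio R f df inj A (g1 s1) (g3 s3) (s ^~ (g2 s2)) (s ^~ (g4 s4))
  (g2 s2) (g4 s4) x2 x4 lam' th dl cA AH A1 A3 (AH' _ A2) (AH' _ A4)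
  (fun z _ => cs1 z (g2 s2)) (fun z _ => cs1 z (g4 s4))
  (fun z Az => sE z _ (boxA z Az) (boxA' _ A2)) (fun z Az => sE z _ (boxA z Az) (boxA' _ A4))
  (fun z Az => let: And3 h _ _ := far13 z Az in h) (fun z Az => let: And3 _ h _ := far13 z Az in h)
  (fun z Az => let: And3 _ _ h := far13 z Az in h) dl0 dle c2 c4 f2 f4.
have [rho' hrho' E24] := @root_ratio R f df inj A' (g2 s2) (g4 s4) (s (g1 s1)) (s (g3 s3))
  (g1 s1) (g3 s3) x1 x3 lam th dl cA' AH' A2 A4 (AH _ A1) (AH _ A3)
  (fun z _ => cs2 (g1 s1) z) (fun z _ => cs2 (g3 s3) z)
  (fun z Az => etrans (sE _ z (boxA _ A1) (boxA' z Az)) (quotient_sym f _ _))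
  (fun z Az => etrans (sE _ z (boxA _ A3) (boxA' z Az)) (quotient_sym f _ _))
  (fun z Az => let: And3 h _ _ := far24 z Az in h) (fun z Az => let: And3 _ h _ := far24 z Az in h)
  (fun z Az => let: And3 _ _ h := far24 z Az in h) dl0 dle c1 c3 f1 f3.
have Q1 := q1 _ (lt_le_trans c1 k1); have Q2 := q2 _ (lt_le_trans c2 k2).
have Q3 := q3 _ (lt_le_trans c3 k3); have Q4 := q4 _ (lt_le_trans c4 k4).
set M1 := root_quotient x2 x4 (cpx x1 0) in Q1; set M3 := root_quotient x2 x4 (cpx x3 0) in Q3.
set M2 := root_quotient x1 x3 (cpx x2 0) in Q2; set M4 := root_quotient x1 x3 (cpx x4 0) in Q4.
have M10 : M1 != 0 by apply: root_quotient_neq0 => //; exact: r0.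
have M30 : M3 != 0 by apply: root_quotient_neq0 => //; exact: r0.
have M20 : M2 != 0 by apply: root_quotient_neq0 => //; exact: r0.
have M40 : M4 != 0 by apply: root_quotient_neq0 => //; exact: r0.
(* the quarter turns cancel on the left, and multiply to -1 on the right *)
have sgn : M1 * M4 = - (M2 * M3).
  have hp (x y : R) : x < y -> half_plane_root (cpx x 0 - cpx y 0) =
     cpx 0 1 * half_plane_root (cpx y 0 - cpx x 0).
    move=> xy; rewrite !cpx_sub -half_plane_root_opp ?subr_gt0 //.
    by rewrite opprB.
  have hn (x y : R) : x != y -> half_plane_root (cpx x 0 - cpx y 0) != 0.
    by move=> xy; apply: half_plane_root_neq0; [rewrite !cE subrr|exact: r0].
  have ii : cpx 0 1 * cpx 0 1 = -1 :> C by apply: cpx_inj; rewrite !cE; ring.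
  have i0 : cpx 0 1 != 0 :> C by rewrite -cabs_eq0 cpx_imag normr1 oner_eq0.
  rewrite /M1 /M2 /M3 /M4 /root_quotient (hp x1 x4) ?(hp x1 x2) ?(hp x2 x3) ?(hp x3 x4) //; last first.
    by apply: lt_trans x34; exact: lt_trans x23.
  have h1 := hn _ _ n41; have h2 := hn _ _ n21; have h3 := hn _ _ n43; have h4 := hn _ _ n32.
  have -> : - (cpx 0 1 * half_plane_root (cpx x3 0 - cpx x2 0) / half_plane_root (cpx x2 0 - cpx x1 0) *
     (cpx 0 1 * half_plane_root (cpx x4 0 - cpx x3 0) / half_plane_root (cpx x3 0 - cpx x2 0))) =
     - (cpx 0 1 * cpx 0 1) * (half_plane_root (cpx x4 0 - cpx x3 0) / half_plane_root (cpx x2 0 - cpx x1 0)).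
    by field; rewrite h4 h2.
  rewrite ii; field; by rewrite ?h1 ?h2 ?h3 ?i0.
clear -E13 E24 hrho hrho' Q1 Q2 Q3 Q4 M10 M20 M30 M40 sgn.
move: (root_quotient x2 x4 (g1 s1)) (root_quotient x2 x4 (g3 s3))
  (root_quotient x1 x3 (g2 s2)) (root_quotient x1 x3 (g4 s4)) E13 E24 Q1 Q2 Q3 Q4.
move: M1 M2 M3 M4 M10 M20 M30 M40 sgn => M1 M2 M3 M4 M10 M20 M30 M40 sgn m1 m3 m2 m4.
move=> E13 E24 Q1 Q2 Q3 Q4.
have E : rho * (m1 / m3) = rho' * (m2 / m4).
  by rewrite -E13 -E24 !invfM !invrK; ring.
have nz (z : C) : cabs (z - 1) <= 1 / 100 -> z != 0.
  by move=> h; apply/eqP => z0; move: h; rewrite z0 sub0r cabsN cabs1; lra.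
have w3 := nz _ Q3; have w4 := nz _ Q4.
have m30 : m3 != 0 by apply: contraNneq w3 => ->; rewrite mul0r.
have m40 : m4 != 0 by apply: contraNneq w4 => ->; rewrite mul0r.
have K : rho * (m1 / M1) * (m4 / M4) * (M1 * M4) = rho' * (m2 / M2) * (m3 / M3) * (M2 * M3).
  transitivity (rho * (m1 / m3) * (m3 * m4)); first by field; rewrite m30 M10 M40.
  by rewrite E; field; rewrite m40 M20 M30.
have {K} : rho * (m1 / M1) * (m4 / M4) + rho' * (m2 / M2) * (m3 / M3) = 0.
  have M0 : M2 * M3 != 0 by rewrite mulf_neq0.
  by apply: (mulIf M0); rewrite mulrDl -K sgn; ring.
have := near1M (near1M hrho Q1) Q4; have := near1M (near1M hrho' Q2) Q3.
set a := rho * _ * _; set b := rho' * _ * _ => hb ha ab0.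
have pa : 0 < cre a by apply: near1_right; apply: le_lt_trans ha _; lra.
have pb : 0 < cre b by apply: near1_right; apply: le_lt_trans hb _; lra.
by have := congr1 (@cre R) ab0; rewrite creD cre0; lra.
Qed.

End LandingPaths.

(** * Spherical area *)

Section Packing.
Context {R : realType}.
Local Notation C := (cplane R).
Implicit Types (z w : C) (x y t e : R).

(** The square [-1, 1] ^ 2 has area 4. *)
Lemma rectangle_packing (I : finType) (a b c d : I -> R) :
  (forall i, a i <= b i /\ c i <= d i) ->
  (forall i, -1 <= a i /\ b i <= 1) -> (forall i, -1 <= c i /\ d i <= 1) ->
  (forall i j x y, a i < x < b i -> c i < y < d i ->
     a j < x < b j -> c j < y < d j -> i = j) ->
  \sum_i (b i - a i) * (d i - c i) <= 4.
Proof.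
move=> ord ab cd disj.
pose mu := @lebesgue_measure R.
pose F (k : 'I_#|I|) := `]a (enum_val k), b (enum_val k)[%classic `*` `]c (enum_val k), d (enum_val k)[%classic.
have mF k : measurable (F k) by apply: measurableX; exact: measurable_itv.
have tF : trivIset setT F.
  apply/trivIsetP => i j _ _ ij; apply/seteqP; split => // -[x y] [[/= i1 i2] [j1 j2]].
  move: i1 i2 j1 j2; rewrite !in_itv => i1 i2 j1 j2.
  have := disj _ _ x y i1 i2 j1 j2 => /enum_val_inj E.
  by move: ij; rewrite E eqxx.
have len (x y : R) : x <= y -> mu `]x, y[%classic = (y - x)%:E.
  move=> xy; rewrite /mu lebesgue_measure_itv /=; case: ltP => // h.
  have -> : y = x by apply/eqP; rewrite eq_le xy andbT; move: h; rewrite lee_fin.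
  by rewrite subrr.
have lenc : mu `[(-1 : R), 1]%classic = 2%:E.
  rewrite /mu lebesgue_measure_itv /= lte_fin ifT; last by lra.
  by rewrite -EFinB; congr (_%:E); lra.
have muF k : (mu \x mu)%E (F k) = ((b (enum_val k) - a (enum_val k)) * (d (enum_val k) - c (enum_val k)))%:E.
  rewrite product_measure1E; try exact: measurable_itv.
  by have [h1 h2] := ord (enum_val k); rewrite [X in (X * _)%E](len _ _ h1) [X in (_ * X)%E](len _ _ h2).
have : ((mu \x mu) (\big[setU/set0]_(k < #|I|) F k) <= 4%:E)%E.
  have -> : 4%:E = (mu \x mu)%E (`[(-1 : R), 1]%classic `*` `[(-1 : R), 1]%classic).
    rewrite product_measure1E; try exact: measurable_itv.
    by rewrite [X in (X * _)%E]lenc [X in (_ * X)%E]lenc -EFinM; congr (_%:E); lra.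
  apply: le_measure; rewrite ?inE.
  - by apply: bigsetU_measurable => k _; exact: mF.
  - by apply: measurableX; exact: measurable_itv.
  move=> [x y]; rewrite -bigcup_seq => -[k _] [/=]; rewrite !in_itv /=.
  have [h1 h2] := ab (enum_val k); have [h3 h4] := cd (enum_val k).
  by move=> /andP[k1 k2] /andP[k3 k4]; split; apply/andP; split; lra.
rewrite measure_bigsetU_ord //.
rewrite (eq_bigr _ (fun k _ => muF k)).
rewrite sumEFin lee_fin; apply: le_trans; rewrite le_eqVlt; apply/orP; left; apply/eqP.
by rewrite [LHS](reindex _ (onW_bij _ (@enum_val_bij I))).
Qed.

(** Applied to both coordinates, it maps disjoint squares to disjoint rectangles in
    [-1, 1] ^ 2 whose areas are at least a multiple of the spherical areas. *)
Definition squash x : R := x / (1 + `|x|).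

Lemma squash_bound x : -1 <= squash x /\ squash x <= 1.
Proof.
have h : 0 < 1 + `|x| by rewrite ltr_pwDl.
rewrite /squash ler_pdivlMr // ler_pdivrMr //; have := ler_norm x; have := ler_norm (- x).
by rewrite normrN; split; lra.
Qed.

Lemma squash_increment x y : x <= y ->
  (y - x) / ((1 + `|x|) * (1 + `|y|)) <= squash y - squash x.
Proof.
move=> xy.
have hx : 0 < 1 + `|x| by rewrite ltr_pwDl.
have hy : 0 < 1 + `|y| by rewrite ltr_pwDl.
have -> : squash y - squash x = (y * (1 + `|x|) - x * (1 + `|y|)) / ((1 + `|x|) * (1 + `|y|)).
  by rewrite /squash; field; rewrite !lt0r_neq0.
rewrite ler_pM2r ?invr_gt0 ?mulr_gt0 //.
case: (ler0P x) => x0; case: (ler0P y) => y0; try lra.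
by have := mulr_ge0_le0 (ltW y0) x0; lra.
Qed.

Lemma squash_lt x y : x < y -> squash x < squash y.
Proof.
move=> xy; rewrite -subr_gt0; apply: lt_le_trans (squash_increment (ltW xy)).
by rewrite divr_gt0 ?subr_gt0 // mulr_gt0 // ltr_pwDl.
Qed.

Lemma squash_le_mono : {mono squash : x y / x <= y}.
Proof. by apply: le_mono => x y; exact: squash_lt. Qed.

Definition open_square z t : set C := [set w | `|cre (w - z)| < t /\ `|cim (w - z)| < t].

Definition square_family (W : set C) (I : finType) (c : I -> C) (t : I -> R) :=
  [/\ forall i, 0 < t i <= 1, forall i, open_square (c i) (t i) `<=` W &
      forall i j w, open_square (c i) (t i) w -> open_square (c j) (t j) w -> i = j].

(** Comparable with the spherical area of the squares, as their sides are at most 2. *)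
Definition spherical_mass (I : finType) (c : I -> C) (t : I -> R) :=
  \sum_i (t i / (1 + cabs (c i)) ^+ 2) ^+ 2.

Lemma squash_square x t m : 0 < t <= 1 -> `|x| <= m ->
  t / (2 * (1 + m) ^+ 2) <= squash (x + t) - squash (x - t).
Proof.
move=> /andP[t0 t1] xm; have m0 : 0 <= m by exact: le_trans xm.
have h : x - t <= x + t by lra.
apply: le_trans (squash_increment h).
have b1 : `|x - t| <= m + 1 by apply: le_trans (ler_normB _ _) _; rewrite [`|t|]gtr0_norm //; lra.
have b2 : `|x + t| <= m + 1 by apply: le_trans (ler_normD _ _) _; rewrite [`|t|]gtr0_norm //; lra.
have p1 : 0 < 1 + `|x - t| by rewrite ltr_pwDl.
have p2 : 0 < 1 + `|x + t| by rewrite ltr_pwDl.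
have : (1 + `|x - t|) * (1 + `|x + t|) <= 2 * (1 + m) * (2 * (1 + m)) by apply: ler_pM; lra.
move=> hh; have m1 : 0 < 1 + m by lra.
have q1 : 0 < 2 * (1 + m) ^+ 2 by rewrite mulr_gt0 // exprn_gt0.
have q2 : 0 < (1 + `|x - t|) * (1 + `|x + t|) by rewrite mulr_gt0.
rewrite ler_pdivrMr // mulrAC ler_pdivlMr //.
have -> : (x + t - (x - t)) * (2 * (1 + m) ^+ 2) = t * (2 * (1 + m) * (2 * (1 + m))) by ring.
by rewrite ler_pM2l.
Qed.

Lemma spherical_packing W (I : finType) (c : I -> C) (t : I -> R) :
  square_family W c t -> spherical_mass c t <= 16.
Proof.
move=> [t01 _ disj].
pose a i := squash (cre (c i) - t i); pose b i := squash (cre (c i) + t i).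
pose a' i := squash (cim (c i) - t i); pose b' i := squash (cim (c i) + t i).
have : \sum_i (b i - a i) * (b' i - a' i) <= 4.
  apply: rectangle_packing.
  - by move=> i; have /andP[t0 _] := t01 i; rewrite !squash_le_mono; split; lra.
  - by move=> i; split; [have [] := squash_bound (cre (c i) - t i)|have [] := squash_bound (cre (c i) + t i)].
  - by move=> i; split; [have [] := squash_bound (cim (c i) - t i)|have [] := squash_bound (cim (c i) + t i)].
  move=> i j x y hx hy hx' hy'.
  (* the rectangles are images of the squares: pick a common preimage *)
  pose lo := Num.max (cre (c i) - t i) (cre (c j) - t j).
  pose hi := Num.min (cre (c i) + t i) (cre (c j) + t j).
  pose lo' := Num.max (cim (c i) - t i) (cim (c j) - t j).
  pose hi' := Num.min (cim (c i) + t i) (cim (c j) + t j).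
  have lt_of (u v s : R) : squash u < s -> s < squash v -> u < v.
    by move=> h1 h2; rewrite ltNge; apply/negP; rewrite -squash_le_mono; lra.
  have [/andP[x1 x2] /andP[x3 x4]] := (hx, hx').
  have [/andP[y1 y2] /andP[y3 y4]] := (hy, hy').
  have lh : lo < hi.
    by rewrite /lo /hi gt_max !lt_min (lt_of _ _ _ x1 x2) (lt_of _ _ _ x1 x4)
      (lt_of _ _ _ x3 x2) (lt_of _ _ _ x3 x4).
  have lh' : lo' < hi'.
    by rewrite /lo' /hi' gt_max !lt_min (lt_of _ _ _ y1 y2) (lt_of _ _ _ y1 y4)
      (lt_of _ _ _ y3 y2) (lt_of _ _ _ y3 y4).
  have m1 : lo < (lo + hi) / 2 < hi by lra.
  have m2 : lo' < (lo' + hi') / 2 < hi' by lra.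
  move: m1 m2; set p := (lo + hi) / 2; set q := (lo' + hi') / 2.
  rewrite {1}/lo {1}/hi {1}/lo' {1}/hi' !gt_max !lt_min.
  move=> /andP[/andP[u1 u2] /andP[u3 u4]] /andP[/andP[v1 v2] /andP[v3 v4]].
  clear -disj u1 u2 u3 u4 v1 v2 v3 v4.
  by apply: (disj i j (cpx p q)); rewrite /open_square /= !cE !ltr_norml; split; lra.
rewrite /spherical_mass => h4.
suff : \sum_i (t i / (1 + cabs (c i)) ^+ 2) ^+ 2 <= 4 * \sum_i (b i - a i) * (b' i - a' i) by lra.
rewrite mulr_sumr; apply: ler_sum => i _.
have h1 := squash_square (t01 i) (cre_cabs (c i)).
have h2 := squash_square (t01 i) (cim_cabs (c i)).
have m0 := cabs_ge0 (c i).
have k0 : 0 <= t i / (2 * (1 + cabs (c i)) ^+ 2).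
  by have /andP[t0 _] := t01 i; rewrite divr_ge0 ?ltW // mulr_gt0 // exprn_gt0; lra.
have := ler_pM k0 k0 h1 h2; rewrite -/(a i) -/(b i) -/(a' i) -/(b' i).
have -> : (t i / (1 + cabs (c i)) ^+ 2) ^+ 2 =
   4 * (t i / (2 * (1 + cabs (c i)) ^+ 2) * (t i / (2 * (1 + cabs (c i)) ^+ 2))).
  by field; rewrite lt0r_neq0 //; lra.
by rewrite ler_pM2l.
Qed.

(** Area is measured from inside by finite families of disjoint squares. The families
    of disjoint sets can be put together, and the length-area inequality produces
    such a family. *)
Definition small_area (W : set C) e := forall (I : finType) (c : I -> C) (t : I -> R),
  square_family W c t -> spherical_mass c t <= e.

Lemma small_area_sub W W' e : W `<=` W' -> small_area W' e -> small_area W e.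
Proof.
move=> WW h I c t [h1 h2 h3]; apply: h; split => //.
by move=> i; apply: subset_trans (h2 i) WW.
Qed.

(** Pigeonhole: putting together the families of many disjoint sets would exceed the
    area of the sphere. *)
Lemma small_area_exists (W : nat -> set C) e (K : nat) : 0 < e ->
  (forall k k' w, W k w -> W k' w -> k = k') ->
  exists2 k, (K <= k)%N & small_area (W k) e.
Proof.
move=> e0 disj; apply: contrapT => no.
have fam k : exists I : {I : finType & ((I -> C) * (I -> R))%type},
   square_family (W (K + k)%N) (projT2 I).1 (projT2 I).2 /\
   e < spherical_mass (projT2 I).1 (projT2 I).2.
  apply: contrapT => h; apply: no; exists (K + k)%N; first exact: leq_addr.
  move=> I c t fam; rewrite leNgt; apply/negP => big; apply: h.
  by exists (existT _ I (c, t)).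
have [F HF] := choice fam.
pose m := (Num.trunc (16 / e)).+1.
have mE : 16 < e * m%:R.
  by rewrite mulrC -ltr_pdivrMr // truncnS_gt.
pose J := {k : 'I_m & projT1 (F k)}.
pose c (p : J) := (projT2 (F (tag p))).1 (tagged p).
pose t (p : J) := (projT2 (F (tag p))).2 (tagged p).
have : spherical_mass c t <= 16.
  apply: (@spherical_packing setT); split.
  - by move=> [k i]; have [[h _ _] _] := HF k; exact: h.
  - by [].
  - move=> [k i] [l j] w /= h1 h2; have [[_ s1 d1] _] := HF k; have [[_ s2 _] _] := HF l.
    have kl : k = l.
      by apply/val_inj/eqP; rewrite -(eqn_add2l K); apply/eqP; apply: (disj _ _ w); [exact: s1 h1|exact: s2 h2].
    move: j h2 s2; rewrite -kl => j h2 _.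
    by rewrite (d1 i j w h1 h2).
apply/negP; rewrite -ltNge; apply: lt_le_trans mE _.
have -> : spherical_mass c t = \sum_(k < m) spherical_mass (projT2 (F k)).1 (projT2 (F k)).2.
  rewrite /spherical_mass.
  by rewrite (@sig_big_dep _ _ _ 'I_m (fun k : 'I_m => projT1 (F k)) xpredT (fun=> xpredT)
    (fun (k : 'I_m) (i : projT1 (F k)) => ((projT2 (F k)).2 i / (1 + cabs ((projT2 (F k)).1 i)) ^+ 2) ^+ 2)).
have -> : e * m%:R = \sum_(k < m) e by rewrite sumr_const card_ord mulr_natr.
by apply: ler_sum => k _; have [_ /ltW] := HF k.
Qed.

End Packing.

(** * The length-area inequality *)

Section Chord.
Context {R : realType}.
Local Notation C := (cplane R).
Implicit Types (z w a b s : C).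

Definition height z : R := (1 + cabs z ^+ 2)^-1.
Definition shadow z : C := z * cpx (height z) 0.
(** Comparable with the chordal distance: the shadow and the height of z are the
    horizontal and the vertical coordinate of its stereographic projection, up to
    normalization. *)
Definition chord z w : R := cabs (shadow z - shadow w) + `|height z - height w|.

Lemma height_den z : 0 < 1 + cabs z ^+ 2.
Proof. by rewrite ltr_wpDr ?exprn_ge0 ?cabs_ge0. Qed.

Lemma height_gt0 z : 0 < height z.
Proof. by rewrite invr_gt0 height_den. Qed.

Lemma chordC z w : chord z w = chord w z.
Proof. by rewrite /chord cabsC distrC. Qed.

Lemma chord_ge0 z w : 0 <= chord z w.
Proof. by rewrite addr_ge0 ?cabs_ge0. Qed.

Lemma chord_triangle w z z' : chord z z' <= chord z w + chord w z'.
Proof.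
rewrite /chord.
have h1 := cabs_triangle (shadow w) (shadow z) (shadow z').
have h2 := ler_distD (height w) (height z) (height z').
lra.
Qed.

Lemma height_bound a s : cabs (a - s) <= 1 -> height a <= 6 / (1 + cabs s) ^+ 2.
Proof.
move=> h; have := cabsB s a; rewrite cabsC => h1.
have a0 := cabs_ge0 a; have s0 := cabs_ge0 s.
have k : 0 < (1 + cabs s) ^+ 2 by rewrite exprn_gt0; lra.
rewrite /height ler_pdivlMr // mulrC ler_pdivrMr ?height_den //.
have : (1 + cabs s) ^+ 2 <= (2 + cabs a) ^+ 2 by rewrite ler_sqr ?nnegrE; lra.
have : 0 <= (cabs a - 1) ^+ 2 by exact: sqr_ge0.
rewrite !expr2; nra.
Qed.

Lemma height_diff a b : `|height a - height b| <=
  cabs (a - b) * (cabs a + cabs b) * height a * height b.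
Proof.
have pa := height_den a; have pb := height_den b.
have -> : height a - height b = (cabs b - cabs a) * (cabs a + cabs b) * height a * height b.
  by rewrite /height; field; rewrite !lt0r_neq0.
have a0 := cabs_ge0 a; have b0 := cabs_ge0 b.
rewrite !normrM (gtr0_norm (height_gt0 a)) (gtr0_norm (height_gt0 b)).
rewrite [`|cabs a + cabs b|]ger0_norm ?addr_ge0 //.
do 2 (apply: ler_wpM2r; first exact: ltW (height_gt0 _)).
apply: ler_wpM2r; first exact: addr_ge0.
rewrite ler_norml; have := cabsB a b; have := cabsB b a; rewrite [cabs (b - a)]cabsC.
lra.
Qed.

Lemma chord_lipschitz s a b : cabs (a - s) <= 1 -> cabs (b - s) <= 1 ->
  chord a b <= 24 * (cabs (a - b) / (1 + cabs s) ^+ 2).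
Proof.
move=> has hbs; have ha := height_bound has; have hb := height_bound hbs.
have p0 := height_gt0 a; have q0 := height_gt0 b.
have a0 := cabs_ge0 a; have b0 := cabs_ge0 b; have d0 := cabs_ge0 (a - b).
have hd := height_diff a b.
set p := height a in ha p0 hd *; set q := height b in hb q0 hd *.
set d := cabs (a - b) in d0 hd *; set x := cabs a in a0 hd *; set y := cabs b in b0 hd *.
have px : p * (1 + x ^+ 2) = 1 by rewrite /p /height mulVf // lt0r_neq0 // height_den.
have qy : q * (1 + y ^+ 2) = 1 by rewrite /q /height mulVf // lt0r_neq0 // height_den.
have pq0 : 0 < p * q by rewrite mulr_gt0.
have epq1 : p = p * q + p * q * y ^+ 2 by rewrite -{1}[p]mulr1 -qy; ring.
have epq2 : q = p * q + p * q * x ^+ 2 by rewrite -{1}[q]mulr1 -px; ring.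
(* both terms are controlled by (x^2 + y^2) p q <= p + q *)
have A1 : (x + y) * p * q <= (p + q) / 2.
  have := mulr_ge0 (ltW pq0) (sqr_ge0 (x - 1)); have := mulr_ge0 (ltW pq0) (sqr_ge0 (y - 1)).
  rewrite !expr2 in epq1 epq2 *; lra.
have A2 : y * ((x + y) * p * q) <= 3 / 2 * p + q / 2.
  have := mulr_ge0 (ltW pq0) (sqr_ge0 (x - y)).
  rewrite !expr2 in epq1 epq2 *; lra.
have hv : cabs (shadow a - shadow b) <= d * p + y * `|p - q|.
  have -> : shadow a - shadow b = (a - b) * cpx p 0 + b * cpx (p - q) 0.
    have -> : cpx (p - q) 0 = cpx p 0 - cpx q 0 by apply: cpx_inj; rewrite !cE; ring.
    by rewrite /shadow -/p -/q; ring.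
  apply: le_trans (cabsD _ _) _; rewrite !cabsM !cpx_real (gtr0_norm p0).
  by [].
have B1 : `|p - q| <= d * ((p + q) / 2).
  by apply: le_trans hd _; rewrite -!mulrA ler_wpM2l // !mulrA.
have B2 : y * `|p - q| <= d * (3 / 2 * p + q / 2).
  have := ler_wpM2l b0 hd; move/le_trans; apply.
  have -> : y * (d * (x + y) * p * q) = d * (y * ((x + y) * p * q)) by ring.
  by rewrite ler_wpM2l.
rewrite /chord -/p -/q.
have : d * (3 * p + q) <= d * (24 / (1 + cabs s) ^+ 2).
  by rewrite ler_wpM2l //; lra.
lra.
Qed.

End Chord.

Section LengthAreaConstant.
Context (R : realType).

(* opaque, as conversion would unfold the numeral to a sum of ones *)
Lemma length_area_constant_sig : {c : R | c = 5000}.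
Proof. by exists 5000. Qed.

Definition length_area_constant : R := sval length_area_constant_sig.

Lemma length_area_constantE : length_area_constant = 5000.
Proof. exact: svalP length_area_constant_sig. Qed.

Lemma length_area_constant_gt0 : 0 < length_area_constant.
Proof. by rewrite length_area_constantE ltr0n. Qed.

End LengthAreaConstant.

Section LengthArea.
Context {R : realType}.
Local Notation C := (cplane R).
Variables (f : C -> C) (G : set C).
Hypotheses (oG : open G) (df : forall z, G z -> derivable f z 1).
Hypothesis inj : forall z w, G z -> G w -> f z = f w -> z = w.
Implicit Types (z w s : C) (e d x y l : R).

Lemma uniform_distortion (K : set C) : compact K -> K `<=` G ->
  exists2 d : R, 0 < d & forall s z w, K s -> cabs (z - s) < d -> cabs (w - s) < d ->
    cabs (f z - f w - 'D_1 f s * (z - w)) <= cabs ('D_1 f s) / 2 * cabs (z - w) /\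
    cabs (f z - f s) <= 1.
Proof.
move=> cK KG; have /compact_near_coveringP cov := cK.
pose P (d : R) s := forall z w, cabs (z - s) < d -> cabs (w - s) < d ->
    cabs (f z - f w - 'D_1 f s * (z - w)) <= cabs ('D_1 f s) / 2 * cabs (z - w) /\
    cabs (f z - f s) <= 1.
have : \forall d \near (0 : R)^'+, K `<=` P d.
  apply: cov => s0 Ks0; have Gs0 := KG _ Ks0.
  have l0 := univalent_derivative_neq0 oG df inj Gs0.
  set l := 'D_1 f s0 in l0; have al0 : 0 < cabs l by rewrite cabs_gt0.
  have al8 : 0 < cabs l / 8 by rewrite divr_gt0.
  have [d1 d10 h1] := strict_derivative oG df Gs0 al8.
  have [d2 d20 h2] := quotient_near_diagonal oG df Gs0 al8.
  have /continuousC/(_ (1 / 2) ltac:(lra))[d3 d30 h3] := derivableC_continuous (df Gs0).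
  pose d := Num.min d1 (Num.min d2 d3) / 2.
  have d0 : 0 < d by rewrite divr_gt0 // !lt_min d10 d20.
  have d12 z : cabs (z - s0) < 2 * d -> [/\ cabs (z - s0) < d1, cabs (z - s0) < d2 & cabs (z - s0) < d3].
    have -> : 2 * d = Num.min d1 (Num.min d2 d3) by rewrite /d; field.
    by rewrite !lt_min => /and3P.
  exists (disk s0 d, [set r | r < d]) => /=.
    by split; [exact: disk_nbhs|exact: nbhs_right_lt].
  move=> [s r] [/= hs hr] z w hz hw; rewrite /disk /= in hs hr hz hw.
  have [s1 s2 s3] : [/\ cabs (s - s0) < d1, cabs (s - s0) < d2 & cabs (s - s0) < d3].
    by apply: d12; lra.
  have [z1 z2 z3] : [/\ cabs (z - s0) < d1, cabs (z - s0) < d2 & cabs (z - s0) < d3].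
    by apply: d12; have := cabs_triangle s z s0; lra.
  have [w1 w2 w3] : [/\ cabs (w - s0) < d1, cabs (w - s0) < d2 & cabs (w - s0) < d3].
    by apply: d12; have := cabs_triangle s w s0; lra.
  split; last first.
    have := cabs_triangle (f s0) (f z) (f s); rewrite [cabs (f s0 - _)]cabsC.
    by have := h3 z z3; have := h3 s s3; lra.
  have E := h1 z w z1 w1; rewrite -/l in E.
  have := h2 s s s2 s2; rewrite {1}/quotient eqxx -/l => E'.
  set ls := 'D_1 f s in E' *; clearbody l ls.
  have D := cabs_ge0 (z - w).
  have -> : f z - f w - ls * (z - w) = (f z - f w - l * (z - w)) - (ls - l) * (z - w) by ring.
  apply: le_trans (cabsD _ _) _; rewrite cabsN cabsM.
  have K1 : cabs (ls - l) * cabs (z - w) <= cabs l / 8 * cabs (z - w) by exact: ler_wpM2r D _ _ (ltW E').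
  have K2 : cabs l / 4 * cabs (z - w) <= cabs ls / 2 * cabs (z - w).
    apply: (ler_wpM2r D); have := cabsB l ls; rewrite [cabs (l - _)]cabsC.
    lra.
  by move: E K1 K2; clear; lra.
move=> H; near (0 : R)^'+ => d; exists d; first by near: d; exact: nbhs_right_gt.
move=> s z w Ks hz hw.
have Pd : K `<=` P d by near: d.
exact: (Pd s Ks z w hz hw).
Unshelve. all: by end_near. Qed.

(** Among N columns one has at most the average sum of squares; Cauchy's inequality then
    bounds its sum. *)
Lemma column_average (N : nat) (u : nat -> nat -> R) e : 0 < e ->
  \sum_(i < N.+1) \sum_(j < N.+1) u i j ^+ 2 <= e ->
  exists2 i, (i < N.+1)%N & \sum_(j < N.+1) u i j <= Num.sqrt e.
Proof.
move=> e0 hs; have N0 : 0 < N.+1%:R :> R by rewrite ltr0n.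
have [i iN hi] : exists2 i, (i < N.+1)%N & \sum_(j < N.+1) u i j ^+ 2 <= e / N.+1%:R.
  apply: contrapT => no.
  have : \sum_(i < N.+1) (e / N.+1%:R) < \sum_(i < N.+1) \sum_(j < N.+1) u i j ^+ 2.
    apply: ltr_sum; first by apply/hasP; exists ord0; rewrite ?mem_index_enum.
    move=> i _; rewrite ltNge; apply/negP => h; apply: no; exists (val i) => //.
    exact: ltn_ord.
  by rewrite sumr_const card_ord -[_ *+ _]mulr_natr divfK ?lt0r_neq0 // ltNge hs.
exists i => //; set S := Num.sqrt e.
have S0 : 0 < S by rewrite sqrtr_gt0.
have SS : S * S = e by rewrite -expr2 sqr_sqrtr // ltW.
pose a := S / N.+1%:R.
have a0 : 0 < a by rewrite divr_gt0.
have : \sum_(j < N.+1) u i j <= \sum_(j < N.+1) (u i j ^+ 2 / (2 * a) + a / 2).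
  apply: ler_sum => j _.
  have -> : u i j ^+ 2 / (2 * a) + a / 2 = (u i j ^+ 2 + a ^+ 2) / (2 * a) by field; rewrite lt0r_neq0.
  rewrite ler_pdivlMr ?mulr_gt0 //; have := sqr_ge0 (u i j - a); rewrite !expr2; lra.
move/le_trans; apply; rewrite big_split /= sumr_const card_ord -[(a / 2) *+ _]mulr_natr.
have -> : a / 2 * N.+1%:R = S / 2 by rewrite /a; field; rewrite addrC natr1 lt0r_neq0.
have : \sum_(j < N.+1) u i j ^+ 2 / (2 * a) <= S / 2.
  rewrite -mulr_suml ler_pdivrMr ?mulr_gt0 //; apply: le_trans hi _.
  rewrite -SS /a le_eqVlt; apply/orP; left; apply/eqP; field.
  by rewrite addrC natr1 lt0r_neq0.
lra.
Qed.

(** The rectangle is cut into N ^ 2 cells so small that f is nearly affine on each. The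
    images of the cells contain disjoint squares of side comparable with |f'| times the
    width of a cell. Their total mass is small, so in some column the sum of the sides,
    which is comparable with the length of the image of its middle line, is small. *)
Lemma short_vertical_segment x0 y0 l l' e : 0 < l -> l <= l' -> l' <= 4 * l -> 0 < e ->
  let K := [set z : C | x0 <= cre z <= x0 + l /\ y0 <= cim z <= y0 + l'] in
  K `<=` G -> small_area (f @` K) e ->
  exists2 x, x0 <= x <= x0 + l & forall y y', y0 <= y <= y0 + l' -> y0 <= y' <= y0 + l' ->
    chord (f (cpx x y)) (f (cpx x y')) <= length_area_constant R * Num.sqrt e.
Proof.
move=> l0 ll' l4 e0 K KG area.
have cK : compact K by exact: compact_rectangle.
have [d d0 hd] := uniform_distortion cK KG.
have [n hn] : exists n : nat, 5 * l / d < n.+1%:R.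
  by exists (Num.trunc (5 * l / d)); have := truncnS_gt (5 * l / d).
pose N : R := n.+1%:R; have N0 : 0 < N by rewrite ltr0n.
pose w := l / N; pose h := l' / N.
have w0 : 0 < w by rewrite divr_gt0.
have wN : w * N = l by rewrite /w divfK // lt0r_neq0.
have hN : h * N = l' by rewrite /h divfK // lt0r_neq0.
have wh : w <= h by rewrite /w /h ler_pM2r ?invr_gt0.
have h4 : h <= 4 * w by rewrite /w /h mulrA ler_pM2r ?invr_gt0.
have wd : 5 * w < d.
  by rewrite /w mulrA ltr_pdivrMr // [d * _]mulrC -ltr_pdivrMr.
have h0 : 0 < h by exact: lt_le_trans wh.
pose xs (i : nat) := x0 + (i%:R + 1 / 2) * w.
pose s (i j : nat) : C := cpx (xs i) (y0 + (j%:R + 1 / 2) * h).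
have natN (i : nat) : (i < n.+1)%N -> 0 <= i%:R :> R /\ i%:R + 1 <= N.
  by move=> hi; rewrite ler0n /N natr1 ler_nat.
have cell (i : nat) (k m L : R) : (i < n.+1)%N -> 0 < k -> k * N = L ->
   m <= m + i%:R * k /\ m + i%:R * k + k <= m + L.
  move=> hi k0 kL; have [i0 iN] := natN i hi; rewrite -kL.
  have := ler_wpM2r (ltW k0) iN; have := mulr_ge0 i0 (ltW k0); lra.
have inK i j z : (i < n.+1)%N -> (j < n.+1)%N -> x0 + i%:R * w <= cre z <= x0 + i%:R * w + w ->
    y0 + j%:R * h <= cim z <= y0 + j%:R * h + h -> K z.
  move=> hi hj hx hy; have [a1 a2] := cell i w x0 l hi w0 wN.
  have [b1 b2] := cell j h y0 l' hj h0 hN.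
  by split; move: a1 a2 b1 b2 hx hy; clear; lra.
have sK i j : (i < n.+1)%N -> (j < n.+1)%N -> K (s i j).
  by move=> hi hj; apply: (inK i j) => //; rewrite /s /xs ?cre_cpx ?cim_cpx; lra.
have near_cell i j z : (i < n.+1)%N -> (j < n.+1)%N -> cabs (z - s i j) <= w / 2 -> K z.
  move=> hi hj hz; have := le_trans (cre_cabs _) hz; have := le_trans (cim_cabs _) hz.
  rewrite /s /xs !cE !ler_norml => hy hx; by apply: (inK i j z hi hj); move: hx hy w0 wh; clear; lra.
have [D DE] : exists D : nat -> nat -> R, forall i j, D i j = cabs ('D_1 f (s i j)) by eexists.
have D0 i j : (i < n.+1)%N -> (j < n.+1)%N -> 0 < D i j.
  move=> hi hj; rewrite DE cabs_gt0; apply: (univalent_derivative_neq0 oG df inj).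
  by apply: KG; exact: sK.
have ss d' i j : 0 < d' -> cabs (s i j - s i j) < d' by rewrite subrr cabs0.
have low i j z : (i < n.+1)%N -> (j < n.+1)%N -> cabs (z - s i j) < d ->
    D i j / 2 * cabs (z - s i j) <= cabs (f z - f (s i j)).
  move=> hi hj hz; have [h1 _] := hd _ z (s i j) (sK i j hi hj) hz (ss _ _ _ d0).
  have := cabsB ('D_1 f (s i j) * (z - s i j)) (f z - f (s i j)).
  rewrite [cabs (_ * _ - _)]cabsC cabsM -DE in h1 *.
  by move: (cabs (_ - _ * _)) (cabs (z - s i j)) (cabs (f z - f _)) h1 => a1 a2 a3 *; lra.
pose t i j := D i j * w / 16.
pose u i j := t i j / (1 + cabs (f (s i j))) ^+ 2.
have fam : square_family (f @` K) (fun p : 'I_n.+1 * 'I_n.+1 => f (s p.1 p.2)) (fun p => t p.1 p.2).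
  have sq i j v : (i < n.+1)%N -> (j < n.+1)%N -> open_square (f (s i j)) (t i j) v ->
     exists2 z, cabs (z - s i j) < w / 2 & f z = v.
    move=> hi hj [v1 v2].
    apply: (image_contains_disk oG df inj (m := D i j * w / 4)).
    - by rewrite divr_gt0.
    - by move=> z hz; apply: KG; exact: near_cell hz.
    - move=> z hz; have zd : cabs (z - s i j) < d by rewrite hz; move: wd w0; clear; lra.
      by have := low i j z hi hj zd; rewrite hz; clear; lra.
    by apply: le_lt_trans (cabs_le_re_im _) _; rewrite /t in v1 v2; lra.
  split.
  - move=> [i j] /=; have hi := ltn_ord i; have hj := ltn_ord j.
    have k0 := D0 i j hi hj.
    have tt : 0 < D i j * w / 16 by apply: divr_gt0 => //; exact: mulr_gt0.
    rewrite /t tt /=.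
    pose z := s i j + cpx (w / 2) 0.
    have hz : cabs (z - s i j) = w / 2.
      by rewrite /z addrAC subrr add0r cpx_real gtr0_norm // divr_gt0.
    have zd : cabs (z - s i j) < d by rewrite hz; lra.
    have := low i j z hi hj zd; have [_] := hd _ z (s i j) (sK i j hi hj) zd (ss _ _ _ d0).
    by rewrite hz; lra.
  - move=> [i j] v /= /(sq i j v (ltn_ord i) (ltn_ord j))[z hz <-].
    by exists z => //; apply: (near_cell i j); rewrite ?ltn_ord // ltW.
  - move=> [i j] [i' j'] v /= /(sq i j v (ltn_ord i) (ltn_ord j))[z hz <-].
    move=> /(sq i' j' _ (ltn_ord i') (ltn_ord j'))[z' hz'] E.
    have zz : z' = z.
      by apply: inj E; apply: KG; [apply: (near_cell i' j')|apply: (near_cell i j)]; rewrite ?ltn_ord // ltW.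
    rewrite zz in hz'.
    have := le_lt_trans (cre_cabs _) hz; have := le_lt_trans (cim_cabs _) hz.
    have := le_lt_trans (cre_cabs _) hz'; have := le_lt_trans (cim_cabs _) hz'.
    rewrite /s /xs !cE !ltr_norml => a1 a2 a3 a4.
    have sep (a b : nat) (k : R) : 0 < k -> `|(a%:R - b%:R) * k| < k -> a = b.
      move=> k0; rewrite normrM (gtr0_norm k0) gtr_pMl //.
      case: (ltngtP a b) => // ab.
        rewrite distrC ger0_norm ?subr_ge0 ?ler_nat ?(ltnW ab) //.
        by rewrite ltrBlDr -[1 + _]addrC natr1 ltr_nat ltnS leqNgt ab.
      rewrite ger0_norm ?subr_ge0 ?ler_nat ?(ltnW ab) //.
      by rewrite ltrBlDr -[1 + _]addrC natr1 ltr_nat ltnS leqNgt ab.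
    congr (_, _); apply/val_inj.
      by apply: (sep _ _ w w0); rewrite ltr_norml; move: a2 a4; clear; lra.
    by apply: (sep _ _ h h0); rewrite ltr_norml; move: a1 a3 wh; clear; lra.
have mass := area _ _ _ fam.
have [|i hi hsum] := @column_average n u e e0.
  move: mass; rewrite /spherical_mass -(pair_bigA _ (fun i j : 'I_n.+1 => (t i j / (1 + cabs (f (s i j))) ^+ 2) ^+ 2)).
  exact.
have u0 j : (j < n.+1)%N -> 0 <= u i j.
  move=> hj; rewrite /u divr_ge0 ?exprn_ge0 ?addr_ge0 ?cabs_ge0 //.
  by apply: divr_ge0 => //; apply: mulr_ge0; apply: ltW => //; exact: D0.
have step j y y' : (j < n.+1)%N -> y0 + j%:R * h <= y <= y0 + j%:R * h + h ->
   y0 + j%:R * h <= y' <= y0 + j%:R * h + h ->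
   chord (f (cpx (xs i) y)) (f (cpx (xs i) y')) <= 2304 * u i j.
  move=> hj hy hy'.
  have nr y1 : y0 + j%:R * h <= y1 <= y0 + j%:R * h + h -> cabs (cpx (xs i) y1 - s i j) < d.
    move=> hy1; have -> : cpx (xs i) y1 - s i j = cpx 0 (y1 - (y0 + (j%:R + 1 / 2) * h)).
      by apply: cpx_inj; rewrite /s !cE; ring.
    rewrite cpx_imag; apply: (@le_lt_trans _ _ (h / 2)); last by move: h4 wd w0; clear; lra.
    by rewrite ler_norml; move: hy1; clear; lra.
  have [a1 a2] := hd _ (cpx (xs i) y) (cpx (xs i) y') (sK i j hi hj) (nr y hy) (nr y' hy').
  have [_ a3] := hd _ (cpx (xs i) y') (cpx (xs i) y') (sK i j hi hj) (nr y' hy') (nr y' hy').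
  apply: le_trans (chord_lipschitz a2 a3) _.
  have dy : cabs (cpx (xs i) y - cpx (xs i) y') <= h.
    have -> : cpx (xs i) y - cpx (xs i) y' = cpx 0 (y - y') by apply: cpx_inj; rewrite !cE; ring.
    by rewrite cpx_imag ler_norml; move: hy hy'; clear; lra.
  have k0 := D0 i j hi hj.
  have fz : cabs (f (cpx (xs i) y) - f (cpx (xs i) y')) <= 6 * (D i j * w).
    have := cabsB (f (cpx (xs i) y) - f (cpx (xs i) y')) ('D_1 f (s i j) * (cpx (xs i) y - cpx (xs i) y')).
    rewrite cabsM -DE in a1 *.
    have : D i j * cabs (cpx (xs i) y - cpx (xs i) y') <= D i j * (4 * w).
      by rewrite ler_pM2l //; move: dy h4; clear; lra.
    by move: a1; clear; lra.
  rewrite /u /t.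
  have p0 : 0 < (1 + cabs (f (s i j))) ^+ 2 by rewrite exprn_gt0 // ltr_pwDl ?cabs_ge0.
  move: p0 fz; move: ((1 + cabs (f (s i j))) ^+ 2) (D i j * w) (cabs (f _ - f _)) => Q M T Q0 TM.
  have -> : 2304 * (M / 16 / Q) = 24 * (6 * M / Q) by field; rewrite lt0r_neq0.
  by rewrite ler_pM2l // ler_pM2r ?invr_gt0.
clearbody u; clear hd low fam mass area sK near_cell inK DE D0 ss natN.
have [c c0 cE] : exists2 c : R, 0 < c & c = 2304 by exists 2304; [rewrite ltr0n|reflexivity].
rewrite -cE in step.
have chain j : (j <= n.+1)%N -> forall y, y0 <= y <= y0 + j%:R * h ->
   chord (f (cpx (xs i) y)) (f (cpx (xs i) y0)) <= c * \sum_(k < j) u i k.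
  elim: j => [|j IH] hj y.
    rewrite mul0r addr0 big_ord0 mulr0 => hy; have -> : y = y0 by lra.
    by rewrite /chord !subrr cabs0 normr0 addr0.
  rewrite -natr1 mulrDl mul1r addrA => hy; rewrite big_ord_recr /= mulrDr.
  have j0 : 0 <= j%:R * h by apply: mulr_ge0; [exact: ler0n|exact: ltW].
  have cu : 0 <= c * u i j by apply: mulr_ge0; [exact: ltW|exact: u0].
  have [yj|yj] := leP y (y0 + j%:R * h).
    have hyj : y0 <= y <= y0 + j%:R * h by case/andP: hy => -> _.
    by apply: le_trans (IH (ltnW hj) y hyj) _; rewrite lerDl.
  have hm : y0 <= y0 + j%:R * h <= y0 + j%:R * h by rewrite lexx lerDl j0.
  have hm' : y0 + j%:R * h <= y0 + j%:R * h <= y0 + j%:R * h + h by rewrite lexx lerDl ltW.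
  have hy' : y0 + j%:R * h <= y <= y0 + j%:R * h + h by rewrite ltW //; case/andP: hy.
  apply: le_trans (chord_triangle (f (cpx (xs i) (y0 + j%:R * h))) _ _) _.
  by rewrite addrC; exact: lerD (IH (ltnW hj) _ hm) (step j _ _ hj hy' hm').
have [xi1 xi2] := cell i w x0 l hi w0 wN.
exists (xs i); first by rewrite /xs; move: xi1 xi2 w0; clear; lra.
have fin y : y0 <= y <= y0 + l' -> chord (f (cpx (xs i) y)) (f (cpx (xs i) y0)) <= c * Num.sqrt e.
  move=> hy; have hy' : y0 <= y <= y0 + n.+1%:R * h by rewrite mulrC hN.
  by apply: le_trans (chain n.+1 (leqnn _) y hy') _; rewrite ler_pM2l.
move=> y y' hy hy'; apply: le_trans (chord_triangle (f (cpx (xs i) y0)) _ _) _.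
have := fin y hy; have := fin y' hy'; rewrite [chord (f (cpx (xs i) y')) _]chordC cE length_area_constantE.
have := sqrtr_ge0 e; clear; lra.
Qed.

End LengthArea.

(** * Crosscuts with small images *)

Lemma sequence_cluster (T : topologicalType) (K : set T) (u : nat -> T) : compact K ->
  (forall n, K (u n)) -> exists2 x, K x &
    forall U, nbhs x U -> forall k, exists2 n, (k <= n)%N & U (u n).
Proof.
move=> cK Ku; have uK : (u @ \oo) K by exists 0%N => // n _; exact: Ku.
have [x [Kx cx]] := cK (u @ \oo) (fmap_proper_filter u _) uK.
exists x => // U xU k.
have [|_ [[n /= kn <-] Un]] := cx (u @` [set n | (k <= n)%N]) U _ xU.
  by exists k => // n kn; exists n.
by exists n.
Qed.

Lemma reciprocals_small (R : realType) (e : R) : 0 < e ->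
  exists k : nat, forall n, (k <= n)%N -> n.+1%:R^-1 < e.
Proof.
move=> e0; exists (Num.trunc e^-1) => n kn.
rewrite -[ltRHS]invrK ltf_pV2 ?posrE ?invr_gt0 ?ltr0n //.
by apply: lt_le_trans (truncnS_gt _) _; rewrite ler_nat.
Qed.

Section SphereNeighbourhoods.
Context {R : realType}.
Local Notation C := (cplane R).
Implicit Types (z w q : C) (e r : R).

Lemma nbhs_Some q (W : set (sphere R)) :
  nbhs (Some q : sphere R) W <-> exists2 r, 0 < r & forall z, cabs (z - q) < r -> W (Some z).
Proof. by rewrite -(nbhs_disk q (fun z => W (Some z))). Qed.

Lemma nbhs_None (W : set (sphere R)) :
  nbhs (None : sphere R) W <-> W None /\ exists r, forall z, r < cabs z -> W (Some z).
Proof.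
split.
  move=> [K [cK clK] KW]; split; first by apply: KW; right.
  have [m m0 hm] : exists2 m : R, 0 < m & forall z, K z -> m <= (1 + cabs z)^-1.
    apply: (compact_bounded_below cK) => z Kz; last by rewrite invr_gt0 ltr_wpDr ?cabs_ge0.
    have c1 : {for z, continuous (fun _ : C => 1 : R)} by exact: cst_continuous.
    have c3 : {for z, continuous (fun z => 1 + cabs z)} by exact: (cvgD c1 (@cabs_continuous R z)).
    by apply: (cvgV _ c3); apply: lt0r_neq0; rewrite ltr_wpDr ?cabs_ge0.
  exists m^-1 => z hz; apply: KW; left; exists z => // Kz.
  have := hm z Kz; rewrite -[leLHS]invrK lef_pV2 ?posrE ?invr_gt0 ?ltr_wpDr ?cabs_ge0 //; lra.
move=> [W0 [r hr]]; exists [set z | cabs (z - 0) <= r].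
  by split; [exact: compact_cdisk|exact: closed_cdisk].
move=> x [[z /= hz <-]|->//]; apply: hr.
by rewrite ltNge; apply/negP => h; apply: hz; rewrite subr0.
Qed.

(** Uniform continuity of the identity from the chordal distance to the sphere. *)
Lemma chord_nbhs (p : sphere R) (W : set (sphere R)) : nbhs p W ->
  exists2 W' : set (sphere R), nbhs p W' & exists2 e : R, 0 < e &
    forall z w, W' (Some z) -> chord z w < e -> W (Some w).
Proof.
case: p => [q|].
  move=> /nbhs_Some[r r0 hr].
  exists (Some @` disk q (Num.min 1 (r / 2))).
    apply/nbhs_Some; exists (Num.min 1 (r / 2)); first by rewrite lt_min ltr01 divr_gt0.
    by move=> z hz; exists z.
  pose M := cabs q + 1; have q0 := cabs_ge0 q; have M0 : 0 < M by rewrite /M; lra.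
  pose k := (1 + M ^+ 2)^-1.
  have k0 : 0 < k by rewrite invr_gt0 ltr_wpDr ?exprn_ge0 // ltW.
  pose e := Num.min (k / 2) (r * k / (4 * (1 + M))).
  have e1 : 0 < k / 2 by lra.
  have e2 : 0 < r * k / (4 * (1 + M)) by apply: divr_gt0; apply: mulr_gt0 => //; lra.
  exists e; first by rewrite lt_min e1 e2.
  move=> z w [z' hz [zE]]; rewrite zE /disk /= lt_min in hz; have /andP[z1 z2] := hz; clear hz.
  rewrite lt_min => /andP[c1 c2]; apply: hr.
  have zM : cabs z <= M by have := cabsB z q; rewrite /M; lra.
  have hz : k <= height z.
    rewrite /k /height lef_pV2 ?posrE ?height_den // ?ltr_wpDr ?exprn_ge0 ?(ltW M0) //.
    by rewrite lerD2l lerXn2r ?nnegrE ?cabs_ge0 // ltW.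
  set c := chord z w in c1 c2.
  have h1 : `|height z - height w| <= c by rewrite lerDr cabs_ge0.
  have h2 : cabs (shadow z - shadow w) <= c by rewrite lerDl.
  have hw : k / 2 <= height w by move: h1; rewrite ler_norml; lra.
  have hw0 := height_gt0 w.
  have E : w - z = (z * cpx (height z - height w) 0 - (shadow z - shadow w)) / cpx (height w) 0.
    have -> : cpx (height z - height w) 0 = cpx (height z) 0 - cpx (height w) 0.
      by apply: cpx_inj; rewrite !cE; ring.
    rewrite /shadow; field.
    by rewrite -cabs_eq0 cpx_real normr_eq0 lt0r_neq0.
  have zw : cabs (w - z) < r / 2.
    rewrite E cabsM cabsV cpx_real (gtr0_norm hw0) ltr_pdivrMr //.
    apply: le_lt_trans (cabsD _ _) _; rewrite cabsN cabsM cpx_real.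
    have c0 : 0 <= c by exact: chord_ge0.
    have p1 : cabs z * `|height z - height w| <= M * c by apply: ler_pM; rewrite ?cabs_ge0.
    have p2 : r / 2 * (k / 2) <= r / 2 * height w by rewrite ler_pM2l ?divr_gt0.
    move: c2; rewrite ltr_pdivlMr ?mulr_gt0 //; last by lra.
    lra.
  by have := cabs_triangle z w q; lra.
move=> /nbhs_None[W0 [r hr]].
pose B := Num.max 0 r.
have B0 : 0 <= B by rewrite le_max lexx.
have kB : 0 < 1 + B ^+ 2 by rewrite ltr_wpDr ?exprn_ge0.
exists ([set x | if x is Some z then 1 + 2 * B ^+ 2 < cabs z ^+ 2 else True]).
  apply/nbhs_None; split => //; exists (1 + 2 * B ^+ 2) => z hz /=.
  have h1 : 1 <= 1 + 2 * B ^+ 2 by rewrite lerDl mulr_ge0 ?exprn_ge0.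
  have h2 : 1 <= cabs z := ltW (le_lt_trans h1 hz).
  by apply: lt_le_trans hz _; rewrite expr2 ler_peMl ?cabs_ge0.
exists (2 * (1 + B ^+ 2))^-1; first by rewrite invr_gt0 mulr_gt0.
move=> z w /= hz hc; apply: hr.
have h1 : height z < (2 * (1 + B ^+ 2))^-1.
  by rewrite /height ltf_pV2 ?posrE ?height_den ?mulr_gt0 //; lra.
have h2 : `|height z - height w| <= chord z w by rewrite lerDr cabs_ge0.
have h3 : height w < (1 + B ^+ 2)^-1.
  have -> : (1 + B ^+ 2)^-1 = 2 * (2 * (1 + B ^+ 2))^-1 by field; rewrite lt0r_neq0.
  by move: h2; rewrite ler_norml; lra.
have h4 : B ^+ 2 < cabs w ^+ 2.
  by move: h3; rewrite /height ltf_pV2 ?posrE ?height_den //; lra.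
have : B < cabs w.
  by rewrite ltNge; apply/negP => h; move: h4; rewrite ltNge lerXn2r ?nnegrE ?cabs_ge0.
by apply: le_lt_trans; rewrite le_max lexx orbT.
Qed.

End SphereNeighbourhoods.

Section Crosscut.
Context {R : realType}.
Local Notation C := (cplane R).
Local Notation H := (@half_plane R).
Variable f : C -> C.
Hypotheses (df : forall z, H z -> derivable f z 1)
  (inj : forall z w, H z -> H w -> f z = f w -> z = w).
Implicit Types (z w p q : C) (a e d r x y l L : R).

Lemma chord_continuous z w : forall e, 0 < e -> exists2 d : R, 0 < d &
  forall z' w', cabs (z' - z) < d -> cabs (w' - w) < d ->
    chord z' w' < chord z w + e /\ chord z w < chord z' w' + e.
Proof.
move=> e e0; exists (Num.min 1 (e / 96)); first by rewrite lt_min ltr01 divr_gt0.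
move=> z' w'; rewrite !lt_min => /andP[z1 z2] /andP[w1 w2].
have b v v' : cabs (v' - v) < 1 -> cabs (v' - v) < e / 96 -> chord v' v < e / 4.
  move=> h1 h2; have := @chord_lipschitz R v v' v (ltW h1); rewrite subrr cabs0 => /(_ ler01).
  move=> h; apply: le_lt_trans h _.
  have h0 : cabs (v' - v) / (1 + cabs v) ^+ 2 <= cabs (v' - v).
    rewrite ler_pdivrMr ?exprn_gt0 ?ltr_pwDl ?cabs_ge0 // ler_peMr ?cabs_ge0 //.
    by rewrite exprn_ege1 // lerDl cabs_ge0.
  lra.
have := b z z' z1 z2; have := b w w' w1 w2.
have := chord_triangle z z' w'; have := chord_triangle w z w'.
have := chord_triangle z' z w; have := chord_triangle w' z' w.
rewrite [chord w w']chordC [chord z z']chordC; have := chord_ge0 w' w; have := chord_ge0 z' z.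
by split; lra.
Qed.

(** Closed rectangles that exhaust the half-open one yield segments with uniformly small
    images; any cluster point of their abscissas gives a segment that reaches down to
    the real line. *)
Lemma vertical_crosscut a l L e : 0 < l -> 2 * l <= L -> L <= 4 * l -> 0 < e ->
  small_area (f @` [set z : C | a <= cre z <= a + l /\ 0 < cim z <= L]) e ->
  exists2 x, a <= x <= a + l & forall y y', 0 < y <= L -> 0 < y' <= L ->
    chord (f (cpx x y)) (f (cpx x y')) <= length_area_constant R * Num.sqrt e.
Proof.
move=> l0 lL L4 e0 area.
pose dl (n : nat) : R := l / n.+1%:R.
have dl0 n : 0 < dl n by rewrite divr_gt0 ?ltr0n.
have dll n : dl n <= l by rewrite ler_pdivrMr ?ltr0n // ler_peMr ?ler1n // ltW.
have ex n : exists x, a <= x <= a + l /\ forall y y', dl n <= y <= L -> dl n <= y' <= L ->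
    chord (f (cpx x y)) (f (cpx x y')) <= length_area_constant R * Num.sqrt e.
  have d0 := dl0 n; have d1 := dll n.
  have [||||x hx hxy] := @short_vertical_segment R f H (@open_half_plane R) df inj a (dl n) l (L - dl n) e l0 _ _ e0.
  - lra.
  - lra.
  - by move=> z [_ hz]; rewrite /half_plane /=; lra.
  - apply: small_area_sub area => _ [z [h1 h2] <-]; exists z => //; split => //; lra.
  exists x; split => // y y' hy hy'; apply: hxy; lra.
have [X HX] := choice ex.
have [|x hx clx] := @sequence_cluster _ _ X (@segment_compact R a (a + l)).
  by move=> n; rewrite /= in_itv; have [] := HX n.
move: hx; rewrite /= in_itv /= => hx; exists x => // y y' hy hy'.
apply/ler_addgt0Pl => e' e'0.
have cf s : 0 < s -> {for cpx x s, continuous f} by move=> s0; exact: derivableC_continuous (df _).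
have [y0 y'0] : 0 < y /\ 0 < y' by case/andP: hy; case/andP: hy'.
have [d1 d10 h1] := chord_continuous (f (cpx x y)) (f (cpx x y')) e'0.
have /continuousC/(_ d1 d10)[d2 d20 h2] := cf y y0.
have /continuousC/(_ d1 d10)[d3 d30 h3] := cf y' y'0.
pose m := Num.min y y'; have m0 : 0 < m by rewrite lt_min y0.
have near_x : nbhs x [set s | `|x - s| < Num.min d2 d3].
  by apply/nbhs_ballP; exists (Num.min d2 d3) => //=; rewrite lt_min d20.
have [k kE] : exists k : nat, l / m < k.+1%:R.
  by exists (Num.trunc (l / m)); have := truncnS_gt (l / m).
have [n kn hn] := clx _ near_x k; rewrite /= lt_min distrC in hn.
have /andP[n2 n3] := hn.
have E t : cpx (X n) t - cpx x t = cpx (X n - x) 0 by apply: cpx_inj; rewrite !cE ?subrr.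
have dm : dl n <= m.
  have : k.+1%:R <= n.+1%:R :> R by rewrite ler_nat.
  move=> kn'; rewrite /dl ler_pdivrMr ?ltr0n //.
  move: kE; rewrite ltr_pdivrMr // => kE.
  have : m * k.+1%:R <= m * n.+1%:R by rewrite ler_pM2l.
  by move: kE; rewrite [_ * m]mulrC; lra.
have [my my'] : m <= y /\ m <= y' by rewrite /m !ge_min !lexx orbT.
have [_ hX] := HX n.
have hXX : chord (f (cpx (X n) y)) (f (cpx (X n) y')) <= length_area_constant R * Num.sqrt e.
  by apply: hX; [case/andP: hy => _ ->|case/andP: hy' => _ ->]; rewrite andbT; apply: le_trans dm _.
have c2 := h2 (cpx (X n) y); rewrite E cpx_real in c2.
have c3 := h3 (cpx (X n) y'); rewrite E cpx_real in c3.
have [_ hlt] := h1 _ _ (c2 n2) (c3 n3).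
move: hlt hXX; move: (_ * Num.sqrt e) (chord _ _) (chord _ _) => c u v; clear; lra.
Qed.

Lemma horizontal_crosscut a l L e : 0 < a -> 0 < l -> l <= 2 * L -> 2 * L <= 4 * l -> 0 < e ->
  small_area (f @` [set z : C | - L <= cre z <= L /\ a <= cim z <= a + l]) e ->
  exists2 y, a <= y <= a + l & forall x x', - L <= x <= L -> - L <= x' <= L ->
    chord (f (cpx x y)) (f (cpx x' y)) <= length_area_constant R * Num.sqrt e.
Proof.
move=> a0 l0 lL L4 e0 area.
(* a quarter turn of the source reduces this to vertical segments *)
pose turn : C := cpx 0 (- 1); pose g z := f (turn * z).
pose G : set C := [set z | cre z < 0].
have GH z : G z -> H (turn * z).
  by rewrite /G /half_plane /= /turn !cE; lra.
have oG : open G.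
  have -> : G = (@cre R) @^-1` [set x | x < 0] by [].
  by apply: open_comp; [move=> z _; exact: cre_continuous|exact: open_lt].
have turn0 : turn != 0 by rewrite -cabs_eq0 cpx_imag normrN normr1 oner_eq0.
have dg z : G z -> derivable g z 1.
  move=> Gz; have h := derivable_has_deriv (df (GH z Gz)).
  apply: (@has_deriv_derivable _ _ _ ('D_1 f (turn * z) * turn)) => r r0.
  have [d d0 hd] := h r r0; exists d => // w hw.
  have E : turn * w - turn * z = turn * (w - z) by ring.
  have T1 : cabs (turn * w - turn * z) = cabs (w - z).
    by rewrite E cabsM cpx_imag normrN normr1 mul1r.
  by have := hd (turn * w); rewrite T1 => /(_ hw); rewrite E mulrA.
have ig z w : G z -> G w -> g z = g w -> z = w.
  by move=> Gz Gw /(inj (GH _ Gz) (GH _ Gw)) /(mulfI turn0).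
have [||||x hx hxy] := @short_vertical_segment R g G oG dg ig (- a - l) (- L) l (2 * L) e l0 _ _ e0.
- lra.
- lra.
- by move=> z [h _]; rewrite /G /=; lra.
- apply: small_area_sub area => _ [z [h1 h2] <-]; exists (turn * z) => //.
  by rewrite /= /turn !cE; split; lra.
exists (- x); first by lra.
have E t : cpx t (- x) = turn * cpx x t by apply: cpx_inj; rewrite /turn !cE; ring.
by move=> y y' hy hy'; rewrite !E; apply: hxy; lra.
Qed.

(** A path from - r1 up, across at height r2, and down to r3, in the open half-plane. *)
Definition crosscut r1 r2 r3 : set C := [set z | [/\ 0 < cim z <= r2, - r1 <= cre z <= r3 &
  [\/ cre z = - r1, cre z = r3 | cim z = r2]]].

(** The sets S k are half-square shells of geometrically decreasing size, hence disjoint;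
    one of them has an image of small area, and contains two vertical segments and a
    horizontal one with short images. *)
Lemma small_crosscut e d : 0 < e -> 0 < d -> exists r1 r2 r3,
  [/\ 0 < r1 < d, 0 < r2 < d, 0 < r3 < d &
    forall z z', crosscut r1 r2 r3 z -> crosscut r1 r2 r3 z' -> chord (f z) (f z') <= e].
Proof.
move=> e0 d0.
pose rho (k : nat) : R := d / 2 * 4^-1 ^+ k.
have rho0 k : 0 < rho k by rewrite mulr_gt0 ?divr_gt0 ?exprn_gt0 ?invr_gt0.
have rhod k : rho k < d.
  apply: (@le_lt_trans _ _ (d / 2)); last by lra.
  by rewrite ler_piMr ?divr_ge0 ?(ltW d0) // exprn_ile1 ?invr_ge0 ?invf_le1 ?ler1n.
have rhoS k j : rho (k + j).+1 <= rho k / 4.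
  have -> : rho (k + j).+1 = rho k / 4 * 4^-1 ^+ j.
    by rewrite /rho exprS exprD; ring.
  by rewrite ler_piMr ?exprn_ile1 ?invr_ge0 ?invf_le1 ?ler1n ?divr_ge0 ?ltW.
pose S k : set C := [set z | [/\ 0 < cim z <= rho k, - rho k <= cre z <= rho k &
   rho k / 2 <= `|cre z| \/ rho k / 2 <= cim z]].
have SH k z : S k z -> H z by move=> [/andP[]].
have disj k k' w : (f @` S k) w -> (f @` S k') w -> k = k'.
  move=> [z Sz <-] [z' Sz'] /(inj (SH _ _ Sz') (SH _ _ Sz)) E; rewrite {z'}E in Sz'.
  have far i j : S i z -> S j z -> (i < j)%N -> False.
    move=> [i1 i2 i3] [j1 j2 j3] ij.
    have rj : rho j <= rho i / 4 by have := rhoS i (j - i.+1)%N; rewrite -addSn subnKC.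
    have zi : `|cre z| <= rho j by rewrite ler_norml.
    by have := rho0 i; case: i3 => h; lra.
  by case: (ltngtP k k') => // h; exfalso; [exact: (far k k')|exact: (far k' k)].
have c0 := length_area_constant_gt0 R; set c := length_area_constant R in c0.
have ec0 : 0 < e / (3 * c) by apply: divr_gt0 => //; apply: mulr_gt0.
pose e1 := (e / (3 * c)) ^+ 2.
have e10 : 0 < e1 by rewrite exprn_gt0.
have e1E : c * Num.sqrt e1 = e / 3.
  by rewrite sqrtr_sqr gtr0_norm //; field; rewrite lt0r_neq0.
have [k _ area] := small_area_exists 0 e10 disj.
set r := rho k in SH disj; have r0 : 0 < r := rho0 k; have rd : r < d := rhod k.
have sub (A : set C) : A `<=` S k -> small_area (f @` A) e1.
  by move=> AS; apply: small_area_sub area; exact: image_subset.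
have [|||||x1 hx1 h1] := @vertical_crosscut (- r) (r / 2) r e1; [lra|lra|lra|exact: e10| |].
  apply: sub => z [hx hy]; split; rewrite -/r; [lra|lra|].
  by left; rewrite ler0_norm; lra.
have [|||||x3 hx3 h3] := @vertical_crosscut (r / 2) (r / 2) r e1; [lra|lra|lra|exact: e10| |].
  apply: sub => z [hx hy]; split; rewrite -/r; [lra|lra|].
  by left; rewrite ger0_norm; lra.
have [||||||y hy h2] := @horizontal_crosscut (r / 2) (r / 2) r e1; [lra|lra|lra|lra|exact: e10| |].
  by apply: sub => z [hx hz]; split; rewrite -/r; [lra|lra|right; lra].
exists (- x1), y, x3; split; [lra|lra|lra|].
rewrite -/c e1E in h1 h2 h3.
(* compare every point with the two upper corners *)
have top z : crosscut (- x1) y x3 z -> chord (f z) (f (cpx x1 y)) <= e / 3 \/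
    chord (f z) (f (cpx x3 y)) <= e / 3.
  move=> [hi hr]; rewrite opprK => -[E|E|E]; rewrite (cpxE z) E.
  - by left; apply: h1; lra.
  - by right; apply: h3; lra.
  - by left; apply: h2; lra.
have c13 : chord (f (cpx x1 y)) (f (cpx x3 y)) <= e / 3 by apply: h2; lra.
move=> z z' /top hz /top hz'.
have := chord_triangle (f (cpx x1 y)) (f z) (f z'); have := chord_triangle (f (cpx x3 y)) (f z) (f z').
have := chord_triangle (f (cpx x3 y)) (f (cpx x1 y)) (f z'); have := chord_triangle (f (cpx x1 y)) (f (cpx x3 y)) (f z').
rewrite [chord (f (cpx x1 y)) (f z')]chordC [chord (f (cpx x3 y)) (f z')]chordC
  [chord (f (cpx x3 y)) (f (cpx x1 y))]chordC.
move: (chord _ _) (chord _ _) (chord _ _) (chord _ _) (chord _ _) (chord _ _) c13 hz hz'.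
move=> u1 u2 u3 u4 u5 u6 c13 hz hz'.
clear -c13 hz hz'.
by case: hz => ?; case: hz' => ?; lra.
Qed.

(** The sphere is compact, so images of smaller and smaller diameter accumulate at a
    point. *)
Lemma crosscut_limit : exists p : sphere R, forall W, nbhs p W -> forall d, 0 < d ->
  exists r1 r2 r3, [/\ 0 < r1 < d, 0 < r2 < d, 0 < r3 < d &
    forall z, crosscut r1 r2 r3 z -> W (Some (f z))].
Proof.
pose D (n : nat) : R := n.+1%:R^-1.
have D0 n : 0 < D n by rewrite invr_gt0.
have ex n : exists r : R * R * R, [/\ 0 < r.1.1 < D n, 0 < r.1.2 < D n, 0 < r.2 < D n &
    forall z z', crosscut r.1.1 r.1.2 r.2 z -> crosscut r.1.1 r.1.2 r.2 z' -> chord (f z) (f z') <= D n].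
  by have [r1 [r2 [r3 h]]] := small_crosscut (D0 n) (D0 n); exists (r1, r2, r3).
have [r Hr] := choice ex.
pose b n : C := cpx (- (r n).1.1) (r n).1.2.
have [|p _ hp] := @sequence_cluster _ _ (fun n => Some (f (b n)) : sphere R)
   (@one_point_compactification_compact C); first by [].
exists p => W pW d d0.
have [W' pW' [e e0 hW]] := chord_nbhs pW.
pose m := Num.min d e; have m0 : 0 < m by rewrite lt_min d0.
have [k small] := reciprocals_small m0.
have [n kn Wn] := hp _ pW' k; have Dm : D n < m := small n kn.
have [Dd De] : D n < d /\ D n < e by move: Dm; rewrite lt_min => /andP[].
have [h1 h2 h3 h4] := Hr n.
exists (r n).1.1, (r n).1.2, (r n).2; split; [lra|lra|lra|].
move=> z hz; apply: (hW (f (b n))) => //; apply: le_lt_trans De; apply: h4 => //.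
by split; rewrite /b ?cre_cpx ?cim_cpx; [lra|lra|exact: Or31].
Qed.

End Crosscut.

(** * Half-rectangles and their images *)

Section Rectangles.
Context {R : realType}.
Local Notation C := (cplane R).
Local Notation H := (@half_plane R).
Implicit Types (z w p q : C) (e d r t x y : R).

(** Less than 1 inside the half-rectangle and greater than 1 outside it, so that a path
    leaving it takes the value 1 on the crosscut. *)
Definition gauge r1 r2 r3 z : R := Num.max (cim z / r2) (Num.max (cre z / r3) (- (cre z / r1))).

Lemma gauge_continuous r1 r2 r3 : continuous (gauge r1 r2 r3).
Proof.
move=> z; have ci : {for z, continuous (fun z : C => cim z / r2)}.
  have c1 : {for z, continuous (fun _ : C => r2^-1)} by exact: cst_continuous.
  exact: (cvgM (@cim_continuous R z) c1).
have cr r : {for z, continuous (fun z : C => cre z / r)}.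
  have c1 : {for z, continuous (fun _ : C => r^-1)} by exact: cst_continuous.
  exact: (cvgM (@cre_continuous R z) c1).
have cn : {for z, continuous (fun z : C => - (cre z / r1))} by exact: (cvgN (cr r1)).
apply: (@continuous_max _ _ (fun z => cim z / r2 : R^o) (fun z => Num.max (cre z / r3) (- (cre z / r1)) : R^o)).
  exact: ci.
by apply: (@continuous_max _ _ (fun z => cre z / r3 : R^o) (fun z => (- (cre z / r1)) : R^o)); [exact: cr|exact: cn].
Qed.

Definition half_rectangle r1 r2 r3 : set C :=
  [set z | [/\ 0 < cim z, cim z < r2 & - r1 < cre z < r3]].

Lemma gauge_lt1 r1 r2 r3 z : 0 < r1 -> 0 < r2 -> 0 < r3 -> H z ->
  half_rectangle r1 r2 r3 z <-> gauge r1 r2 r3 z < 1.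
Proof.
move=> h1 h2 h3 Hz; rewrite /gauge !gt_max ltrNl !ltr_pdivrMr // ltr_pdivlMr // !mul1r mulN1r.
split; first by move=> [_ -> /andP[-> ->]].
by move=> /and3P[a b c]; split => //; apply/andP.
Qed.

Lemma gauge_eq1 r1 r2 r3 z : 0 < r1 -> 0 < r2 -> 0 < r3 -> H z ->
  gauge r1 r2 r3 z = 1 -> crosscut r1 r2 r3 z.
Proof.
move=> h1 h2 h3 Hz g1.
have : gauge r1 r2 r3 z <= 1 by rewrite g1.
rewrite /gauge !ge_max lerNl !ler_pdivrMr // ler_pdivlMr // !mul1r mulN1r => /and3P[a b c].
split; [by apply/andP; split|by apply/andP; split|].
have no : ~ half_rectangle r1 r2 r3 z by move=> /(gauge_lt1 h1 h2 h3 Hz); rewrite g1 ltxx.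
apply: contrapT => n; apply: no; split => //.
  by rewrite lt_neqAle a andbT; apply/eqP => E; apply: n; exact: Or33.
rewrite !lt_neqAle b c !andbT; apply/andP; split; apply/eqP => E; apply: n.
  by apply: Or31; rewrite E.
exact: Or32.
Qed.

Lemma open_half_rectangle r1 r2 r3 : open (half_rectangle r1 r2 r3).
Proof.
apply: disk_open => z [z1 z2 /andP[z3 z4]].
pose d := Num.min (Num.min (cim z) (r2 - cim z)) (Num.min (cre z + r1) (r3 - cre z)).
have d0 : 0 < d by rewrite !lt_min z1 !subr_gt0 z2 z4 -(opprK r1) subr_gt0 z3.
have [d1 d2 d3 d4] : [/\ d <= cim z, d <= r2 - cim z, d <= cre z + r1 & d <= r3 - cre z].
  by split; rewrite /d !ge_min lexx /= ?orbT /= ?orbT.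
exists d => // w hw; have := le_lt_trans (cre_cabs _) hw; have := le_lt_trans (cim_cabs _) hw.
by rewrite !cE !ltr_norml => h1 h2; split; lra.
Qed.

Lemma half_rectangle_near r1 r2 r3 z : 0 < r1 -> 0 < r2 -> 0 < r3 -> H z ->
  cabs z < Num.min r1 (Num.min r2 r3) -> half_rectangle r1 r2 r3 z.
Proof.
move=> h1 h2 h3 Hz; rewrite !lt_min => /and3P[a1 a2 a3].
have := cre_cabs z; have := cim_cabs z; rewrite !ler_norml => b1 b2.
by split; [exact: Hz|lra|lra].
Qed.

Lemma half_rectangle_segment r1 r2 r3 z w t : 0 <= t <= 1 -> half_rectangle r1 r2 r3 z ->
  half_rectangle r1 r2 r3 w -> half_rectangle r1 r2 r3 (segment z w t).
Proof.
move=> ht [z1 z2 z3] [w1 w2 w3].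
have mm (u v : R) : Num.min u v <= u <= Num.max u v /\ Num.min u v <= v <= Num.max u v.
  by rewrite !ge_min !le_max !lexx !orbT.
have [a1 a2] := mm (cim z) (cim w); have [b1 b2] := mm (cre z) (cre w).
have /andP[i1 i2] := between ht a1 a2; have /andP[j1 j2] := between ht b1 b2.
have p1 : 0 < Num.min (cim z) (cim w) by rewrite lt_min z1.
have p2 : Num.max (cim z) (cim w) < r2 by rewrite gt_max z2.
have /andP[z31 z32] := z3; have /andP[w31 w32] := w3.
have p3 : - r1 < Num.min (cre z) (cre w) by rewrite lt_min z31.
have p4 : Num.max (cre z) (cre w) < r3 by rewrite gt_max z32.
split; rewrite ?segment_im ?segment_re; [exact: lt_le_trans p1 i1|exact: le_lt_trans i2 p2|].
by apply/andP; split; [exact: lt_le_trans p3 j1|exact: le_lt_trans j2 p4].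
Qed.

Lemma half_rectangle_half_plane r1 r2 r3 : half_rectangle r1 r2 r3 `<=` H.
Proof. by move=> z []. Qed.

Lemma within_continuousP (A : set R) (h : R -> C) : {within A, continuous h} ->
  forall t, A t -> forall e, 0 < e -> exists2 d : R, 0 < d &
    forall s, A s -> `|s - t| < d -> cabs (h s - h t) < e.
Proof.
move=> /subspace_continuousP ch t At e e0.
have /= := ch t At _ (disk_nbhs (h t) e0).
rewrite /nbhs /= /within /= => /nbhs_ballP[d /= d0 hd].
exists d => // s As st; apply: hd => //; by rewrite /ball /= distrC.
Qed.

End Rectangles.

Section ImageDomain.
Context {R : realType}.
Local Notation C := (cplane R).
Local Notation H := (@half_plane R).
Variables (f g : C -> C).
Hypotheses (df : forall z, H z -> derivable f z 1)
  (inj : forall z w, H z -> H w -> f z = f w -> z = w)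
  (gK : forall z, H z -> g (f z) = z).
Implicit Types (z w q : C) (e d r t x y : R).
Let oH := @open_half_plane R.

(** The half-rectangle is convex, so loops contract along segments, and f transports the
    contraction. *)
Lemma simply_connected_image r1 r2 r3 : half_rectangle r1 r2 r3 !=set0 ->
  simply_connected_domain (f @` half_rectangle r1 r2 r3).
Proof.
set N := half_rectangle r1 r2 r3 => -[z0 Nz0].
have NH : N `<=` H := @half_rectangle_half_plane R r1 r2 r3.
have cf z : N z -> {for z, continuous f} by move=> Nz; exact: derivableC_continuous (df (NH _ Nz)).
have cg z : N z -> {for f z, continuous g} by move=> Nz; exact: (inverse_continuous oH df inj gK (NH _ Nz)).
split.
  split.
  - by exists (f z0); exists z0.
  - apply: (@open_image R f N (@open_half_rectangle R r1 r2 r3)).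
      by move=> z Nz; apply: df; exact: NH.
    by move=> z w Nz Nw; apply: inj; exact: NH.
  apply: connected_continuous_connected; last first.
    by apply: continuous_in_subspaceT => z; rewrite inE; exact: cf.
  have -> : N = \bigcup_(w in N) (segment z0 w @` `[0, 1]%classic).
    apply/seteqP; split=> [w Nw|w [v Nv [t /=]]].
      by exists w => //; exists 1; rewrite /= ?in_itv /= ?lexx ?ler01 //; exact: segment1.
    by rewrite in_itv => ht <-; exact: half_rectangle_segment.
  apply: bigcup_connected.
    by exists z0 => w _; exists 0; rewrite /= ?in_itv /= ?lexx ?ler01 //; exact: segment0.
  move=> w _; apply: connected_continuous_connected; first exact: segment_connected.
  by apply: continuous_subspaceT => t; exact: segment_continuous.
move=> c [cc cU c01].
have inv t : t \in `[0, 1]%R -> N (g (c t)) /\ f (g (c t)) = c t.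
  move=> ht; have [|z Nz <-] := cU (c t); first by exists t.
  by rewrite gK //; exact: NH.
have i0 : (0 : R) \in `[0, 1]%R by rewrite in_itv /= lexx ler01.
have i1 : (1 : R) \in `[0, 1]%R by rewrite in_itv /= lexx ler01.
have seg s t : s \in `[0, 1]%R -> t \in `[0, 1]%R -> N (segment (g (c t)) (g (c 0)) s).
  move=> hs ht; apply: half_rectangle_segment; [|exact: (inv t ht).1|exact: (inv 0 i0).1].
  by move: hs; rewrite in_itv.
exists (fun p => f (segment (g (c p.2)) (g (c 0)) p.1)); split.
- apply/subspace_continuousP => -[s t] [/= hs ht].
  have Ns := seg s t hs ht.
  apply: (@cvg_comp _ _ _ (fun p : R * R => segment (g (c p.2)) (g (c 0)) p.1) f _ (nbhs (segment (g (c t)) (g (c 0)) s))); last first.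
    exact: cf Ns.
  have k2 : (fun p : R * R => g (c p.2)) @ within (`[0, 1]%classic `*` `[0, 1]%classic) (nbhs (s, t)) --> g (c t).
    have [Nt Et] := inv t ht.
    apply: (@cvg_comp _ _ _ (fun p : R * R => c p.2) g _ (nbhs (c t))); last first.
      by have h := cg _ Nt; rewrite Et in h; exact: h.
    move=> A /nbhs_disk[e e0 eA].
    have [d d0 hd] := within_continuousP cc ht e0.
    rewrite /nbhs /= /within /=.
    exists (setT, [set t' | `|t' - t| < d]) => /=.
      split; first exact: filterT.
      by apply/nbhs_ballP; exists d => //= t'; rewrite -ball_normE /= distrC.
    by move=> [s' t'] [_ /= ht'] [_ h]; apply: eA; exact: hd.
  have k1 : (fun p : R * R => cpx p.1 0) @ within (`[0, 1]%classic `*` `[0, 1]%classic) (nbhs (s, t)) --> cpx s 0.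
    apply: (@cvg_trans _ ((fun p : R * R => cpx p.1 0) @ nbhs (s, t))).
      by apply: cvg_app; exact: cvg_within.
    have c1 : {for (s, t), continuous (fun p : R * R => p.1)} by exact: cvg_fst.
    have c2 : {for (s, t), continuous (fun _ : R * R => 0 : R)} by exact: cst_continuous.
    exact: (cpx_continuous c1 c2).
  exact: (cvgD k2 (cvgM k1 (cvgB (cvg_cst (g (c 0))) k2))).
- by move=> _ [[s t] [/= hs ht] <-]; exists (segment (g (c t)) (g (c 0)) s) => //; exact: seg.
- by move=> t ht /=; rewrite segment0; have [] := inv t ht.
- by move=> t ht /=; rewrite segment1; have [] := inv 0 i0.
- move=> s hs /=; rewrite -c01.
  have -> : segment (g (c 0)) (g (c 0)) s = g (c 0) by rewrite /segment subrr mulr0 addr0.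
  by have [_ ->] := inv 0 i0.
Qed.

(** The inverse of f is continuous on the open set f H, so boundary points of the image
    in f H come from boundary points of the half-rectangle in H. *)
Lemma image_boundary r1 r2 r3 v : 0 < r1 -> 0 < r2 -> 0 < r3 ->
  boundary (f @` half_rectangle r1 r2 r3) v -> (f @` H) v ->
  exists2 z, crosscut r1 r2 r3 z & f z = v.
Proof.
move=> h1 h2 h3; set N := half_rectangle r1 r2 r3 => -[clv niv] [z Hz zv].
exists z => //; rewrite -zv in clv niv.
have oN : open (f @` N).
  apply: (@open_image R f N (@open_half_rectangle R r1 r2 r3)).
    by move=> w [Nw _ _]; apply: df.
  by move=> w w' [Nw _ _] [Nw' _ _]; apply: inj.
have nN : ~ N z.
  by move=> Nz; apply: niv; apply: open_nbhs_nbhs; split; [exact: oN|exists z].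
apply: gauge_eq1 => //; apply/eqP; rewrite eq_le; apply/andP; split; last first.
  by rewrite leNgt; apply/negP => /(gauge_lt1 h1 h2 h3 Hz).
apply/ler_addgt0Pl => e e0; rewrite addrC.
have cgz := inverse_continuous oH df inj gK Hz.
have gz : {for f z, continuous (fun v => gauge r1 r2 r3 (g v))}.
  by apply: (@continuous_comp _ _ _ g (gauge r1 r2 r3)); [exact: cgz|exact: gauge_continuous].
have nb : nbhs (f z) [set v | gauge r1 r2 r3 z - e < gauge r1 r2 r3 (g v)].
  have : nbhs (gauge r1 r2 r3 (g (f z))) [set x | gauge r1 r2 r3 z - e < x].
    by apply: lt_nbhsr; rewrite gK // gtrBl.
  by move=> /gz.
have [u [[w Nw <-] /=]] := clv _ nb.
have Hw : H w by case: Nw.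
rewrite gK // => hlt; have := (gauge_lt1 h1 h2 h3 Hw).1 Nw; lra.
Qed.

End ImageDomain.

(** * Accessibility of the cluster values *)

Section Access.
Context {R : realType}.
Local Notation C := (cplane R).
Local Notation H := (@half_plane R).
Variables (f g : C -> C).
Hypotheses (df : forall z, H z -> derivable f z 1)
  (inj : forall z w, H z -> H w -> f z = f w -> z = w)
  (gK : forall z, H z -> g (f z) = z).
Hypothesis reachable : semi_unreachable (f @` H) = set0.
Variable p : sphere R.
Hypothesis crosscuts : forall W, nbhs p W -> forall d, 0 < d ->
  exists r1 r2 r3, [/\ 0 < r1 < d, 0 < r2 < d, 0 < r3 < d &
    forall z, crosscut r1 r2 r3 z -> W (Some (f z))].
Implicit Types (z w q lam : C) (e d r t x y : R).
Let oH := @open_half_plane R.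

(** Finite cluster values of f at the origin. *)
Definition cluster0 lam := forall e d, 0 < e -> 0 < d ->
  exists2 z, H z & cabs z < d /\ cabs (f z - lam) < e.

Lemma cluster0_off_image lam : cluster0 lam -> forall z, H z -> f z != lam.
Proof.
move=> cl z Hz; apply/eqP => E.
have i2 : 0 < cim z / 2 by rewrite divr_gt0.
have /continuousC/(_ _ i2)[d d0 hd] := inverse_continuous oH df inj gK Hz.
have [w Hw [w1 w2]] := cl _ _ d0 i2.
rewrite -E in w2; have := hd _ w2; rewrite !gK // => h.
have := cim_cabs z; rewrite gtr0_norm // => h'.
have := cabs_triangle w z 0; rewrite !subr0 [cabs (z - w)]cabsC; lra.
Qed.

Lemma separate_from_point lam : Some lam <> p -> exists2 W : set (sphere R), nbhs p W &
  exists2 e : R, 0 < e & forall z, W (Some z) -> e <= cabs (z - lam).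
Proof.
case: p => [q|] qlam.
  have ql : q != lam by apply/eqP => E; apply: qlam; rewrite E.
  have k0 : 0 < cabs (q - lam) / 2 by rewrite divr_gt0 // cabs_gt0 subr_eq0.
  exists (Some @` disk q (cabs (q - lam) / 2)).
    by apply/nbhs_Some; exists (cabs (q - lam) / 2) => // z hz; exists z.
  exists (cabs (q - lam) / 2) => // z [z' hz [E]]; rewrite E /disk /= in hz.
  by have := cabs_triangle z q lam; rewrite [cabs (q - z)]cabsC; lra.
exists [set x | if x is Some z then cabs lam + 1 < cabs z else True].
  by apply/nbhs_None; split => //; exists (cabs lam + 1).
by exists 1 => // z /= hz; have := cabsB z lam; lra.
Qed.

(** The point where the absence of semi-unreachable points enters. The boundary of the
    image U of a half-rectangle meets f H only in the image of the crosscut, which is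
    close to p and so away from lam. Hence lam would be
    semi-unreachable through U if it were not accessible from U. *)
Lemma accessible_cluster lam rho : cluster0 lam -> Some lam <> p -> 0 < rho ->
  exists r1 r2 r3, [/\ 0 < r1 < rho, 0 < r2 < rho, 0 < r3 < rho &
    accessible_boundary (f @` half_rectangle r1 r2 r3) lam].
Proof.
move=> cl lp rho0; have [W pW [e e0 We]] := separate_from_point lp.
have [r1 [r2 [r3 [h1 h2 h3 XW]]]] := crosscuts pW rho0.
exists r1, r2, r3; split => //.
have [p1 p2 p3] : [/\ 0 < r1, 0 < r2 & 0 < r3] by split; [case/andP: h1|case/andP: h2|case/andP: h3].
set N := half_rectangle r1 r2 r3; set U := f @` N.
have m0 : 0 < Num.min r1 (Num.min r2 r3) by rewrite !lt_min p1 p2.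
have N0 : N !=set0.
  by have [z Hz [z1 _]] := cl 1 _ ltr01 m0; exists z; exact: half_rectangle_near.
have UG : U `<=` f @` H by apply: image_subset; exact: half_rectangle_half_plane.
have lamG : ~ (f @` H) lam by move=> [z Hz E]; have := cluster0_off_image cl Hz; rewrite E eqxx.
have clU : closure U lam.
  move=> A /nbhs_disk[e' e'0 eA]; have [z Hz [z1 z2]] := cl _ _ e'0 m0.
  exists (f z); split; last exact: eA.
  by exists z => //; exact: half_rectangle_near.
have bU : boundary U lam.
  by split => // /nbhs_singleton /UG.
have bG : boundary (f @` H) lam.
  split; last by move=> /nbhs_singleton.
  exact: (closure_subset UG).
have far : ~ closure (boundary U `&` (f @` H)) lam.
  move=> /(_ _ (disk_nbhs lam e0)) [v [[bv Gv] hv]].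
  have [z Xz E] := image_boundary df inj gK p1 p2 p3 bv Gv.
  by have := We _ (XW z Xz); rewrite E; move: hv; rewrite /disk /=; lra.
apply: contrapT => na.
have : semi_unreachable (f @` H) lam.
  split; first exact: bG.
  exists U; split; [exact: (simply_connected_image df inj gK N0)|exact: UG|by split; [exact: bU|exact: na]|exact: far].
by rewrite reachable.
Qed.

(** The arc meets the boundary only at lam, so from one of its ends up to lam it runs in the
    image and can be pulled back. Parameters below 0 are mapped to the start of the path. *)
Lemma access_path r1 r2 r3 lam : 0 < r1 -> 0 < r2 -> 0 < r3 ->
  accessible_boundary (f @` half_rectangle r1 r2 r3) lam ->
  exists h : R -> C, [/\ forall t, t < 1 -> {for t, continuous h},
    forall t, t < 1 -> half_rectangle r1 r2 r3 (h t) &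
    forall e, 0 < e -> exists2 T, T < 1 & forall t, T < t < 1 -> cabs (f (h t) - lam) < e].
Proof.
move=> p1 p2 p3; set N := half_rectangle r1 r2 r3; set U := f @` N.
move=> [bU [J [[a [b [k [ab ck ik JE]]]] JU Jlam]]].
have NH : N `<=` H := @half_rectangle_half_plane R r1 r2 r3.
have [t0 ht0 kt0] : exists2 t0, a <= t0 <= b & k t0 = lam.
  have : (J `&` boundary U) lam by rewrite Jlam.
  by rewrite JE => -[[t0 /=]]; rewrite in_itv /= => h <- _; exists t0.
have inU t : a <= t <= b -> t != t0 -> U (k t).
  move=> ht tt0; have Jk : J (k t) by rewrite JE; exists t; rewrite //= in_itv.
  apply: contrapT => nU; have : (J `&` boundary U) (k t).
    split; first exact: Jk.
    split; first exact: JU _ Jk.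
    by move=> /nbhs_singleton /nU.
  rewrite Jlam /= -kt0 => E; move/eqP: tt0; apply; apply: ik E; rewrite inE /= in_itv /=;
    [exact: ht|exact: ht0].
have [t1 ht1 t10] : exists2 t1, a <= t1 <= b & t1 != t0.
  have [->|ne] := eqVneq t0 a; first by exists b; [rewrite lexx ltW|rewrite gt_eqF].
  by exists a; [rewrite lexx ltW|rewrite eq_sym].
pose th s := t1 + Num.max 0 s * (t0 - t1).
have thab s : s <= 1 -> a <= th s <= b.
  by move=> s1; apply: between => //; rewrite le_max lexx ge_max ler01 s1.
have th0 s : s < 1 -> th s != t0.
  move=> s1; rewrite /th -subr_eq0.
  have -> : t1 + Num.max 0 s * (t0 - t1) - t0 = (1 - Num.max 0 s) * (t1 - t0) by ring.
  by rewrite mulf_neq0 ?subr_eq0 // eq_sym lt_eqF // gt_max ltr01.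
have thd s s' : `|th s - th s'| <= `|s - s'| * `|t0 - t1|.
  have -> : th s - th s' = (Num.max 0 s - Num.max 0 s') * (t0 - t1) by rewrite /th; ring.
  rewrite normrM ler_wpM2r // ler_norml.
  by case: (leP 0 s) => ?; case: (leP 0 s') => ?; have := ler_norm (s - s'); have := ler_norm (s' - s);
    rewrite [`|s' - s|]distrC; lra.
have dt0 : 0 < `|t0 - t1| by rewrite normr_gt0 subr_eq0 eq_sym.
have kth s e : s <= 1 -> 0 < e -> exists2 d : R, 0 < d &
    forall s', s' <= 1 -> `|s' - s| < d -> cabs (k (th s') - k (th s)) < e.
  move=> s1 e0; have hs : `[a, b]%classic (th s) by rewrite /= in_itv; exact: thab.
  have [d d0 hd] := within_continuousP ck hs e0.
  exists (d / `|t0 - t1|); first by rewrite divr_gt0.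
  move=> s' s'1 hss; apply: hd; first by rewrite /= in_itv; exact: thab.
  by apply: le_lt_trans (thd _ _) _; rewrite -ltr_pdivlMr.
pose h s := g (k (th s)).
have hP s : s < 1 -> N (h s) /\ f (h s) = k (th s).
  move=> s1; have [z Nz E] := inU _ (thab s (ltW s1)) (th0 s s1).
  by rewrite /h -E gK //; exact: NH.
exists h; split.
- move=> s s1; have [Ns Es] := hP s s1.
  move=> A /nbhs_disk[e e0 eA].
  have cgs := inverse_continuous oH df inj gK (NH _ Ns); rewrite Es in cgs.
  have [d d0 hd] := (continuousC g (k (th s))).1 cgs e e0.
  have [d' d'0 hd'] := kth s d (ltW s1) d0.
  apply/nbhs_ballP; exists (Num.min d' (1 - s)); first by rewrite /= lt_min d'0 subr_gt0.
  move=> s'; rewrite /ball /= distrC lt_min => /andP[l1 l2].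
  apply: eA; rewrite /disk /=; apply: hd; apply: hd' => //.
  by move: l2; rewrite ltr_norml; lra.
- by move=> s /hP[].
move=> e e0; have [d d0 hd] := kth 1 e (lexx _) e0.
exists (1 - d); first by rewrite gtrBl.
move=> s /andP[s1 s2]; have [_ ->] := hP s s2.
have E1 : k (th 1) = lam.
  by rewrite /th max_r ?ler01 // mul1r addrC subrK.
rewrite -E1; apply: hd; first exact: ltW.
by rewrite ltr0_norm ?subr_lt0 //; lra.
Qed.

End Access.

(** * The limit at a boundary point *)

Section Limit.
Context {R : realType}.
Local Notation C := (cplane R).
Local Notation H := (@half_plane R).
Variables (f g : C -> C).
Hypotheses (df : forall z, H z -> derivable f z 1)
  (inj : forall z w, H z -> H w -> f z = f w -> z = w)
  (gK : forall z, H z -> g (f z) = z).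
Hypothesis reachable : semi_unreachable (f @` H) = set0.
Variable p : sphere R.
Hypothesis crosscuts : forall W, nbhs p W -> forall d, 0 < d ->
  exists r1 r2 r3, [/\ 0 < r1 < d, 0 < r2 < d, 0 < r3 < d &
    forall z, crosscut r1 r2 r3 z -> W (Some (f z))].
Implicit Types (z w q lam : C) (e d r t x y rho : R).
Let oH := @open_half_plane R.

(** A path that comes back to the origin has to cross small crosscuts, on which f is close
    to p, while f tends to lam along it. *)
Lemma path_avoids_origin (h : R -> C) lam : Some lam <> p ->
  (forall t, t < 1 -> {for t, continuous h}) -> (forall t, t < 1 -> H (h t)) ->
  (forall e, 0 < e -> exists2 T, T < 1 & forall t, T < t < 1 -> cabs (f (h t) - lam) < e) ->
  exists2 d : R, 0 < d & forall t, 0 <= t < 1 -> d <= cabs (h t).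
Proof.
move=> lp ch Hh lim; apply: contrapT => no.
have [W pW [e e0 We]] := separate_from_point lp; clear lp.
have [T T1 hT] := lim e e0.
pose T' := (Num.max 0 T + 1) / 2.
have [m0 mT m1] : [/\ 0 <= Num.max 0 T, T <= Num.max 0 T & Num.max 0 T < 1].
  by rewrite !le_max !lexx orbT gt_max ltr01.
have [T'0 T'1 TT'] : [/\ 0 <= T', T' < 1 & T < T'] by rewrite /T'; split; lra.
clearbody T'.
have cT t : 0 <= t <= T' -> {for t, continuous h} by move=> /andP[_ tT]; apply: ch; exact: le_lt_trans T'1.
have HT t : 0 <= t <= T' -> H (h t) by move=> /andP[_ tT]; apply: Hh; exact: le_lt_trans T'1.
have [b [B [b0 _ hb]]] := box_exists cT HT.
have [r1 [r2 [r3 [/andP[p1 l1] /andP[p2 l2] /andP[p3 l3] XW]]]] := crosscuts pW b0.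
pose m := Num.min r1 (Num.min r2 r3).
have mm : 0 < m by rewrite !lt_min p1 p2.
have [t ht hm] : exists2 t, 0 <= t < 1 & cabs (h t) < m.
  apply: contrapT => no'; apply: no; exists m => // t ht; rewrite leNgt; apply/negP => hlt.
  by apply: no'; exists t.
have /andP[t0 t1] := ht.
have inN := half_rectangle_near p1 p2 p3 (Hh t t1) hm.
have Tt : T' < t.
  rewrite ltNge; apply/negP => tT; have [_ /andP[h1 _]] := hb t ltac:(by rewrite t0).
  by case: inN => _ h2 _; lra.
pose k s := gauge r1 r2 r3 (h s).
have kt : k t < 1 by apply/gauge_lt1 => //; exact: Hh.
have kT : 1 < k T'.
  have [_ /andP[h1 _]] := hb T' ltac:(by rewrite T'0 lexx).
  by rewrite /k /gauge lt_max ltr_pdivlMr // mul1r (lt_le_trans l2 h1).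
have ck : {within `[T', t], continuous k}.
  apply: continuous_in_subspaceT => s; rewrite inE /= in_itv /= => /andP[_ st].
  apply: (@continuous_comp _ _ _ h (gauge r1 r2 r3)); last exact: gauge_continuous.
  by apply: ch; exact: le_lt_trans t1.
have [|s] := @IVT R k T' t 1 (ltW Tt) ck.
  by rewrite ge_min le_max (ltW kt) (ltW kT) orbT.
rewrite in_itv /= => /andP[s1 s2] ks.
have s3 : s < 1 by exact: le_lt_trans t1.
have := We _ (XW _ (gauge_eq1 p1 p2 p3 (Hh s s3) ks)).
have := hT s; rewrite s3 (lt_le_trans TT' s1) => /(_ isT); lra.
Qed.

Lemma landing lam rho : cluster0 f lam -> Some lam <> p -> 0 < rho ->
  exists h x rho', [/\ landing_path f h lam x, 0 < rho',
    forall t, 0 <= t < 1 -> rho' <= cabs (h t) <= rho & rho' <= `|x| <= rho].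
Proof.
move=> cl lp rho0; have rho2 : 0 < rho / 2 by rewrite divr_gt0.
have [r1 [r2 [r3 [/andP[p1 l1] /andP[p2 l2] /andP[p3 l3] acc]]]] :=
  accessible_cluster df inj gK reachable crosscuts cl lp rho2.
have [h [ch Nh lim]] := access_path df inj gK p1 p2 p3 acc.
have Hh t : t < 1 -> H (h t) by move=> /Nh[].
have [d d0 hd] := path_avoids_origin lp ch Hh lim; clear lp acc.
have hrho t : t < 1 -> cabs (h t) <= rho.
  move=> /Nh[i1 i2 /andP[i3 i4]]; apply: le_trans (cabs_le_re_im _) _.
  rewrite (gtr0_norm i1); have : `|cre (h t)| <= rho / 2 by rewrite ler_norml; lra.
  lra.
pose u (n : nat) : R := 1 - n.+1%:R^-1.
have u1 n : u n < 1 by rewrite ltrBlDr ltrDl invr_gt0.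
have [|zeta zrho clz] := @sequence_cluster _ _ (h \o u) (compact_cdisk (c := 0) (r := rho)).
  by move=> n; rewrite /= subr0; exact: hrho.
rewrite /= subr0 in zrho.
have late e T : 0 < e -> T < 1 -> exists2 t, Num.max 0 T < t < 1 & cabs (h t - zeta) < e.
  move=> e0 T1; have m1 : 0 < 1 - Num.max 0 T by rewrite subr_gt0 gt_max ltr01.
  have [k small] := reciprocals_small m1.
  have [n kn hn] := clz _ (disk_nbhs zeta e0) k.
  exists (u n) => //; rewrite u1 andbT.
  by have := small n kn; rewrite /u; move: (_^-1) (Num.max 0 T) => a b ab; rewrite ltrBrDl -ltrBrDr.
have zim : 0 <= cim zeta.
  apply/ler_addgt0Pl => e e0; have [t /andP[_ t1] ht] := late e 0 e0 ltr01.
  have Ht := Hh t t1; have := le_lt_trans (cim_cabs _) ht; rewrite !cE ltr_norml.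
  by move: Ht; rewrite /half_plane /=; lra.
have zH : ~ H zeta.
  move=> Hz; have := cluster0_off_image df inj gK cl Hz; rewrite -subr_eq0 -cabs_gt0 => q0.
  have q2 : 0 < cabs (f zeta - lam) / 2 by rewrite divr_gt0.
  have /continuousC/(_ _ q2)[d1 d10 h1] := derivableC_continuous (df Hz).
  have [T T1 hT] := lim _ q2.
  have [t /andP[Tt t1] ht] := late d1 T d10 T1.
  have := h1 _ ht; have := hT t; rewrite t1 andbT => h2.
  have := h2 (le_lt_trans _ Tt); rewrite le_max lexx orbT => /(_ isT) => a1 a2.
  by have := cabs_triangle (f (h t)) (f zeta) lam; rewrite [cabs (f zeta - f _)]cabsC; lra.
have zE : zeta = cpx (cre zeta) 0.
  apply: cpx_inj => //; rewrite cim_cpx; apply/eqP; rewrite eq_le zim andbT leNgt.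
  by apply/negP.
exists h, (cre zeta), d; split => //.
- split => // e T e0 T1; have [t /andP[Tt t1] ht] := late e T e0 T1.
  exists t; last by rewrite -zE.
  by rewrite t1 andbT; apply: le_lt_trans Tt; rewrite le_max lexx orbT.
- by move=> t ht; rewrite hd //; apply: hrho; case/andP: ht.
rewrite -cpx_real -zE zrho andbT.
apply/ler_addgt0Pl => e e0; have [t /andP[Tt t1] ht] := late e 0 e0 ltr01.
have t0 : 0 <= t by apply: ltW; apply: le_lt_trans Tt; rewrite le_max lexx.
have := hd t; rewrite t0 t1 => /(_ isT); have := cabsB (h t) zeta; lra.
Qed.

(** Landing points of value lam arbitrarily close to the origin on the side of the sign s,
    by paths that are bounded away from the origin. *)
Definition lands s lam := forall rho, 0 < rho -> exists h x rho',
  [/\ landing_path f h lam x, 0 < rho' /\ 0 < s * x,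
    forall t, 0 <= t < 1 -> rho' <= cabs (h t) <= rho & rho' <= `|x| <= rho].

Lemma lands_some_side lam : cluster0 f lam -> Some lam <> p -> lands 1 lam \/ lands (-1) lam.
Proof.
move=> cl lp; have [|no] := pselect (lands 1 lam); first by left.
right => rho rho0.
have [rho1 rho10 no1] : exists2 rho1, 0 < rho1 & ~ exists h x rho',
  [/\ landing_path f h lam x, 0 < rho' /\ 0 < 1 * x,
    forall t, 0 <= t < 1 -> rho' <= cabs (h t) <= rho1 & rho' <= `|x| <= rho1].
  apply: contrapT => no'; apply: no => rho1 rho10; apply: contrapT => no1.
  by apply: no'; exists rho1.
have m0 : 0 < Num.min rho rho1 by rewrite lt_min rho0.
have [h [x [rho' [lh rho'0 hb hx]]]] := landing cl lp m0; clear lp.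
have xneg : x < 0.
  rewrite ltNge; apply/negP => x0; apply: no1; exists h, x, rho'; split => //.
  - split => //; rewrite mul1r lt_neqAle x0 andbT; apply/eqP => x00.
    by move: hx; rewrite -x00 normr0; lra.
  - move=> t /hb /andP[-> /le_trans]; apply; by rewrite ge_min lexx orbT.
  - by case/andP: hx => -> /le_trans; apply; rewrite ge_min lexx orbT.
exists h, x, rho'; split => //.
- by split => //; lra.
- move=> t /hb /andP[-> /le_trans]; apply; by rewrite ge_min lexx.
- by case/andP: hx => -> /le_trans; apply; rewrite ge_min lexx.
Qed.

(** If both values were taken on the same side, paths could be chosen one after the other,
    each much closer to the origin than the previous one, with alternating values. Their
    landing points would interlace. *)
Lemma one_landing_value_per_side s lam lam' : (s = 1 \/ s = -1) ->
  cluster0 f lam -> cluster0 f lam' -> lands s lam -> lands s lam' -> lam = lam'.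
Proof.
move=> s1 cl cl' L L'; apply: contrapT => /eqP ll.
have off := cluster0_off_image df inj gK cl; have off' := cluster0_off_image df inj gK cl'.
have [h1 [x1 [d1 [P1 [d10 S1] B1 X1]]]] := L 1 ltr01.
have [h2 [x2 [d2 [P2 [d20 S2] B2 X2]]]] := L' (d1 / 2) ltac:(by rewrite divr_gt0).
have [h3 [x3 [d3 [P3 [d30 S3] B3 X3]]]] := L (d2 / 2) ltac:(by rewrite divr_gt0).
have [h4 [x4 [d4 [P4 [d40 S4] B4 X4]]]] := L' (d3 / 2) ltac:(by rewrite divr_gt0).
have far (h : R -> C) (x t lo hi lo' hi' : R) : lo <= cabs (h t) <= hi -> lo' <= `|x| <= hi' ->
    hi' + d4 / 2 <= lo \/ hi + d4 / 2 <= lo' -> d4 / 2 <= cabs (h t - cpx x 0).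
  move=> b1 b2 g12; have := cabsB (h t) (cpx x 0); have := cabsB (cpx x 0) (h t).
  by rewrite [cabs (cpx x 0 - _)]cabsC cpx_real; case: g12 => ?; lra.
have e21 : d2 <= d1 / 2 by lra.
have e32 : d3 <= d2 / 2 by lra.
have e43 : d4 <= d3 / 2 by lra.
have sep t : 0 <= t < 1 ->
  [/\ d4 / 2 <= cabs (h1 t - cpx x2 0) /\ d4 / 2 <= cabs (h1 t - cpx x4 0),
      d4 / 2 <= cabs (h3 t - cpx x2 0) /\ d4 / 2 <= cabs (h3 t - cpx x4 0),
      d4 / 2 <= cabs (h2 t - cpx x1 0) /\ d4 / 2 <= cabs (h2 t - cpx x3 0) &
      d4 / 2 <= cabs (h4 t - cpx x1 0) /\ d4 / 2 <= cabs (h4 t - cpx x3 0)].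
  move=> ht; have b1 := B1 t ht; have b2 := B2 t ht; have b3 := B3 t ht; have b4 := B4 t ht.
  split; split.
  - by apply: far b1 X2 _; left; lra.
  - by apply: far b1 X4 _; left; lra.
  - by apply: far b3 X2 _; right; lra.
  - by apply: far b3 X4 _; left; lra.
  - by apply: far b2 X1 _; right; lra.
  - by apply: far b2 X3 _; left; lra.
  - by apply: far b4 X1 _; right; lra.
  - by apply: far b4 X3 _; right; lra.
have d42 : 0 < d4 / 2 by lra.
clear far B1 B2 B3 B4 L L' cl cl'.
case: s1 => sE; rewrite sE in S1 S2 S3 S4.
  have n x : 0 < 1 * x -> `|x| = x by rewrite mul1r => /gtr0_norm.
  rewrite (n _ S1) in X1; rewrite (n _ S2) in X2; rewrite (n _ S3) in X3; rewrite (n _ S4) in X4.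
  apply: (no_interlacing df inj _ off' off P4 P3 P2 P1); [by rewrite eq_sym|lra|lra|lra|].
  by exists (d4 / 2) => // t /sep[[a1 a2] [a3 a4] [a5 a6] [a7 a8]].
have n x : 0 < -1 * x -> `|x| = - x by rewrite mulN1r oppr_gt0 => /ltr0_norm.
rewrite (n _ S1) in X1; rewrite (n _ S2) in X2; rewrite (n _ S3) in X3; rewrite (n _ S4) in X4.
by apply: (no_interlacing df inj ll off off' P1 P2 P3 P4); [lra|lra|lra|exists (d4 / 2)].
Qed.

(** Intermediate value theorem on the vertical segment from z up to the crosscut. *)
Lemma level_value (m : C) c r1 r2 r3 z : 0 < r1 -> 0 < r2 -> 0 < r3 -> half_rectangle r1 r2 r3 z ->
  (forall w, crosscut r1 r2 r3 w -> cabs (f w - m) < c) /\ c <= cabs (f z - m) \/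
  (forall w, crosscut r1 r2 r3 w -> c < cabs (f w - m)) /\ cabs (f z - m) <= c ->
  exists2 w, H w & cabs w <= r1 + r2 + r3 /\ cabs (f w - m) = c.
Proof.
move=> p1 p2 p3 [z1 z2 /andP[z3 z4]] alt.
have Xtop : crosscut r1 r2 r3 (cpx (cre z) r2).
  by split; rewrite ?cre_cpx ?cim_cpx; [rewrite p2 lexx|lra|exact: Or33].
pose k y := cabs (f (cpx (cre z) y) - m).
have ck : {within `[cim z, r2], continuous k}.
  apply: continuous_in_subspaceT => y; rewrite inE /= in_itv /= => /andP[y1 _].
  have Hy : H (cpx (cre z) y) by exact: lt_le_trans y1.
  have c1 : {for y, continuous (fun y : R => cpx (cre z) y)}.
    by apply: (@cpx_continuous R _ (fun=> cre z) (fun y => y)); [exact: cst_continuous|exact: cvg_id].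
  have c2 : {for y, continuous (fun y : R => f (cpx (cre z) y))}.
    by apply: (@continuous_comp _ _ _ (fun y : R => cpx (cre z) y) f); [exact: c1|exact: derivableC_continuous (df Hy)].
  by apply: (@continuous_comp _ _ _ (fun y => f (cpx (cre z) y)) (fun w => cabs (w - m))); [exact: c2|exact: cabs_sub_continuous].
have kz : k (cim z) = cabs (f z - m) by rewrite /k -cpxE.
have [|y] := @IVT R k (cim z) r2 c (ltW z2) ck.
  rewrite ge_min le_max kz; case: alt => -[hX hz].
    by rewrite hz (ltW (hX _ Xtop)) orbT.
  by rewrite hz (ltW (hX _ Xtop)) orbT.
rewrite in_itv /= => /andP[y1 y2] ky; exists (cpx (cre z) y); first exact: lt_le_trans y1.
split => //; apply: le_trans (cabs_le_re_im _) _; rewrite cre_cpx cim_cpx.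
have : `|cre z| <= r1 + r3 by rewrite ler_norml; lra.
have : `|y| <= r2 by rewrite ger0_norm //; lra.
lra.
Qed.

Lemma level_cluster (m : C) c : (forall d, 0 < d -> exists2 w, H w & cabs w < d /\ cabs (f w - m) = c) ->
  exists2 lam, cabs (lam - m) = c & cluster0 f lam.
Proof.
move=> lev.
have ex n : exists w, [/\ H w, cabs w < n.+1%:R^-1 & cabs (f w - m) = c].
  by have [|w Hw [w1 w2]] := lev n.+1%:R^-1; [rewrite invr_gt0|exists w].
have [u Hu] := choice ex.
have cK : compact [set z : C | cabs (z - m) = c].
  apply: (subclosed_compact _ (compact_cdisk (c := m) (r := c))); last by move=> z /= ->.
  have -> : [set z : C | cabs (z - m) = c] = (fun z : C => cabs (z - m)) @^-1` [set x | x = c] by [].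
  apply: closed_comp; last exact: closed_eq.
  by move=> z _; exact: cabs_sub_continuous.
have [|lam lc cll] := @sequence_cluster _ _ (f \o u) cK; first by move=> n; have [] := Hu n.
exists lam => // e d e0 d0.
have [k small] := reciprocals_small d0.
have [n kn hn] := cll _ (disk_nbhs lam e0) k.
have [Hn n1 _] := Hu n; exists (u n) => //; split => //; exact: lt_trans n1 (small n kn).
Qed.

(** Otherwise a whole interval of levels around p is taken near the origin, which gives
    infinitely many cluster values other than p. Each of them lands on one of the two
    sides, and a side has only one landing value: three values are already too many. *)
Lemma boundary_limit W : nbhs p W ->
  exists2 d : R, 0 < d & forall z, H z -> cabs z < d -> W (Some (f z)).
Proof.
move=> pW; apply: contrapT => no.
have bad d : 0 < d -> exists2 z, H z & cabs z < d /\ ~ W (Some (f z)).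
  move=> d0; apply: contrapT => no'; apply: no; exists d => // z Hz zd.
  by apply: contrapT => nW; apply: no'; exists z.
(* the levels are distances to p if p is finite, and moduli if p is infinity *)
have [m [al [be [ab lev]]]] : exists m al be, al < be /\
   forall c, al < c < be -> exists2 lam, cabs (lam - m) = c & cluster0 f lam /\ Some lam <> p.
  case: p pW crosscuts => [q|] pW' cc.
    have [r r0 hr] := (nbhs_Some q W).1 pW'.
    exists q, 0, r; split => // c /andP[c0 cr].
    have [|lam lc cl] := @level_cluster q c.
      move=> d d0; have d3 : 0 < d / 3 by rewrite divr_gt0.
      have [r1 [r2 [r3 [/andP[p1 l1] /andP[p2 l2] /andP[p3 l3] XW]]]] := cc _ (@one_point_compactification_some_nbhs C q _ (disk_nbhs q c0)) _ d3.
      have mm : 0 < Num.min r1 (Num.min r2 r3) by rewrite !lt_min p1 p2.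
      have [z Hz [z1 z2]] := bad _ mm.
      have [|w Hw [w1 w2]] := @level_value q c r1 r2 r3 z p1 p2 p3 (half_rectangle_near p1 p2 p3 Hz z1).
        left; split; first by move=> w /XW [v hv [<-]].
        by rewrite leNgt; apply/negP => h; apply: z2; apply: hr; lra.
      by exists w => //; split => //; lra.
    exists lam => //; split => // -[E]; move: lc; rewrite E subrr cabs0; lra.
  have [W0 [r hr]] := (nbhs_None W).1 pW'.
  exists 0, r, (r + 1); split; first by rewrite ltrDl.
  move=> c /andP[rc _].
  have [|lam lc cl] := @level_cluster 0 c.
    move=> d d0; have d3 : 0 < d / 3 by rewrite divr_gt0.
    have nW : nbhs (None : sphere R) [set x | if x is Some z then c < cabs z else True].
      by apply/nbhs_None; split => //; exists c.
    have [r1 [r2 [r3 [/andP[p1 l1] /andP[p2 l2] /andP[p3 l3] XW]]]] := cc _ nW _ d3.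
    have mm : 0 < Num.min r1 (Num.min r2 r3) by rewrite !lt_min p1 p2.
    have [z Hz [z1 z2]] := bad _ mm.
    have [|w Hw [w1 w2]] := @level_value 0 c r1 r2 r3 z p1 p2 p3 (half_rectangle_near p1 p2 p3 Hz z1).
      right; split; first by move=> w /XW; rewrite subr0.
      by rewrite subr0 leNgt; apply/negP => h; apply: z2; apply: hr; lra.
    by exists w => //; split => //; lra.
  by exists lam.
pose c (i : R) := al + i * (be - al) / 4.
have [lam1 e1 [cl1 n1]] := lev (c 1) ltac:(by rewrite /c; lra).
have [lam2 e2 [cl2 n2]] := lev (c 2) ltac:(by rewrite /c; lra).
have [lam3 e3 [cl3 n3]] := lev (c 3) ltac:(by rewrite /c; lra).
have n12 : lam1 <> lam2 by move=> E; move: e1; rewrite E e2 /c; lra.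
have n13 : lam1 <> lam3 by move=> E; move: e1; rewrite E e3 /c; lra.
have n23 : lam2 <> lam3 by move=> E; move: e2; rewrite E e3 /c; lra.
have pos : (1 : R) = 1 \/ (1 : R) = -1 by left.
have neg : (-1 : R) = 1 \/ (-1 : R) = -1 by right.
have U := one_landing_value_per_side.
case: (lands_some_side cl1 n1) => L1; case: (lands_some_side cl2 n2) => L2;
  case: (lands_some_side cl3 n3) => L3.
- by apply: n12; exact: U pos cl1 cl2 L1 L2.
- by apply: n12; exact: U pos cl1 cl2 L1 L2.
- by apply: n13; exact: U pos cl1 cl3 L1 L3.
- by apply: n23; exact: U neg cl2 cl3 L2 L3.
- by apply: n23; exact: U pos cl2 cl3 L2 L3.
- by apply: n13; exact: U neg cl1 cl3 L1 L3.
- by apply: n12; exact: U neg cl1 cl2 L1 L2.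
- by apply: n12; exact: U neg cl1 cl2 L1 L2.
Qed.

End Limit.

(** * From the half-plane to the disk *)

Section Cayley.
Context {R : realType}.
Local Notation C := (cplane R).
Local Notation H := (@half_plane R).
Implicit Types (z w v : C) (e d : R).

Local Notation ii := (cpx 0 1 : C).

(** Maps the half-plane onto the disk, and the origin to the point w of the circle. *)
Definition cayley w z : C := w * ((ii - z) / (ii + z)).
Definition cayley_inverse w v : C := ii * ((w - v) / (w + v)).

(** The half-plane is the set of points closer to i than to - i. *)
Lemma half_plane_cabs z : H z <-> cabs (ii - z) < cabs (ii + z).
Proof.
have E : cabs (ii + z) ^+ 2 - cabs (ii - z) ^+ 2 = 4 * cim z.
  by rewrite !sqr_cabs !cE; ring.
have -> : (cabs (ii - z) < cabs (ii + z)) = (cabs (ii - z) ^+ 2 < cabs (ii + z) ^+ 2).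
  by rewrite ltr_pXn2r ?nnegrE ?cabs_ge0.
rewrite -subr_gt0 E /half_plane /=; split; lra.
Qed.

Lemma imaginary_unit_neq0 : ii != 0.
Proof. by rewrite -cabs_eq0 cpx_imag normr1 oner_eq0. Qed.

Lemma cayley_denominator z : H z -> ii + z != 0.
Proof. by move=> /half_plane_cabs h; rewrite -cabs_gt0; apply: le_lt_trans h; exact: cabs_ge0. Qed.

Lemma unit_circle_neq0 w : cabs w = 1 -> w != 0.
Proof. by move=> w1; rewrite -cabs_eq0 w1 oner_eq0. Qed.

Lemma cayley_disk w z : cabs w = 1 -> H z -> cabs (cayley w z) < 1.
Proof.
move=> w1 Hz; have n0 := cayley_denominator Hz.
rewrite /cayley cabsM w1 mul1r cabsM cabsV ltr_pdivrMr ?cabs_gt0 // mul1r.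
exact/half_plane_cabs.
Qed.

Lemma cayleyK w z : cabs w = 1 -> H z -> cayley_inverse w (cayley w z) = z.
Proof.
move=> w1 Hz; have n0 := cayley_denominator Hz; have w0 := unit_circle_neq0 w1.
have i0 := imaginary_unit_neq0; have t0 : (2 : C) != 0 by rewrite pnatr_eq0.
have E1 : w - cayley w z = (2 * w / (ii + z)) * z by rewrite /cayley; field.
have E2 : w + cayley w z = (2 * w / (ii + z)) * ii by rewrite /cayley; field.
by rewrite /cayley_inverse E1 E2; field; rewrite i0 n0 w0.
Qed.

Lemma cayley_inverse_denominator w v : cabs w = 1 -> cabs v < 1 -> w + v != 0.
Proof.
move=> w1 v1; rewrite -cabs_gt0.
by have := cabsB w (- v); rewrite opprK w1 cabsN; lra.
Qed.

Lemma cayley_inverseK w v : cabs w = 1 -> cabs v < 1 ->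
  cayley w (cayley_inverse w v) = v /\ H (cayley_inverse w v).
Proof.
move=> w1 v1; have n0 := cayley_inverse_denominator w1 v1; have w0 := unit_circle_neq0 w1.
have i0 := imaginary_unit_neq0; have t0 : (2 : C) != 0 by rewrite pnatr_eq0.
have E1 : ii - cayley_inverse w v = (2 * ii / (w + v)) * v by rewrite /cayley_inverse; field.
have E2 : ii + cayley_inverse w v = (2 * ii / (w + v)) * w by rewrite /cayley_inverse; field.
split; first by rewrite /cayley E1 E2; field; rewrite i0 n0 w0.
apply/half_plane_cabs; rewrite E1 E2 !cabsM ltr_pM2l ?w1 //.
by rewrite -!cabsM cabs_gt0 !mulf_neq0 // invr_neq0.
Qed.

Lemma cayley_derivable w z : H z -> derivable (cayley w) z 1.
Proof.
move=> Hz; have n0 := cayley_denominator Hz.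
have d1 : derivable (fun z : C => ii - z) z 1.
  by apply: derivableB; [exact: derivable_cst|exact: derivable_id].
have d2 : derivable (fun z : C => ii + z) z 1.
  by apply: derivableD; [exact: derivable_cst|exact: derivable_id].
have d3 : derivable (fun z : C => (ii + z)^-1) z 1 by apply: derivableV; [exact: n0|exact: d2].
have d4 : derivable (fun z : C => (ii - z) / (ii + z)) z 1 by exact: (derivableM d1 d3).
exact: (derivableM (@derivable_cst _ _ _ w z 1) d4).
Qed.

Lemma cayley_inverse_small w d : cabs w = 1 -> 0 < d -> exists2 e : R, 0 < e &
  forall v, cabs (v - w) < e -> cabs (cayley_inverse w v) < d.
Proof.
move=> w1 d0; exists (Num.min 1 d); first by rewrite lt_min ltr01.
move=> v; rewrite lt_min cabsC => /andP[v1 v2].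
have h : 1 < cabs (w + v).
  have := cabsB (2 * w) (w - v).
  have -> : 2 * w - (w - v) = w + v by ring.
  have -> : cabs (2 * w) = 2.
    have -> : 2 * w = w + w by ring.
    have -> : w + w = cpx 2 0 * w by apply: cpx_inj; rewrite !cE; ring.
    by rewrite cabsM cpx_real w1 mulr1 ger0_norm.
  lra.
have h0 : 0 < cabs (w + v) by lra.
rewrite /cayley_inverse cabsM cpx_imag normr1 mul1r cabsM cabsV ltr_pdivrMr //.
by apply: lt_trans v2 _; rewrite ltr_pMr.
Qed.

End Cayley.

Section SphereSeparation.
Context {R : realType}.
Local Notation C := (cplane R).

(** Stated with a neighbourhood V of each point outside, so that limits of values in W'
    are seen to lie in W. *)
Lemma sphere_regular (p : sphere R) (W : set (sphere R)) : nbhs p W ->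
  exists2 W' : set (sphere R), nbhs p W' &
    forall x, ~ W x -> exists2 V : set (sphere R), nbhs x V & V `&` W' = set0.
Proof.
case: p => [q|].
  move=> /nbhs_Some[r r0 hr]; have r2 : 0 < r / 2 by rewrite divr_gt0.
  exists (Some @` disk q (r / 2)).
    by apply/nbhs_Some; exists (r / 2) => // z hz; exists z.
  move=> [z nW|_].
    have zr : r <= cabs (z - q) by rewrite leNgt; apply/negP => h; apply: nW; exact: hr.
    exists (Some @` disk z (r / 2)).
      by apply/nbhs_Some; exists (r / 2) => // v hv; exists v.
    rewrite -subset0 => _ [[v hv <-] [v' hv' [E]]]; rewrite E {v' E} /disk /= in hv' hv.
    by have := cabs_triangle v z q; rewrite [cabs (z - v)]cabsC; lra.
  exists [set x | if x is Some z then cabs q + r < cabs z else True].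
    by apply/nbhs_None; split => //; exists (cabs q + r).
  rewrite -subset0 => _ [/[swap] [[v hv <-]]] /= h.
  by rewrite /disk /= in hv; have := cabsB v q; lra.
move=> /nbhs_None[W0 [r hr]].
exists [set x | if x is Some z then r + 1 < cabs z else True].
  by apply/nbhs_None; split => //; exists (r + 1).
move=> [z nW|//].
have zr : cabs z <= r by rewrite leNgt; apply/negP => h; apply: nW; exact: hr.
exists (Some @` disk z 1); first by apply/nbhs_Some; exists 1 => // v hv; exists v.
rewrite -subset0 => _ [[v hv <-]] /= h.
by rewrite /disk /= in hv; have := cabsB v z; lra.
Qed.

End SphereSeparation.

(** * Boundary behaviour of the inverse Riemann map *)

Section Extension.
Context {R : realType}.
Local Notation C := (cplane R).
Local Notation H := (@half_plane R).
Variables (G : set C) (phi psi : C -> C).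
Hypotheses (oG : open G) (hphi : riemann_map G phi) (hpsi : forall z, G z -> psi (phi z) = z).
Implicit Types (z w v : C) (e d t : R).

Lemma unit_diskE v : unit_disk v = (cabs v < 1) :> Prop.
Proof. by rewrite /unit_disk /= normC_cabs -[1]/((1 : R)%:C%C) ltcR. Qed.

Lemma closed_unit_diskE v : closed_unit_disk v = (cabs v <= 1) :> Prop.
Proof. by rewrite /closed_unit_disk /= normC_cabs -[1]/((1 : R)%:C%C) lecR. Qed.

Lemma riemann_inverse v : cabs v < 1 -> G (psi v) /\ phi (psi v) = v.
Proof.
rewrite -unit_diskE => Dv; have [_ [_ _ sur]] := hphi.
by have [z Gz <-] := sur v Dv; rewrite hpsi.
Qed.

Lemma riemann_disk z : G z -> cabs (phi z) < 1.
Proof. by move=> Gz; rewrite -unit_diskE; have [_ [fun_ _ _]] := hphi; exact: fun_. Qed.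

Lemma riemann_injective z w : G z -> G w -> phi z = phi w -> z = w.
Proof. by move=> Gz Gw E; rewrite -(hpsi Gz) E hpsi. Qed.

Lemma inverse_injective v w : cabs v < 1 -> cabs w < 1 -> psi v = psi w -> v = w.
Proof. by move=> /riemann_inverse[_ hv] /riemann_inverse[_ hw] E; rewrite -hv E hw. Qed.

Lemma riemann_inverse_derivable v : cabs v < 1 -> derivable psi v 1.
Proof.
move=> /riemann_inverse[Gv hv]; rewrite -hv.
exact: (inverse_derivable oG hphi.1 riemann_injective hpsi).
Qed.

Lemma riemann_inverse_continuous v : cabs v < 1 -> {for v, continuous psi}.
Proof. by move=> /riemann_inverse_derivable; exact: derivableC_continuous. Qed.

(** The limit at the origin of the half-plane, transported by a Cayley map. *)
Lemma limit_at_circle w : semi_unreachable G = set0 -> cabs w = 1 ->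
  exists p : sphere R, forall W, nbhs p W -> exists2 d : R, 0 < d &
    forall v, cabs v < 1 -> cabs (v - w) < d -> W (Some (psi v)).
Proof.
move=> reach w1; pose f : C -> C := psi \o cayley w; pose g : C -> C := cayley_inverse w \o phi.
have df z : H z -> derivable f z 1.
  move=> Hz; apply/derivable1_diffP; apply: differentiable_comp.
    by apply/derivable1_diffP; exact: cayley_derivable.
  by apply/derivable1_diffP; exact: (riemann_inverse_derivable (cayley_disk w1 Hz)).
have gK z : H z -> g (f z) = z.
  move=> Hz; rewrite /g /f /=.
  have [_ ->] := riemann_inverse (cayley_disk w1 Hz); exact: cayleyK.
have inj z z' : H z -> H z' -> f z = f z' -> z = z'.
  by move=> Hz Hz' E; rewrite -(gK z Hz) E gK.
have fG : f @` H = G.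
  apply/seteqP; split=> [_ [z Hz <-]|v Gv].
    exact: (riemann_inverse (cayley_disk w1 Hz)).1.
  have [E Hz] := cayley_inverseK w1 (riemann_disk Gv).
  by exists (g v) => //; rewrite /f /g /= E hpsi.
have [p hp] := crosscut_limit df inj.
exists p => W pW.
have reach' : semi_unreachable (f @` H) = set0 by rewrite fG.
have [d d0 hd] := boundary_limit df inj gK reach' hp pW.
have [e e0 he] := cayley_inverse_small w1 d0.
exists e => // v v1 vw; have [E Hz] := cayley_inverseK w1 v1.
by rewrite -E; apply: hd => //; exact: he.
Qed.

(** The limits at the points of the circle define the extension. A limit at a nearby point
    of the circle is a limit of values in the disk that are already under control, so
    regularity of the sphere gives continuity there. *)
Lemma extension_exists : semi_unreachable G = set0 -> extends_continuously_to_closed_disk psi.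
Proof.
move=> reach.
have ex w : exists p : sphere R, cabs w = 1 -> forall W, nbhs p W -> exists2 d : R, 0 < d &
    forall v, cabs v < 1 -> cabs (v - w) < d -> W (Some (psi v)).
  have [w1|n1] := pselect (cabs w = 1); last by exists None => /n1.
  by have [p hp] := limit_at_circle reach w1; exists p.
have [P HP] := choice ex.
pose Psi v : sphere R := if cabs v < 1 then Some (psi v) else P v.
suff cPsi w : cabs w <= 1 -> forall W, nbhs (Psi w) W -> exists2 d : R, 0 < d &
    forall v, cabs v <= 1 -> cabs (v - w) < d -> W (Psi v).
  exists Psi; split; last by move=> v; rewrite unit_diskE /Psi => ->.
  apply/subspace_continuousP => w; rewrite closed_unit_diskE => w1 W nW.
  have [d d0 hd] := cPsi w w1 W nW.
  rewrite /nbhs /= /within /=; apply/nearC; exists d => // v vw.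
  by rewrite closed_unit_diskE => v1; exact: hd.
move=> w1; rewrite {1}/Psi; have [w_lt|w_ge] := ltP (cabs w) 1; last first.
  have wE : cabs w = 1 by apply/eqP; rewrite eq_le w1.
  move=> W /sphere_regular[W' pW' sep]; have [d d0 hd] := HP w wE _ pW'.
  exists d => // v v1 vw.
  rewrite /Psi; have [v_lt|v_ge] := ltP (cabs v) 1; apply: contrapT => nW.
    have [V nV VW] := sep _ nW; have : (V `&` W') (Some (psi v)).
      by split; [exact: (nbhs_singleton nV)|exact: hd].
    by rewrite VW => -[].
  have vE : cabs v = 1 by apply/eqP; rewrite eq_le v1.
  have [V nV VW] := sep _ nW; have [d' d'0 hd'] := HP v vE _ nV.
  (* a point of the open disk on the radius through v, close to both v and w *)
  pose s : R := Num.min (1 / 2) (Num.min (d' / 2) ((d - cabs (v - w)) / 2)).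
  have s0 : 0 < s by rewrite !lt_min !divr_gt0 // subr_gt0.
  have [s1 s2 s3] : [/\ s <= 1 / 2, s <= d' / 2 & s <= (d - cabs (v - w)) / 2].
    by split; rewrite /s !ge_min lexx /= ?orbT.
  clearbody s; pose u := cpx (1 - s) 0 * v.
  have u1 : cabs u < 1 by rewrite /u cabsM cpx_real vE mulr1 ger0_norm; lra.
  have uv : cabs (u - v) = s.
    have -> : u - v = cpx (- s) 0 * v by apply: cpx_inj; rewrite /u !cE; ring.
    by rewrite cabsM cpx_real vE mulr1 normrN gtr0_norm.
  have : (V `&` W') (Some (psi u)).
    split; first by apply: hd' => //; lra.
    by apply: hd => //; have := cabs_triangle v u w; lra.
  by rewrite VW => -[].
move=> W /nbhs_Some[r r0 hr].
have [d d0 hd] := (continuousC psi w).1 (riemann_inverse_continuous w_lt) r r0.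
exists (Num.min d (1 - cabs w)); first by rewrite lt_min d0 subr_gt0.
move=> v _; rewrite lt_min => /andP[vd vw].
rewrite /Psi; have -> : cabs v < 1 by have := cabsB v w; lra.
by apply: hr; exact: hd.
Qed.

(** Let l be semi-unreachable through U. Points of U tending to l have images in the disk
    that cluster at a point w, where the extension takes the value l, and w is on the
    circle since l is not in G. Near w the inverse map has values close to l, where U has
    no boundary inside G; so, by connectedness, these values are all in U. The image of a
    radius ending at w is then an arc in U that lands at l, and l is accessible from U. *)
Lemma no_semi_unreachable : extends_continuously_to_closed_disk psi -> semi_unreachable G = set0.
Proof.
move=> [Psi [cPsi PsiE]]; rewrite -subset0 => l [[_ nGl] [U [[[_ oU _] _] UG [bU naU] far]]].
have Gl : ~ G l by move=> Gl; apply: nGl; exact: open_nbhs_nbhs.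
have Ul : ~ U l by move=> /UG.
have PE v : cabs v < 1 -> Psi v = Some (psi v) by move=> v1; apply: PsiE; rewrite unit_diskE.
have cP v : cabs v <= 1 -> forall W, nbhs (Psi v) W -> exists2 d : R, 0 < d &
    forall v', cabs v' <= 1 -> cabs (v' - v) < d -> W (Psi v').
  move=> v1 W nW; move/subspace_continuousP: cPsi => /(_ v); rewrite closed_unit_diskE.
  move=> /(_ v1 W nW); rewrite /nbhs /= /within /= => /nearC[d d0 hd].
  by exists d => // v' v'1 v'v; apply: hd => //; rewrite closed_unit_diskE.
have [e e0 he] : exists2 e : R, 0 < e & forall v, cabs (v - l) < e -> G v -> ~ boundary U v.
  apply: contrapT => no; apply: far => B /nbhs_disk[e e0 eB]; apply: contrapT => nB; apply: no.
  by exists e => // v vl Gv bv; apply: nB; exists v; split => //; exact: eB.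
have ex n : exists v, U v /\ cabs (v - l) < n.+1%:R^-1.
  have n0 : 0 < n.+1%:R^-1 :> R by rewrite invr_gt0.
  by have [v [Uv vl]] := bU.1 _ (disk_nbhs l n0); exists v.
have [u Hu] := choice ex.
have [|w] := @sequence_cluster _ _ (phi \o u) (@compact_cdisk R 0 1).
  by move=> n; rewrite /= subr0; apply: ltW; apply: riemann_disk; apply: UG; have [] := Hu n.
rewrite /= subr0 => w1 clw.
have Psiw : Psi w = Some l.
  apply: contrapT => ne.
  have [W nW [r r0 hr]] := separate_from_point (fun E => ne (esym E)).
  have [d d0 hd] := cP w w1 W nW.
  have [k small] := reciprocals_small r0.
  have [n kn hn] := clw _ (disk_nbhs w d0) k.
  have [Un ul] := Hu n; have Gn := UG _ Un; have p1 := riemann_disk Gn.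
  have Wn := hd _ (ltW p1) hn; rewrite (PE _ p1) /= (hpsi Gn) in Wn.
  have := hr _ Wn; rewrite leNgt => /negP; apply.
  exact: lt_trans ul (small n kn).
have wE : cabs w = 1.
  apply/eqP; rewrite eq_le w1 leNgt; apply/negP => w_lt.
  by have := PE w w_lt; rewrite Psiw => -[E]; apply: Gl; rewrite E; exact: (riemann_inverse w_lt).1.
have nWl : nbhs (Psi w) (Some @` disk l e).
  by rewrite Psiw; apply/nbhs_Some; exists e => // z hz; exists z.
have [d d0 hd] := cP w w1 _ nWl.
pose N v := cabs v < 1 /\ cabs (v - w) < d.
have NB v : N v -> cabs (psi v - l) < e.
  by move=> [v1 vw]; have := hd v (ltW v1) vw; rewrite (PE _ v1) => -[z hz [<-]].
have [n _ hn] := clw _ (disk_nbhs w d0) 0%N.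
have [Un _] := Hu n; have Gn := UG _ Un.
have Nn : N (phi (u n)) by split; [exact: riemann_disk|exact: hn].
have NU v : N v -> U (psi v).
  move=> Nv; pose sg := segment (phi (u n)) v; pose A := (psi \o sg) @` `[0, 1]%classic.
  have sgN t : 0 <= t <= 1 -> N (sg t).
    move=> /andP[t0 t1].
    have conv c r : cabs (phi (u n) - c) < r -> cabs (v - c) < r -> cabs (sg t - c) < r.
      move=> h1 h2.
      have -> : sg t - c = cpx (1 - t) 0 * (phi (u n) - c) + cpx t 0 * (v - c).
        by rewrite /sg /segment; apply: cpx_inj; rewrite !cE; ring.
      apply: le_lt_trans (cabsD _ _) _; rewrite !cabsM !cpx_real !ger0_norm; [|lra|lra].
      have [->|tn] := eqVneq t 0; first by rewrite subr0 mul1r mul0r addr0.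
      have tp : 0 < t by rewrite lt_neqAle eq_sym tn.
      have a1 : t * cabs (v - c) < t * r by rewrite ltr_pM2l.
      have a2 : (1 - t) * cabs (phi (u n) - c) <= (1 - t) * r.
        by apply: ler_wpM2l; [rewrite subr_ge0|exact: ltW].
      have -> : r = (1 - t) * r + t * r by ring.
      exact: ler_ltD.
    split; last by apply: conv; [exact: Nn.2|exact: Nv.2].
    by rewrite -[sg t]subr0; apply: conv; rewrite subr0; [exact: Nn.1|exact: Nv.1].
  have cA : connected A.
    apply: connected_continuous_connected; first exact: segment_connected.
    apply: continuous_in_subspaceT => t; rewrite inE /= in_itv /= => ht.
    apply: (@continuous_comp _ _ _ sg psi); first exact: segment_continuous.
    exact: riemann_inverse_continuous (sgN t ht).1.
  have AU : A `&` U = A.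
    apply: cA.
    - exists (u n); split; last exact: Un.
      exists 0; first by rewrite /= in_itv /= lexx ler01.
      by rewrite /= /sg segment0 hpsi.
    - by exists U.
    - exists (closure U); first exact: closed_closure.
      apply/seteqP; split=> x [Ax hx]; split; [exact: Ax|exact: subset_closure|exact: Ax|].
      have [t /=] := Ax; rewrite in_itv /= => ht tx.
      apply: contrapT => nUx; apply: (he x).
      + by rewrite -tx; exact: NB (sgN t ht).
      + by rewrite -tx; exact: (riemann_inverse (sgN t ht).1).1.
      + by split; [exact: hx|move=> /nbhs_singleton; exact: nUx].
  have : A (psi v).
    exists 1; first by rewrite /= in_itv /= lexx ler01.
    exact: (congr1 psi (segment1 _ _)).
  by rewrite -AU => -[].
pose a : R := 1 - Num.min d 1 / 2.
have [ad a0 a1] : [/\ 1 - a < d, 0 < a & a < 1].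
  have m0 : 0 < Num.min d 1 by rewrite lt_min d0 ltr01.
  have m1 : Num.min d 1 <= d by rewrite ge_min lexx.
  have m2 : Num.min d 1 <= 1 by rewrite ge_min lexx orbT.
  by rewrite /a; move: (Num.min d 1) m0 m1 m2 => m *; split; lra.
clearbody a.
pose k t := if t < 1 then psi (cpx t 0 * w) else l.
have tw t : 0 <= t -> cabs (cpx t 0 * w) = t.
  by move=> t0; rewrite cabsM cpx_real wE mulr1 ger0_norm.
have kN t : a <= t -> t < 1 -> N (cpx t 0 * w).
  move=> ta t1; have t0 : 0 <= t := le_trans (ltW a0) ta.
  have dt : 1 - t < d by apply: le_lt_trans ad; rewrite lerB.
  split; first by rewrite (tw _ t0).
  have -> : cpx t 0 * w - w = cpx (t - 1) 0 * w by apply: cpx_inj; rewrite !cE; ring.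
  rewrite cabsM cpx_real wE mulr1 distrC ger0_norm; first exact: dt.
  by rewrite subr_ge0 ltW.
have kU t : a <= t -> t < 1 -> U (k t).
  by move=> ta t1; rewrite /k t1; apply: NU; exact: kN.
have kP t : a <= t <= 1 -> Psi (cpx t 0 * w) = Some (k t).
  move=> /andP[ta t1]; have t0 : 0 <= t := le_trans (ltW a0) ta.
  rewrite /k; have [t_lt|t_ge] := ltP t 1.
    by apply: PE; rewrite (tw _ t0).
  have -> : t = 1 by apply/eqP; rewrite eq_le t1.
  by have -> : cpx 1 0 * w = w by apply: cpx_inj; rewrite !cE; ring.
apply: naU; split; first exact: bU.
exists (k @` `[a, 1]%classic); split.
- exists a, 1, k; split; [exact: a1| | |reflexivity].
    apply/subspace_continuousP => t; rewrite /= in_itv /= => ht B /nbhs_disk[r r0 rB].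
    have t1 : cabs (cpx t 0 * w) <= 1 by case/andP: ht => ta t1; rewrite (tw _ (le_trans (ltW a0) ta)).
    have [|d' d'0 hd'] := cP _ t1 (Some @` disk (k t) r).
      by rewrite (kP _ ht); apply/nbhs_Some; exists r => // z hz; exists z.
    rewrite /nbhs /= /within /=; apply/nbhs_ballP; exists d'; first exact: d'0.
    move=> s.
    rewrite /ball /= => st; rewrite in_itv /= => hs.
    have s1 : cabs (cpx s 0 * w) <= 1 by case/andP: hs => sa s1; rewrite (tw _ (le_trans (ltW a0) sa)).
    have sd : cabs (cpx s 0 * w - cpx t 0 * w) < d'.
      have -> : cpx s 0 * w - cpx t 0 * w = cpx (s - t) 0 * w by apply: cpx_inj; rewrite !cE; ring.
      by rewrite cabsM cpx_real wE mulr1 distrC.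
    have := hd' _ s1 sd; rewrite (kP _ hs) => -[z hz [zk]]; apply: rB.
    by rewrite zk in hz; exact: hz.
  move=> s t; rewrite !inE /= !in_itv /= => /andP[sa s1] /andP[ta t1] E.
  have [s_lt|s_ge] := ltP s 1; have [t_lt|t_ge] := ltP t 1.
  + move: E; rewrite /k s_lt t_lt => E.
    have := inverse_injective (kN s sa s_lt).1 (kN t ta t_lt).1 E.
    move/(mulIf (unit_circle_neq0 wE)) => /(congr1 (@cre R)); rewrite !cre_cpx; exact.
  + by exfalso; apply: Ul; have := kU s sa s_lt; rewrite E /k ltNge t_ge.
  + by exfalso; apply: Ul; have := kU t ta t_lt; rewrite -E /k ltNge s_ge.
  + by apply/eqP; rewrite eq_le (le_trans s1) ?(le_trans t1).
- move=> _ [t ht <-]; move: ht; rewrite /= in_itv /= => /andP[ta t1].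
  have [t_lt|t_ge] := ltP t 1; first by apply: subset_closure; exact: kU.
  have -> : k t = l by rewrite /k ltNge t_ge.
  exact: bU.1.
apply/seteqP; split=> [_ [[t ht <-] bk]|_ ->].
  move: ht; rewrite /= in_itv /= => /andP[ta t1].
  have [t_lt|t_ge] := ltP t 1; last by rewrite /k ltNge t_ge.
  by exfalso; apply: bk.2; apply: open_nbhs_nbhs; split; [exact: oU|exact: kU].
split; last exact: bU.
exists 1; first by rewrite /= in_itv /= lexx (ltW a1).
by rewrite /k ltxx.
Qed.

End Extension.

Theorem theorem1 (R : realType) (G : set (cplane R))
    (hG : simply_connected_domain G)
    (hbd : ~ exists p : sphere R, sphere_boundary G = [set p])
    (phi psi : cplane R -> cplane R)
    (hphi : riemann_map G phi)
    (hpsi : forall z, G z -> psi (phi z) = z) :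
  extends_continuously_to_closed_disk psi <-> semi_unreachable G = set0.
Proof.
have [[_ oG _] _] := hG.
by split; [exact: (no_semi_unreachable oG hphi hpsi)|exact: (extension_exists oG hphi hpsi)].
Qed.
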